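(* Assume that there exist $m$ processes $Y^i:=(Y^i_t)_{t\ge 0}$, $i=1,\dots,m$, belonging to $\mathcal S^2$, such that for every $i\in\mathcal I$ $$\forall t\ge 0,\quad e^{-rt}Y^i_t=\operatorname*{ess\,sup}_{\tau\ge t}E\Big[\int_t^\tau e^{-rs}\psi_i(X_s)\,ds+e^{-r\tau}\max_{j\in\mathcal I^{-i}}\big(-g_{ij}(X_\tau)+Y^j_\tau\big)\,\Big|\,\mathcal F_t\Big],\qquad \lim_{t\to+\infty}e^{-rt}Y^i_t=0,$$ where the essential supremum is over all stopping times $\tau\ge t$. Then: (i) $Y^1_0=\sup_{(\delta,\xi)\in\mathcal D}J(\delta,\xi)$. (ii) Define $\delta^*=(\tau^*_n)_{n\ge1}$ and the modes $u_{\tau^*_n}$ (equivalently $\xi^*_n$), $n\ge 1$, recursively by $$\tau^*_1=\inf\Big\{s\ge 0:\ Y^1_s=\max_{j\in\mathcal I^{-1}}(-g_{1j}(X_s)+Y^j_s)\Big\},$$ $$\tau^*_n=\inf\Big\{s\ge\tau^*_{n-1}:\ Y^{u_{\tau^*_{n-1}}}_s=\max_{k\in\mathcal I\setminus\{u_{\tau^*_{n-1}}\}}\big(-g_{u_{\tau^*_{n-1}}k}(X_s)+Y^k_s\big)\Big\},\quad n\ge2,$$ where $u_{\tau^*_1}=j$ on the set $\{\max_{k\in\mathcal I^{-1}}(-g_{1k}(X_{\tau^*_1})+Y^k_{\tau^*_1})=-g_{1j}(X_{\tau^*_1})+Y^j_{\tau^*_1}\}$; for $n\ge1$ and $t\ge\tau^*_n$,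 $Y^{u_{\tau^*_n}}_t=\sum_{j\in\mathcal I}1_{\{u_{\tau^*_n}=j\}}Y^j_t$; and for $n\ge2$, $u_{\tau^*_n}=l$ on the set $$\Big\{\max_{k\in\mathcal I\setminus\{u_{\tau^*_{n-1}}\}}\big(-g_{u_{\tau^*_{n-1}}k}(X_{\tau^*_n})+Y^k_{\tau^*_n}\big)=-g_{u_{\tau^*_{n-1}}l}(X_{\tau^*_n})+Y^l_{\tau^*_n}\Big\},$$ with $g_{u_{\tau^*_{n-1}}k}(X_{\tau^*_n})=\sum_{j\in\mathcal I}1_{\{u_{\tau^*_{n-1}}=j\}}g_{jk}(X_{\tau^*_n})$ (in case of ties one maximizing index is selected measurably). Then the strategy $(\delta^*,u^* )$ satisfies $E\big[\sum_{n\ge0}e^{-r\tau^*_n}\big]<+\infty$ and it is optimal, i.e. $J(\delta^*,u^* )\ge J(\delta,u)$ for every $(\delta,u)\in\mathcal D$.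
   Context: Let $(\Omega,\mathcal F,P)$ be a probability space carrying a standard $d$-dimensional Brownian motion $B$, and let $\mathbf F=(\mathcal F_t)_{t\ge0}$ be the natural filtration of $B$ completed with the $P$-null sets of $\mathcal F$. Stopping times are $\mathbf F$-stopping times, with values possibly $+\infty$. $\mathcal S^2$ is the set of progressively measurable continuous processes $w$ with $E[\sup_{t\ge0}|w_t|^2]<\infty$; $\mathcal M^{2,k}$ is the set of progressively measurable $\mathbb R^k$-valued processes $w$ with $E[\int_0^\infty|w_s|^2ds]<\infty$. Data: $\mathcal I=\{1,\dots,m\}$, $\mathcal I^{-i}=\mathcal I\setminus\{i\}$; $r>0$ is a discount factor; $X=(X_t)_{t\ge0}$ is a progressively measurable continuous $\mathbb R^k$-valued process; for $i\ne j$, $g_{ij}:\mathbb R^k\to\mathbb R$ is continuous and there is $\alpha>0$ with $\frac1\alpha\le g_{ij}(x)\le\alpha$ for all $x$; for $i\in\mathcal I$, $\psi_i:\mathbb R^k\to\mathbb R$ is continuous with $|\psi_i(x)|\le C(1+|x|^\gamma)$ for some constants $C,\gamma$. It is assumed that $(e^{-rt}\psi_i(X_t))_{t\ge0}\in\mathcal M^{2,1}$ for every $i$. Strategies: $\mathcal D$ is the set of pairs $(\delta,\xi)=((\tau_n)_{n\ge1},(\xi_n)_{n\ge1})$, where $(\tau_n)$ is a nondecreasing sequence of stopping times and $\xi_n$ is an $\mathcal F_{\tau_n}$-measurable $\mathcal I$-valued random variable, the mode to which the system is switched at $\tau_n$ (a switch is from the current mode to another one). The system starts in mode $1$ at time $0$,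 and its mode at time $t$ is $$u_t=1_{[0,\tau_1]}(t)+\sum_{n\ge1}\xi_n1_{(\tau_n,\tau_{n+1}]}(t).$$ In subscripts, $u_{\tau_n}$ denotes the mode $\xi_n$ chosen at $\tau_n$, with $\tau_0=0$ and $u_{\tau_0}=1$. Since $(\delta,\xi)$ and $(\delta,u)$ determine each other, both notations are used for the same strategy. The expected total profit is $$J(\delta,\xi)=J(\delta,u)=E\Big[\int_0^{+\infty}e^{-rs}\psi_{u_s}(X_s)\,ds-\sum_{n\ge1}e^{-r\tau_n}g_{u_{\tau_{n-1}}u_{\tau_n}}(X_{\tau_n})\Big].$$ Conventions: $\inf\emptyset=+\infty$, and terms of the form $e^{-r\tau}(\cdots)$ are $0$ on $\{\tau=+\infty\}$.
   Formalization: Adds that for each i the positive or the negative part of e^{-rs}ψ_i(X_s) has finite integral over ds×dP; membership in M^{2,1} does not imply this, and without it E[Σ e^{-rτ*_n}] can be infinite. *)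

(* Defs.v *)
From HB Require Import structures.
From mathcomp Require Import all_boot all_order all_algebra.
From mathcomp Require Import all_classical all_reals all_analysis.
From mathcomp Require Import measurable_realfun.
Import Order.TTheory GRing.Theory Num.Theory.
Import numFieldNormedType.Exports.
Set Implicit Arguments.
Unset Strict Implicit.
Unset Printing Implicit Defensive.
Local Open Scope classical_set_scope.
Local Open Scope ring_scope.
Local Open Scope ereal_scope.

(* Processes are functions of a time [t : R] and an outcome; only times
   [0 <= t] are ever used.  Filtrations [F] give, for each [t], a sigma-algebra
   [F t], turned into a measurable type by [g_sigma_algebraType]. *)

Section stochastic_processes.
Context d (T : measurableType d) (R : realType) (P : probability T R).
Implicit Types (F : R -> set_system T) (G : set_system T).

(* Events observed from the coordinates of [B] up to time [t]. *)
Definition observed_events n (B : R -> T -> 'rV[R]_n) (t : R) : set_system T :=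
  [set E | exists s : R, exists j : 'I_n, exists A : set R,
    [/\ (0 <= s <= t)%R, measurable A & E = [set w | A (B s w ord0 j)]]].

(* Increments over [s, t] are independent of the past of [B] up to [s] and
   have i.i.d. N(0, t - s) coordinates; boxes are a pi-system generating the
   Borel sets.  The second parameter of [normal_prob] is a standard
   deviation. *)
Definition brownian_motion n (B : R -> T -> 'rV[R]_n) :=
  [/\ forall t (j : 'I_n), (0 <= t)%R ->
        measurable_fun setT (fun w => B t w ord0 j),
      {ae P, forall w, B 0%R w = 0%R},
      forall w, {within `[0%R, +oo[, continuous (fun t => B t w)} &
      forall (s t : R) (E : set T) (A : 'I_n -> set R),
        (0 <= s < t)%R -> <<s observed_events B s >> E ->
        (forall j, measurable (A j)) ->
        P (E `&` [set w | forall j, A j (B t w ord0 j - B s w ord0 j)%R]) =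
        P E * \prod_(j < n) normal_prob 0%R (Num.sqrt (t - s)) (A j)].

Definition completed_filtration n (B : R -> T -> 'rV[R]_n) (t : R)
    : set_system T :=
  <<s observed_events B t `|` [set N | measurable N /\ P N = 0] >>.

Definition progressive F d' (U : measurableType d') (Z : R -> T -> U) :=
  forall t : R, (0 <= t)%R ->
    measurable_fun (`[0%R, t]%classic `*` setT)
      (fun z : R * g_sigma_algebraType (F t) => Z z.1 z.2).

Definition continuous_process (U : topologicalType) (Z : R -> T -> U) :=
  forall w, {within `[0%R, +oo[, continuous (fun t => Z t w)}.

Definition spaceS2 F (Z : R -> T -> R) :=
  [/\ progressive F Z, continuous_process Z &
      \int[P]_w ereal_sup [set (`|Z t w| ^+ 2)%:E | t in `[0%R, +oo[] < +oo].

Definition spaceM2 F (Z : R -> T -> R) :=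
  progressive F Z /\
  \int[P]_w \int[lebesgue_measure]_(s in `[0%R, +oo[)
    (`|Z s w| ^+ 2)%:E < +oo.

Definition stopping_time F (tau : T -> \bar R) :=
  (forall w, 0 <= tau w) /\
  (forall t : R, (0 <= t)%R -> F t [set w | tau w <= t%:E]).

(* The sigma-algebra of events prior to [tau]. *)
Definition stopped_sigma F (tau : T -> \bar R) : set_system T :=
  [set A | measurable A /\
    forall t : R, (0 <= t)%R -> F t (A `&` [set w | tau w <= t%:E])].

Definition is_cond_exp_ge0 G (xi V : T -> \bar R) :=
  [/\ measurable_fun setT (V : g_sigma_algebraType G -> \bar R),
      forall w, 0 <= V w &
      forall A, G A -> \int[P]_(w in A) V w = \int[P]_(w in A) xi w].

(* [V] is a version of E[xi | G] = E[xi^+ | G] - E[xi^- | G]; [xi] need not be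
   integrable, so that infinite values are allowed. *)
Definition is_cond_exp G (xi V : T -> \bar R) :=
  exists Vp Vn, [/\ is_cond_exp_ge0 G (xi^\+) Vp,
    is_cond_exp_ge0 G (xi^\-) Vn & forall w, V w = Vp w - Vn w].

(* Essential supremum of a family of random variables (the library's [ess_sup]
   is that of a single function). *)
Definition is_ess_sup (Z : T -> \bar R) (V : set (T -> \bar R)) :=
  [/\ measurable_fun setT Z,
      forall v, V v -> {ae P, forall w, v w <= Z w} &
      forall Z', measurable_fun setT Z' ->
        (forall v, V v -> {ae P, forall w, v w <= Z' w}) ->
        {ae P, forall w, Z w <= Z' w}].

End stochastic_processes.

(* [stime s n] and [smode s n] are the n-th switching time and the mode chosen
   then; index 0 stands for the start (time 0, initial mode). *)
Record strategy (T : Type) (R : realType) (m : nat) := Strategy {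
  stime : nat -> T -> \bar R ;
  smode : nat -> T -> 'I_m }.

Section switching.
Context d (T : measurableType d) (R : realType) (P : probability T R).
Context (F : R -> set_system T) (m k : nat) (r : R) (X : R -> T -> 'rV[R]_k).
Context (psi : 'I_m -> 'rV[R]_k -> R) (g : 'I_m -> 'I_m -> 'rV[R]_k -> R).
Context (i1 : 'I_m).
Implicit Types (s : strategy T R m) (tau : T -> \bar R).

(* exp (- r tau); it is 0 where [tau = +oo], as [expeR -oo = 0]. *)
Definition discount (tau : \bar R) : \bar R := expeR (- (r%:E * tau)).

Definition discounted_profit (i : 'I_m) (t : R) (w : T) : R :=
  (expR (- (r * t)) * psi i (X t w))%R.

Definition admissible s :=
  [/\ (forall w, stime s 0 w = 0) /\ (forall w, smode s 0 w = i1),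
      forall n, stopping_time F (stime s n),
      forall n w, stime s n w <= stime s n.+1 w,
      forall n j, stopped_sigma F (stime s n) [set w | smode s n w = j] &
      forall n w, stime s n.+1 w < +oo -> smode s n.+1 w != smode s n w].

Definition in_phase s (n : nat) (t : R) (w : T) : Prop :=
  if n is 0 then 0 <= t%:E <= stime s 1 w
  else stime s n w < t%:E <= stime s n.+1 w.

(* The mode u_t; the phases are disjoint, and there is no mode at times beyond
   the limit of the switching times. *)
Definition mode s (t : R) (w : T) : option 'I_m :=
  xget None [set o | exists2 n, in_phase s n t w & o = Some (smode s n w)].

Definition profit_rate (o : option 'I_m) (x : 'rV[R]_k) : R :=
  if o is Some i then psi i x else 0%R.

Definition total_profit s : \bar R :=
  \int[P]_w (\int[lebesgue_measure]_(t in `[0%R, +oo[)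
               (expR (- (r * t)) * profit_rate (mode s t w) (X t w))%:E
             - \sum_(1 <= n <oo) discount (stime s n w) *
               (g (smode s n.-1 w) (smode s n w)
                  (X (fine (stime s n w)) w))%:E).

Context (Y : 'I_m -> R -> T -> R).

(* max over the modes j <> i of - g_ij(X_t) + Y^j_t *)
Definition switch_value (i : 'I_m) (t : R) (w : T) : \bar R :=
  \big[maxe/-oo]_(j < m | j != i) (- g i j (X t w) + Y j t w)%:E.

(* Where [tau = +oo] the second term is 0, whatever the value of [fine]. *)
Definition stopping_payoff (i : 'I_m) (t : R) tau (w : T) : \bar R :=
  \int[lebesgue_measure]_(s in [set s : R | (t <= s)%R /\ s%:E <= tau w])
    (discounted_profit i s w)%:E
  + discount (tau w) * switch_value i (fine (tau w)) w.

Definition solves_switching_system :=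
  forall i : 'I_m,
  [/\ spaceS2 P F (Y i),
      forall t : R, (0 <= t)%R ->
        is_ess_sup P (fun w => (expR (- (r * t)) * Y i t w)%:E)
          [set V | exists tau, [/\ stopping_time F tau,
             forall w, t%:E <= tau w &
             is_cond_exp P (F t) (stopping_payoff i t tau) V]] &
      {ae P, forall w, (expR (- (r * t)) * Y i t w)%R @[t --> +oo%R] --> 0%R}].

(* The recursively defined strategy; its modes are any measurable selection of
   maximizing indices. *)
Definition hitting_strategy s :=
  [/\ (forall w, stime s 0 w = 0) /\ (forall w, smode s 0 w = i1),
      forall n w, stime s n.+1 w =
        ereal_inf [set t%:E | t in [set t : R | stime s n w <= t%:E /\
          (Y (smode s n w) t w)%:E = switch_value (smode s n w) t w]],
      forall n w, stime s n.+1 w < +oo ->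
        let i := smode s n w in let j := smode s n.+1 w in
        let t := fine (stime s n.+1 w) in
        j != i /\ switch_value i t w = (- g i j (X t w) + Y j t w)%:E &
      forall n j, stopped_sigma F (stime s n.+1)
        [set w | smode s n.+1 w = j]].

(* The integral of the discounted profit of mode [i] over time and outcomes is
   well defined in [-oo, +oo], i.e. not of the form +oo - oo.  On an infinite
   horizon this does not follow from square integrability. *)
Definition well_defined_profit (i : 'I_m) :=
  \int[P]_w \int[lebesgue_measure]_(s in `[0%R, +oo[)
    (Num.max (discounted_profit i s w) 0)%:E < +oo \/
  \int[P]_w \int[lebesgue_measure]_(s in `[0%R, +oo[)
    (Num.max (- discounted_profit i s w) 0)%:E < +oo.

End switching.

(* Main.v *)
(* For each mode [i], the process [int_0^t e^(-rs) psi_i(X_s) ds + e^(-rt) Y^i_t]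
   is a supermartingale lying above the obstacle, because gains of stopping
   times can be pasted along events of [F t].  It is a martingale until [Y^i]
   first meets the obstacle: stopping times that are optimal up to [2^-k] stop,
   almost surely in the limit, where the gap to the obstacle vanishes, hence not
   before that hitting time.

   Gluing these processes along a strategy, every switch raises the value by
   at most the cost paid for it.  So, up to the [n]-th switch and time [n], the
   expected net profit plus the expected remaining value is at most [E Y^1_0],
   with equality for the hitting strategies.  Income and losses are monotone in
   [n].  If the total losses have infinite expectation, the profit is [-oo].
   Otherwise, costs being bounded below, the switching times tend to infinity,
   the remaining value vanishes, and the inequality passes to the limit.
   Finally [Y^1_0] is almost surely constant since the completed filtration is
   trivial at time 0. *)
Require Import Defs.
From HB Require Import structures.
From mathcomp Require Import all_boot all_order all_algebra.
From mathcomp Require Import all_classical all_reals all_analysis.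
From mathcomp Require Import measurable_realfun.
From mathcomp Require Import ring lra.
Import Order.TTheory GRing.Theory Num.Theory.
Import numFieldNormedType.Exports.
Set Implicit Arguments.
Unset Strict Implicit.
Unset Printing Implicit Defensive.
Local Open Scope classical_set_scope.
Local Open Scope ring_scope.
Local Open Scope ereal_scope.

(** The obstacle is integrability. The essential supremum ranges over stopping times with possibly
    infinite values, whose payoffs may fail to be integrable, whereas pasting and sampling need
    finite expectations. Hence nearly all work is done with times cut at a deterministic horizon,
    where square integrability of the profit gives integrable bounds; [cond_payoff_le] shows that
    the uncut times do not raise the supremum. It rests on [fpos_tot_lty]: the positive part of the
    running profit has finite total expectation, either by assumption or because the value is
    integrable. The same fact keeps the profit of every strategy away from [+oo].

    Martingale properties are tested on events, as signs of expectations of [\1_A] times an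
    increment. Optional sampling asks for the sign only on events where the deterministic time lies
    between the two stopping times, so that one lemma serves for the supermartingale and for its
    stopped negative.

    For strategies, one exact balance carries two correction terms of known sign, [jump] and
    [slack]; it yields the inequality in general and the equality when both have mean 0. *)

(** * Continuous processes evaluated at random times *)

Section caratheodory.
Local Open Scope ring_scope.
Context {R : realType}.

Lemma cvg_floor_grid (x : R) :
  (Num.floor (x * n.+1%:R))%:~R / n.+1%:R @[n --> \oo] --> x.
Proof.
apply: (@squeeze_cvgr _ _ _ _ (fun n => x - n.+1%:R^-1) (fun=> x)).
- near=> n.
  have n0 : (0 < n.+1%:R :> R) by rewrite ltr0n.
  have /andP[h1 h2] := floor_itv (x * n.+1%:R).
  rewrite ler_pdivrMr// h1 andbT ler_pdivlMr// mulrBl mulVf ?gt_eqF//.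
  by move: h2; rewrite intrD => h2; lra.
- rewrite -[X in _ --> X]subr0.
  by apply: cvgB; [exact: cvg_cst | exact: cvg_harmonic].
- exact: cvg_cst.
Unshelve. all: end_near. Qed.

(** Replacing the time by the fraction with denominator [n+1] just below it turns preimages into
    countable unions of rectangles; continuity in time makes these approximations converge
    pointwise. *)
Lemma measurable_caratheodory d (U : measurableType d) (M : R -> U -> R) :
  (forall w, continuous (M^~ w)) -> (forall t, measurable_fun setT (M t)) ->
  measurable_fun setT (fun z : R * U => M z.1 z.2).
Proof.
move=> Mc Mm.
pose h n (z : R * U) := M ((Num.floor (z.1 * n.+1%:R))%:~R / n.+1%:R) z.2.
apply: (@measurable_fun_cvg _ _ _ _ h) => //.
  move=> n _ B mB; rewrite setTI.
  have -> : h n @^-1` B = \bigcup_(k : int)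
     ([set x | Num.floor (x * n.+1%:R) = k] `*`
      (M (k%:~R / n.+1%:R) @^-1` B)).
    apply/seteqP; split => [z hz|z [k _ [/= zk hz]]].
      by exists (Num.floor (z.1 * n.+1%:R)).
    by rewrite /preimage/= /h zk.
  apply: countable_bigcupT_measurable => [|k]; first exact: countableP.
  apply: measurableX; last by rewrite -[X in measurable X]setTI; exact: Mm.
  rewrite (_ : [set _ | _] = (fun x : R => x * n.+1%:R) @^-1`
     `[k%:~R, (k + 1)%:~R[%classic).
    rewrite -[X in measurable X]setTI.
    by apply: mulrr_measurable.
  apply/seteqP; split => x /=; rewrite in_itv/=.
    by move=> /eqP; rewrite floor_eq.
  by move=> xk; apply/eqP; rewrite floor_eq.
move=> z _; apply: (@cvg_comp _ _ _ _ (M^~ z.2) _ (nbhs (z.1 : R))).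
  exact: cvg_floor_grid.
exact: Mc.
Qed.

Lemma measurable_eval d (U : measurableType d) (M : R -> U -> R) (tau : U -> R) :
  (forall w, continuous (M^~ w)) -> (forall t, measurable_fun setT (M t)) ->
  measurable_fun setT tau -> measurable_fun setT (fun w => M (tau w) w).
Proof.
move=> Mc Mm mt.
have mp : measurable_fun setT (fun w => (tau w, w)).
  exact: measurable_fun_pair.
exact: (measurableT_comp (measurable_caratheodory Mc Mm) mp).
Qed.

End caratheodory.

(** * Expectations of real random variables *)

Section expectation.
Local Open Scope ring_scope.
Context d (T : measurableType d) (R : realType) (P : probability T R).
Implicit Types (Z : T -> R) (H : T -> \bar R) (A : set T).

Local Notation itg Z := (P.-integrable setT (EFin \o Z)).

Lemma itg_measurable Z : itg Z -> measurable_fun setT Z.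
Proof. by move=> /measurable_int /measurable_EFinP. Qed.

Lemma itg_dom Z H : measurable_fun setT Z -> P.-integrable setT H ->
  (forall w, (`|Z w|%:E <= H w)%E) -> itg Z.
Proof.
move=> mZ iH ZH; apply: le_integrable iH => //; first exact/measurable_EFinP.
by move=> w _ /=; rewrite (le_trans (ZH w))// lee_abs.
Qed.

Lemma itg_domR Z Z' : measurable_fun setT Z -> itg Z' ->
  (forall w, `|Z w| <= Z' w) -> itg Z.
Proof. by move=> mZ iZ ZZ; apply: itg_dom iZ _ => // w /=; rewrite lee_fin. Qed.

Lemma itg_dom_ae Z H : measurable_fun setT Z -> P.-integrable setT H ->
  {ae P, forall w, (`|Z w|%:E <= H w)%E} -> itg Z.
Proof.
move=> mZ iH ZH; apply/integrableP; split; first exact/measurable_EFinP.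
apply: le_lt_trans (integral_funepos_lt_pinfty measurableT iH).
apply: ae_ge0_le_integral => //.
- by do 2 apply: measurableT_comp => //; exact/measurable_EFinP.
- exact/measurable_funepos/(measurable_int _ iH).
by apply: filterS ZH => w h _ /=; rewrite (le_trans h)// funeposE le_max lexx.
Qed.

Lemma itg_cst (c : R) : itg (fun=> c).
Proof. exact: finite_measure_integrable_cst. Qed.

Lemma itg_D Z Z' : itg Z -> itg Z' -> itg (fun w => Z w + Z' w).
Proof. by move=> i i'; have := integrableD measurableT i i'. Qed.

Lemma itg_B Z Z' : itg Z -> itg Z' -> itg (fun w => Z w - Z' w).
Proof. by move=> i i'; have := integrableB measurableT i i'. Qed.

Lemma itg_N Z : itg Z -> itg (fun w => - Z w).
Proof. by move=> i; have := integrableN i. Qed.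

Lemma itg_norm Z : itg Z -> itg (fun w => `|Z w|).
Proof. exact: integrable_norm. Qed.

Lemma itg_ind A Z : measurable A -> itg Z -> itg (fun w => \1_A w * Z w).
Proof.
move=> mA iZ; apply: itg_domR (itg_norm iZ) _.
  apply: measurable_funM; [exact: measurable_indic|exact: itg_measurable].
move=> w; rewrite normrM indicE; case: (w \in A) => /=.
  by rewrite normr1 mul1r.
by rewrite normr0 mul0r.
Qed.

Lemma itg_sum (I : Type) (s : seq I) (p : pred I) (Z : I -> T -> R) :
  (forall i, itg (Z i)) -> itg (fun w => \sum_(i <- s | p i) Z i w).
Proof.
move=> iZ; elim: s => [|i s IH].
  by under eq_fun do rewrite big_nil; exact: itg_cst.
under eq_fun do rewrite big_cons; case: (p i) => //; exact: itg_D.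
Qed.

Lemma itg_max Z Z' : itg Z -> itg Z' -> itg (fun w => Num.max (Z w) (Z' w)).
Proof.
move=> i i'; apply: itg_domR (itg_D (itg_norm i) (itg_norm i')) _.
  by apply: measurable_maxr; exact: itg_measurable.
by move=> w; rewrite /Num.max; case: ifP; rewrite ?lerDl ?lerDr.
Qed.

Lemma E_D Z Z' : itg Z -> itg Z' ->
  \int[P]_w (Z w + Z' w) = \int[P]_w Z w + \int[P]_w Z' w.
Proof. by move=> *; rewrite RintegralD. Qed.

Lemma E_B Z Z' : itg Z -> itg Z' ->
  \int[P]_w (Z w - Z' w) = \int[P]_w Z w - \int[P]_w Z' w.
Proof. by move=> *; rewrite RintegralB. Qed.

Lemma E_N Z : itg Z -> \int[P]_w (- Z w) = - \int[P]_w Z w.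
Proof.
move=> iZ; rewrite -[RHS]mulN1r -RintegralZl//.
by apply: eq_Rintegral => w _; rewrite mulN1r.
Qed.

Lemma E_sum (I : Type) (s : seq I) (p : pred I) (Z : I -> T -> R) :
  (forall i, itg (Z i)) ->
  \int[P]_w (\sum_(i <- s | p i) Z i w) = \sum_(i <- s | p i) \int[P]_w Z i w.
Proof.
move=> iZ; elim: s => [|i s IH].
  rewrite big_nil; under eq_Rintegral do rewrite big_nil.
  by rewrite Rintegral_cst// mul0r.
rewrite big_cons; under eq_Rintegral do rewrite big_cons.
by case: (p i) => //; rewrite E_D// ?IH//; exact: itg_sum.
Qed.

Lemma E_EFin Z : itg Z -> (\int[P]_w (Z w)%:E = (\int[P]_w Z w)%:E)%E.
Proof. by move=> iZ; rewrite /Rintegral fineK//; exact: integrable_fin_num. Qed.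

Lemma E_cst (c : R) : \int[P]_w c = c.
Proof. by rewrite Rintegral_cst//= probability_setT mulr1. Qed.

Lemma E_le_ae Z Z' : itg Z -> itg Z' -> {ae P, forall w, Z w <= Z' w} ->
  \int[P]_w Z w <= \int[P]_w Z' w.
Proof.
move=> iZ iZ' h; rewrite -subr_ge0 -E_B// -lee_fin -E_EFin; last exact: itg_B.
have mB : measurable_fun setT (fun w => (Z' w - Z w)%:E).
  exact: measurable_int (itg_B iZ' iZ).
rewrite (@ae_eq_integral _ _ _ P setT
  (fun w => (Num.max (Z' w - Z w) 0)%:E)) //.
- by apply: integral_ge0 => w _; rewrite lee_fin le_max lexx orbT.
- apply/measurable_EFinP/measurable_maxr => //.
  exact/measurable_EFinP.
- by apply: filterS h => w h _ /=; congr EFin; rewrite max_l// subr_ge0.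
Qed.

Lemma E_le Z Z' : itg Z -> itg Z' -> (forall w, Z w <= Z' w) ->
  \int[P]_w Z w <= \int[P]_w Z' w.
Proof. by move=> i i' h; apply: E_le_ae => //; exact: aeW. Qed.

(** The bound [H] is extended-real so that path suprema and path integrals, which may be infinite on
    a null set, can dominate as they are. *)
Lemma E_dominated (Z_ : nat -> T -> R) Z H :
  (forall n, measurable_fun setT (Z_ n)) -> measurable_fun setT Z ->
  P.-integrable setT H ->
  (forall n w, (`|Z_ n w|%:E <= H w)%E) ->
  {ae P, forall w, Z_ n w @[n --> \oo] --> Z w} ->
  itg Z /\ \int[P]_w Z_ n w @[n --> \oo] --> \int[P]_w Z w.
Proof.
move=> mZn mZ iH ZH cZ.
have iZn n : itg (Z_ n) by exact: itg_dom iH (ZH n).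
have [] := @dominated_convergence _ _ _ P setT measurableT
   (fun n => EFin \o Z_ n) (EFin \o Z) H.
- by move=> n; exact/measurable_EFinP.
- exact/measurable_EFinP.
- apply: filterS cZ => w h _.
  by apply: cvg_EFin => //; near=> n.
- exact: iH.
- by apply: aeW => w n _; exact: ZH.
move=> iZ _ cv; split => //.
have -> : \int[P]_w Z w = fine (\int[P]_w (Z w)%:E)%E by [].
apply: fine_cvg; rewrite E_EFin//= -E_EFin//; exact: cv.
Unshelve. all: end_near. Qed.

Lemma ae0_of_E_le0 Z : itg Z -> {ae P, forall w, 0 <= Z w} ->
  \int[P]_w Z w <= 0 -> {ae P, forall w, Z w = 0}.
Proof.
move=> iZ Z0 EZ.
have : \int[P]_w `|Z w| <= 0.
  apply: le_trans EZ; apply: E_le_ae => //; first exact: itg_norm.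
  by apply: filterS Z0 => w h; rewrite ger0_norm.
rewrite -lee_fin -E_EFin; last exact: itg_norm.
move=> le0.
have : (\int[P]_w `|(Z w)%:E| = 0)%E.
  by apply/eqP; rewrite eq_le le0 integral_ge0.
move/(ae_eq_integral_abs P measurableT (measurable_int _ iZ)).1.
by apply: filterS => w /(_ I) [].
Qed.

(** The difference [Z - Z'] is positive on [A] but has nonpositive expectation there, so [A] is
    negligible. Taking for [A] the event where an inequality fails proves that inequality almost
    surely. *)
Lemma ae_le_of_ind Z Z' A : itg Z -> itg Z' -> measurable A ->
  (forall w, A w -> Z' w < Z w) ->
  \int[P]_w (\1_A w * Z w) <= \int[P]_w (\1_A w * Z' w) ->
  {ae P, forall w, ~ A w}.
Proof.
move=> i i' mA AZ; rewrite -subr_le0 -E_B; try exact: itg_ind.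
move=> /ae0_of_E_le0 h.
have {h} : {ae P, forall w, \1_A w * Z w - \1_A w * Z' w = 0}.
  apply: h; first by apply: itg_B; exact: itg_ind.
  apply: aeW => w; rewrite -mulrBr indicE.
  have [/set_mem Aw|] := boolP (w \in A); last by rewrite mul0r.
  by rewrite mul1r subr_ge0 ltW// AZ.
apply: filterS => w + Aw; rewrite indicE mem_set// !mul1r.
by have := AZ _ Aw; lra.
Qed.

End expectation.

(** * Conditional expectations *)

Section sub_sigma_algebra.
Context d (T : measurableType d) (R : realType) (P : probability T R).
Variable G : set_system T.
Hypotheses (sG : sigma_algebra setT G) (Gm : G `<=` measurable).
Local Notation GT := (g_sigma_algebraType G).

(** [g_sigma_algebraType G] carries the sigma-algebra generated by [G], which is [G] itself here;
    closure properties of measurable sets thus transfer to [G]. *)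
Lemma sub_measurableE (A : set GT) : measurable A <-> G A.
Proof.
have -> : @measurable _ GT = <<s G >> by [].
by rewrite sigma_algebra_id.
Qed.

Lemma sub_measurable_fun d' (U : measurableType d') (V : GT -> U) :
  measurable_fun setT V -> measurable_fun (setT : set T) (V : T -> U).
Proof.
by move=> mV _ B mB; apply: Gm; apply/sub_measurableE; exact: mV.
Qed.

Lemma sub_measurable_setU (A B : set T) : G A -> G B -> G (A `|` B).
Proof.
move=> /sub_measurableE mA /sub_measurableE mB; apply/sub_measurableE.
exact: measurableU.
Qed.

Lemma sub_measurable_setI (A B : set T) : G A -> G B -> G (A `&` B).
Proof.
move=> /sub_measurableE mA /sub_measurableE mB; apply/sub_measurableE.
exact: measurableI.
Qed.

Lemma sub_measurable_setC (A : set T) : G A -> G (~` A).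
Proof.
by move=> /sub_measurableE mA; apply/sub_measurableE; exact: measurableC.
Qed.

Lemma sub_measurable_setT : G setT.
Proof. by apply: (sub_measurableE _).1; exact: measurableT. Qed.

Lemma sub_measurable_set0 : G set0.
Proof. by apply: (sub_measurableE _).1; exact: measurable0. Qed.

End sub_sigma_algebra.

Section restricted_measures.
Context d (T : measurableType d) (R : realType) (P : probability T R).
Variable G : set_system T.
Hypotheses (sG : sigma_algebra setT G) (Gm : G `<=` measurable).
Local Notation GT := (g_sigma_algebraType G).

(** The identity, seen as a measurable map to the coarser space: its distribution is the restriction
    of [P] to [G]. *)
Let coarsen : T -> GT := fun w => w.

Let measurable_coarsen : measurable_fun setT coarsen.
Proof. by move=> _ B mB; rewrite setTI; apply: Gm; apply/sub_measurableE. Qed.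

HB.instance Definition _ :=
  @isMeasurableFun.Build _ _ _ _ coarsen measurable_coarsen.

Variables (Z : T -> R) (iZ : P.-integrable setT (EFin \o Z)).
Hypothesis Z0 : forall w, (0 <= Z w)%R.

Let nu (A : set GT) : \bar R := \int[P]_(w in A) (Z w)%:E.

Let nu0 : nu set0 = 0. Proof. by rewrite /nu integral_set0. Qed.

Let nu_ge0 A : 0 <= nu A.
Proof. by apply: integral_ge0 => w _; exact: Z0. Qed.

Let nu_sigma_additive : semi_sigma_additive nu.
Proof.
move=> F mF tF mUF; apply: semi_sigma_additive_nng_induced => //.
- exact: measurable_int iZ.
- by move=> i; apply/Gm/sub_measurableE.
- exact/Gm/sub_measurableE.
Qed.

HB.instance Definition _ := isMeasure.Build _ _ _ nu nu0 nu_ge0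
  nu_sigma_additive.

Let nu_fin : fin_num_fun nu.
Proof.
move=> A mA; apply: integrable_fin_num => //=.
  exact/Gm/sub_measurableE.
by apply: integrableS iZ => //; exact/Gm/sub_measurableE.
Qed.

HB.instance Definition _ := Measure_isFinite.Build _ _ _ nu nu_fin.

(** Radon-Nikodym on the coarse space: the measure with density [Z], restricted to [G], is dominated
    by the restriction of [P]. The density is finite everywhere, so that [fine] loses nothing. *)
Lemma cond_exp_ge0_ex : exists V : T -> R,
  [/\ measurable_fun setT (V : GT -> R), (forall w, (0 <= V w)%R),
      P.-integrable setT (EFin \o V) &
      forall A, G A -> \int[P]_(w in A) (V w)%:E = \int[P]_(w in A) (Z w)%:E].
Proof.
pose mu := distribution P coarsen.
have numu : nu `<< mu.
  apply/null_content_dominatesP => A mA muA; apply: null_set_integral.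
  - exact/Gm/sub_measurableE.
  - by apply: measurable_funTS; apply: measurable_int iZ.
  - exact: muA.
pose f := Radon_Nikodym_SigmaFinite.f nu mu.
have mf : measurable_fun setT f.
  exact/measurable_int/Radon_Nikodym_SigmaFinite.f_integrable.
have f0 : forall w, 0 <= f w := Radon_Nikodym_SigmaFinite.f_ge0 numu.
have ff w : (fine (f w))%:E = f w.
  by rewrite fineK//; exact: Radon_Nikodym_SigmaFinite.f_fin_num.
have If A : G A -> \int[P]_(w in A) (fine (f w))%:E = \int[P]_(w in A) (Z w)%:E.
  move=> GA; have mA : @measurable _ GT A by exact/sub_measurableE.
  transitivity (\int[mu]_(w in A) f w).
    rewrite /mu ge0_integral_pushforward//; last exact: measurable_funTS.
    by apply: eq_integral => w _; rewrite ff.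
  by rewrite -(Radon_Nikodym_SigmaFinite.f_integral numu).
have mff : measurable_fun setT (fine \o f : GT -> R).
  by apply: measurableT_comp => //; exact: fine_measurable.
exists (fine \o f); split => //.
- by move=> w; rewrite /= fine_ge0.
- apply/integrableP; split.
    exact/measurable_EFinP/(sub_measurable_fun sG Gm).
  rewrite (eq_integral (fun w : T => (fine (f w))%:E)); last first.
    by move=> w _; rewrite /= ger0_norm// fine_ge0.
  rewrite If; last exact: sub_measurable_setT.
  have := integral_funepos_lt_pinfty measurableT iZ.
  rewrite (_ : _^\+ = EFin \o Z)//; apply/funext => w.
  by rewrite (@ge0_funeposE _ _ setT) ?inE// => x _; rewrite lee_fin.
Qed.

End restricted_measures.

Section conditional_expectation.
Local Open Scope ring_scope.
Context d (T : measurableType d) (R : realType) (P : probability T R).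
Variable G : set_system T.
Hypotheses (sG : sigma_algebra setT G) (Gm : G `<=` measurable).
Local Notation GT := (g_sigma_algebraType G).
Local Notation itg Z := (P.-integrable setT (EFin \o Z)).
Implicit Types Z V W : T -> R.

(** Real-valued counterpart of [is_cond_exp] for integrable variables. Averages are tested with
    indicators, which keeps every expectation over the whole space. *)
Definition cond_version Z V :=
  [/\ measurable_fun setT (V : GT -> R), itg V &
      forall A, G A ->
        \int[P]_w (\1_A w * V w) = \int[P]_w (\1_A w * Z w)].

Lemma E_ind_setint Z A : measurable A ->
  (\int[P]_(w in A) (Z w)%:E = \int[P]_w (\1_A w * Z w)%:E)%E.
Proof.
move=> mA; rewrite integral_mkcond; apply: eq_integral => w _.
by rewrite patchE indicE; case: (w \in A); rewrite ?mul1r ?mul0r.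
Qed.

Lemma funeposr (Z : T -> R) : ((EFin \o Z)^\+)%E = EFin \o (fun w => Num.max (Z w) 0).
Proof. by apply/funext => w; rewrite funeposE /= EFin_max. Qed.

Lemma funenegr (Z : T -> R) :
  ((EFin \o Z)^\-)%E = EFin \o (fun w => Num.max (- Z w) 0).
Proof. by apply/funext => w; rewrite funenegE /= EFin_max. Qed.

Lemma cond_version_ex Z : itg Z ->
  exists2 V, cond_version Z V & is_cond_exp P G (EFin \o Z) (EFin \o V).
Proof.
move=> iZ.
have iZp : itg (fun w => Num.max (Z w) 0).
  by apply: itg_max => //; exact: itg_cst.
have iZn : itg (fun w => Num.max (- Z w) 0).
  by apply: itg_max => //; [exact: itg_N|exact: itg_cst].
have [|Vp [mVp Vp0 iVp eVp]] := cond_exp_ge0_ex sG Gm iZp.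
  by move=> w; rewrite le_max lexx orbT.
have [|Vn [mVn Vn0 iVn eVn]] := cond_exp_ge0_ex sG Gm iZn.
  by move=> w; rewrite le_max lexx orbT.
exists (fun w => Vp w - Vn w).
  split; first exact: measurable_funB.
    exact: itg_B.
  move=> A GA; have mA := Gm GA.
  under eq_Rintegral do rewrite mulrBr.
  under [RHS]eq_Rintegral => w _.
    rewrite (_ : Z w = Num.max (Z w) 0 - Num.max (- Z w) 0); last first.
      by rewrite /Num.max; case: ltP => ?; case: ltP => ?; lra.
    rewrite mulrBr; over.
  rewrite !E_B; try exact: itg_ind.
  by congr (_ - _); congr fine; rewrite -!E_ind_setint// ?eVp ?eVn.
rewrite /is_cond_exp; exists (EFin \o Vp), (EFin \o Vn); split => //.
- split; first exact/measurable_EFinP.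
    by move=> w; rewrite lee_fin.
  by move=> A GA /=; rewrite eVp// funeposr.
- split; first exact/measurable_EFinP.
    by move=> w; rewrite lee_fin.
  by move=> A GA /=; rewrite eVn// funenegr.
Qed.

Lemma cond_versionE Z V : cond_version Z V -> \int[P]_w V w = \int[P]_w Z w.
Proof.
move=> [_ _ /(_ setT (sub_measurable_setT sG))].
by under eq_Rintegral do rewrite indicT mul1r;
  under [X in _ = X -> _]eq_Rintegral do rewrite indicT mul1r.
Qed.

Definition paste (A : set T) Z1 Z2 : T -> R := fun w => if w \in A then Z1 w else Z2 w.

Lemma pasteE A Z1 Z2 w :
  paste A Z1 Z2 w = \1_A w * Z1 w + \1_(~` A) w * Z2 w.
Proof.
rewrite /paste !indicE in_setC; case: (w \in A) => /=.
  by rewrite mul1r mul0r addr0.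
by rewrite mul1r mul0r add0r.
Qed.

Lemma E_paste A B Z1 Z2 : measurable A -> measurable B -> itg Z1 -> itg Z2 ->
  \int[P]_w (\1_B w * paste A Z1 Z2 w) =
  \int[P]_w (\1_(B `&` A) w * Z1 w) + \int[P]_w (\1_(B `&` ~` A) w * Z2 w).
Proof.
move=> mA mB i1 i2; rewrite -E_D; last 2 first.
- by apply: itg_ind=> //; exact: measurableI.
- by apply: itg_ind=> //; apply: measurableI => //; exact: measurableC.
by apply: eq_Rintegral => w _; rewrite pasteE !indicI mulrDr !mulrA.
Qed.

(** Conditional expectation commutes with pasting along an event of [G]; pasting along [V2 <= V1]
    produces the maximum. Hence the conditional expectations of a family stable under pasting are
    upward directed. *)
Lemma cond_version_max Z1 Z2 V1 V2 : itg Z1 -> itg Z2 ->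
  cond_version Z1 V1 -> cond_version Z2 V2 ->
  G [set w | V2 w <= V1 w] /\
  cond_version (paste [set w | V2 w <= V1 w] Z1 Z2)
    (fun w => Num.max (V1 w) (V2 w)).
Proof.
move=> iZ1 iZ2 [mV1 iV1 e1] [mV2 iV2 e2]; set A := [set w | _].
have GA : G A.
  apply: (sub_measurableE sG _).1.
  have -> : A = (fun w : GT => V2 w <= V1 w) @^-1` [set true].
    by apply/seteqP; split => w.
  by rewrite -[X in measurable X]setTI; apply: measurable_fun_ler.
split => //; split.
- exact: measurable_maxr.
- exact: itg_max.
- move=> B GB.
  have mE w : Num.max (V1 w) (V2 w) = paste A V1 V2 w.
    rewrite /paste; case: ifPn => [/set_mem h|].
      by rewrite max_l.
    by rewrite notin_setE /A/= => /negP; rewrite -ltNge => /ltW h; rewrite max_r.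
  have mA := Gm GA; have mB := Gm GB.
  under eq_Rintegral do rewrite mE.
  rewrite !E_paste ?e1 ?e2//.
  - by apply: sub_measurable_setI => //; exact: sub_measurable_setC.
  - exact: sub_measurable_setI.
Qed.

Lemma cond_version_le (A : set T) Z V V' : itg V' -> G A ->
  cond_version Z V -> {ae P, forall w, V w <= V' w} ->
  \int[P]_w (\1_A w * Z w) <= \int[P]_w (\1_A w * V' w).
Proof.
move=> iV' GA [mV iV e] VV'; rewrite -e//.
apply: E_le_ae; try (apply: itg_ind => //; exact: Gm).
apply: filterS VV' => w h; rewrite indicE; case: (w \in A).
  by rewrite !mul1r.
by rewrite !mul0r.
Qed.

Section upper_family.
Variables (fam : (T -> R) -> Prop) (C : R) (Z0 : T -> R).
Hypotheses (fam_itg : forall Z, fam Z -> itg Z)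
  (fam_paste : forall A Z1 Z2, G A -> fam Z1 -> fam Z2 -> fam (paste A Z1 Z2))
  (fam_bound : forall Z, fam Z -> \int[P]_w Z w <= C) (famZ0 : fam Z0).

Let c := sup [set \int[P]_w Z w | Z in fam].

Let has_sup_c : has_sup [set \int[P]_w Z w | Z in fam].
Proof.
split; first by exists (\int[P]_w Z0 w), Z0.
by exists C => _ [Z fZ <-]; exact: fam_bound.
Qed.

Let le_c Z : fam Z -> \int[P]_w Z w <= c.
Proof. by move=> fZ; apply: sup_upper_bound => //; exists Z. Qed.

Let approx n : exists ZV : (T -> R) * (T -> R),
  [/\ fam ZV.1, cond_version ZV.1 ZV.2 & c - n.+1%:R^-1 <= \int[P]_w ZV.1 w].
Proof.
have [|_ [Z fZ <-] h] := sup_adherent _ has_sup_c (eps := n.+1%:R^-1).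
  by rewrite invr_gt0.
have [V ZV _] := cond_version_ex (fam_itg fZ).
by exists (Z, V); split => //; exact: ltW.
Qed.

(** [V] is the essential supremum of the conditional expectations of the family. It is the limit of
    running maxima [W n] of versions along a sequence of members whose expectations approach the
    supremum [c]; by pasting, each [W n] is again a version of a member, so its expectation stays
    below [c]. *)
Lemma upper_family_sup : exists V : T -> R,
  [/\ measurable_fun setT (V : GT -> R), itg V,
      (forall Z, fam Z -> forall A, G A ->
         \int[P]_w (\1_A w * Z w) <= \int[P]_w (\1_A w * V w)) &
      forall e, 0 < e -> exists2 Z, fam Z & \int[P]_w V w <= \int[P]_w Z w + e].
Proof.
have [ZV hZV] := choice approx.
pose W := fix W n := if n is n'.+1
  then fun w => Num.max (W n' w) ((ZV n'.+1).2 w) else (ZV 0%N).2.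
have famW n : exists2 Z, fam Z & cond_version Z (W n).
  elim: n => [|n [Z fZ cZ]]; first by exists (ZV 0%N).1; have [] := hZV 0%N.
  have [fZ' cZ' _] := hZV n.+1.
  have [GA cA] := cond_version_max (fam_itg fZ) (fam_itg fZ') cZ cZ'.
  by eexists; last exact: cA; apply: fam_paste.
have mW n : measurable_fun setT (W n : GT -> R) by have [Z _ []] := famW n.
have iW n : itg (W n) by have [Z _ []] := famW n.
have EW n : \int[P]_w W n w <= c.
  by have [Z fZ /cond_versionE ->] := famW n; exact: le_c.
have W_ge n w : (ZV n).2 w <= W n w by case: n => //= n; rewrite le_max lexx orbT.
have W_nd w : nondecreasing_seq (W ^~ w).
  by apply/nondecreasing_seqP => n /=; rewrite le_max lexx.
have W_lb n : c - n.+1%:R^-1 <= \int[P]_w W n w.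
  have [_ cV /le_trans] := hZV n; apply; rewrite -(cond_versionE cV).
  by apply: E_le => //; case: cV.
(* Monotone convergence is applied to the nonnegative increments over [W 0]; their limit [L] may be
   infinite on a null set. *)
pose D n w := (W n w - W 0%N w)%:E.
have D_nd w : nondecreasing_seq (D ^~ w).
  by move=> i j ij; rewrite lee_fin lerD2r; exact: W_nd.
have D0 n w : (0 <= D n w)%E by rewrite lee_fin subr_ge0; exact: W_nd.
pose L w := ereal_sup (range (D ^~ w)).
have D_L w : D ^~ w @ \oo --> L w.
  exact: ereal_nondecreasing_cvgn (D_nd w).
have mL : measurable_fun setT (L : GT -> \bar R).
  apply: (@emeasurable_fun_cvg _ GT _ setT D) => //= n.
  by apply/measurable_EFinP; apply: measurable_funB.
have DL n w : (D n w <= L w)%E.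
  by apply: ereal_sup_ubound; exists n.
have L0 w : (0 <= L w)%E by apply: le_trans (D0 0%N w) (DL _ _).
have EL : (\int[P]_w L w <= (c - \int[P]_w W 0%N w)%:E)%E.
  have cv : (\int[P]_w D n w @[n --> \oo] --> \int[P]_w L w)%E.
    have LE w : L w = limn (D ^~ w) by apply/esym/cvg_lim.
    under eq_integral do rewrite LE.
    apply: cvg_monotone_convergence => //.
    by move=> n; apply/measurable_EFinP/itg_measurable; exact: itg_B.
  rewrite -(cvg_lim _ cv)//; apply: lime_le; first exact: cvgP cv.
  apply: nearW => n; rewrite E_EFin; last exact: itg_B.
  by rewrite lee_fin E_B// lerD2r.
have iL : P.-integrable setT L.
  apply/integrableP; split; first exact: (sub_measurable_fun sG Gm).
  under eq_integral do rewrite gee0_abs//.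
  exact: le_lt_trans EL (ltry _).
have L_fin : {ae P, forall w, L w \is a fin_num}.
  by apply: filterS (integrable_ae measurableT iL) => w; exact.
have iLf : itg (fine \o L).
  apply: itg_dom_ae iL _.
    apply: measurableT_comp; first exact: fine_measurable.
    exact: (sub_measurable_fun sG Gm).
  by apply: filterS L_fin => w h /=; rewrite ger0_norm ?fine_ge0// fineK.
pose V w := W 0%N w + fine (L w).
have WV n : {ae P, forall w, W n w <= V w}.
  apply: filterS L_fin => w h; rewrite -lerBlDl -lee_fin fineK//; exact: DL.
have iV : itg V by exact: itg_D.
have V_ge Z V' : fam Z -> cond_version Z V' -> {ae P, forall w, V' w <= V w}.
  move=> fZ cZ; have iV' : itg V' by case: cZ.
  have ip : itg (fun w => Num.max (V' w - V w) 0).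
    by apply: itg_max; [exact: itg_B|exact: itg_cst].
  have : {ae P, forall w, Num.max (V' w - V w) 0 = 0}.
    apply: ae0_of_E_le0 => //.
      by apply: aeW => w; rewrite le_max lexx orbT.
    (* The maximum of [W n] and [V'] is a version of a member, so its expectation is at most [c],
       while that of [W n] is within [1/(n+1)] of [c]: the excess of [V'] over [V] has mean at most
       [1/(n+1)]. *)
    apply/ler_addgt0Pl => e e0; rewrite addr0.
    have [n ne] : exists n, n.+1%:R^-1 <= e.
      exists (Num.truncn e^-1); rewrite invf_ple ?posrE// ltW//.
      by rewrite truncnS_gt.
    apply: le_trans ne.
    have [Z' fZ' cZ'] := famW n.
    have [GA cM] := cond_version_max (fam_itg fZ') (fam_itg fZ) cZ' cZ.
    have := le_c (fam_paste GA fZ' fZ); rewrite -(cond_versionE cM) => h.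
    have iM : itg (fun w => Num.max (W n w) (V' w)) by exact: itg_max.
    apply: (@le_trans _ _ (\int[P]_w (Num.max (W n w) (V' w) - W n w))).
      apply: E_le_ae => //; first exact: itg_B.
      apply: filterS (WV n) => w hw; rewrite ge_max; apply/andP; split.
        by rewrite lerB// le_max lexx orbT.
      by rewrite subr_ge0 le_max lexx.
    by rewrite E_B// lerBlDr (le_trans h)// -lerBlDl; exact: W_lb.
  by apply: filterS => w /eqP; rewrite eq_le ge_max subr_le0 => /andP[/andP[]].
exists V; split => //.
- apply: measurable_funD => //.
  by apply: measurableT_comp => //; exact: fine_measurable.
- move=> Z fZ A GA; have [V' cZ _] := cond_version_ex (fam_itg fZ).
  exact: cond_version_le iV GA cZ (V_ge _ _ fZ cZ).
- move=> e e0; have [|_ [Z fZ <-] h] := sup_adherent _ has_sup_c (eps := e) => //.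
  exists Z => //; rewrite E_D//.
  suff : \int[P]_w fine (L w) <= c - \int[P]_w W 0%N w by move=> h'; move: h; rewrite -/c => h; lra.
  rewrite -lee_fin -E_EFin//; apply: le_trans EL; rewrite le_eqVlt; apply/orP; left.
  apply/eqP/ae_eq_integral => //.
  + by apply: measurable_int iLf.
  + exact: (sub_measurable_fun sG Gm).
  + by apply: filterS L_fin => w hw _ /=; rewrite fineK.
Qed.

End upper_family.
End conditional_expectation.

(** * Stopping times *)

Section stopping_times.
Local Open Scope ring_scope.
Context d (T : measurableType d) (R : realType).
Variable F : R -> set_system T.
Hypotheses (sF : forall t, sigma_algebra setT (F t))
  (Fm : forall t, F t `<=` measurable)
  (Fmono : forall s t, s <= t -> F s `<=` F t).
Implicit Types (tau sigma : T -> \bar R) (A : set T).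

(** Truncation turns an extended time into a real one at which processes can be evaluated; for [tau]
    and [K] nonnegative, [fine] discards nothing. *)
Definition cap tau (K : R) (w : T) : R := fine (mine (tau w) K%:E).

Section cap.
Variables (tau : T -> \bar R) (K : R).
Hypotheses (tau0 : forall w, (0 <= tau w)%E) (K0 : 0 <= K).

Lemma capE w : ((cap tau K w)%:E = mine (tau w) K%:E)%E.
Proof.
rewrite /cap fineK//; have := tau0 w; case: (tau w) => [x| |] //=.
  by rewrite -EFin_min. 
Qed.

Lemma cap_le w s : (cap tau K w <= s) = (tau w <= s%:E)%E || (K <= s).
Proof. by rewrite -lee_fin capE ge_min lee_fin. Qed.

Lemma cap_gt w s : (s < cap tau K w) = (s%:E < tau w)%E && (s < K).
Proof. by rewrite -lte_fin capE lt_min lte_fin. Qed.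

Lemma cap_leK w : cap tau K w <= K.
Proof. by rewrite cap_le lexx orbT. Qed.

Lemma cap_ge0 w : 0 <= cap tau K w.
Proof. by rewrite -lee_fin capE le_min tau0 lee_fin. Qed.

Lemma cap_id w x : tau w = x%:E -> x <= K -> cap tau K w = x.
Proof.
by move=> tx xK; apply: EFin_inj; rewrite capE tx min_l ?lee_fin.
Qed.

Lemma cap_cst w : (K%:E <= tau w)%E -> cap tau K w = K.
Proof. by move=> Kt; apply: EFin_inj; rewrite capE min_r. Qed.

End cap.

Lemma le_cap sigma tau K w : (forall w, (0 <= sigma w)%E) ->
  (forall w, (0 <= tau w)%E) -> (sigma w <= tau w)%E ->
  cap sigma K w <= cap tau K w.
Proof.
move=> s0 t0 st; rewrite -lee_fin !capE// le_min !ge_min st lexx orbT.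
by [].
Qed.

Lemma stopping_timeP tau t : stopping_time F tau ->
  F t [set w | (tau w <= t%:E)%E].
Proof.
move=> [t0 h]; have [/h//|tneg] := leP 0 t.
rewrite (_ : [set _ | _] = set0); first exact: sub_measurable_set0.
rewrite -subset0 => w /= /(le_trans (t0 w)); rewrite lee_fin.
by rewrite leNgt tneg.
Qed.

Lemma stopping_time_gt tau t : stopping_time F tau ->
  F t [set w | (t%:E < tau w)%E].
Proof.
move=> st; rewrite (_ : [set _ | _] = ~` [set w | (tau w <= t%:E)%E]).
  by apply: sub_measurable_setC => //; exact: stopping_timeP.
by apply/seteqP; split => w /=; rewrite ltNge => /negP.
Qed.

Lemma stopping_time_measurable tau : stopping_time F tau ->
  measurable_fun setT tau.
Proof.
move=> st; apply: (measurability _ (ErealGenOInfty.measurableE R)) => //.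
move=> _ [_ [x ->] <-]; rewrite setTI.
rewrite (_ : _ @^-1` _ = [set w | (x%:E < tau w)%E]).
  by apply: (Fm (t := x)); exact: stopping_time_gt.
by apply/seteqP; split => w /=; rewrite in_itv/= andbT.
Qed.

Lemma measurable_cap tau K : stopping_time F tau -> 0 <= K ->
  measurable_fun setT (cap tau K).
Proof.
move=> st K0; apply: measurableT_comp; first exact: fine_measurable.
by apply: measurable_mine => //; exact: stopping_time_measurable.
Qed.

Lemma stopping_time_cst t : 0 <= t -> stopping_time F (fun=> t%:E).
Proof.
move=> t0; split => [w|s s0]; first by rewrite lee_fin.
have [ts|st] := leP t s.
  rewrite (_ : [set _ | _] = setT); first exact: sub_measurable_setT.
  by apply/seteqP; split => // w _ /=; rewrite lee_fin.
rewrite (_ : [set _ | _] = set0); first exact: sub_measurable_set0.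
by rewrite -subset0 => w /=; rewrite lee_fin leNgt st.
Qed.

Lemma stopping_time_min tau sigma : stopping_time F tau ->
  stopping_time F sigma -> stopping_time F (fun w => mine (tau w) (sigma w)).
Proof.
move=> st ss; split => [w|t t0]; first by rewrite le_min; have [-> _] := st; have [-> _] := ss.
rewrite (_ : [set _ | _] = [set w | tau w <= t%:E]%E `|` [set w | sigma w <= t%:E]%E).
  by apply: sub_measurable_setU => //; exact: stopping_timeP.
by apply/seteqP; split => w /=; rewrite ge_min => /orP.
Qed.

Lemma stopping_time_max tau sigma : stopping_time F tau ->
  stopping_time F sigma -> stopping_time F (fun w => maxe (tau w) (sigma w)).
Proof.
move=> st ss; split => [w|t t0]; first by rewrite le_max; have [-> _] := st.
rewrite (_ : [set _ | _] = [set w | tau w <= t%:E]%E `&` [set w | sigma w <= t%:E]%E).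
  by apply: sub_measurable_setI => //; exact: stopping_timeP.
by apply/seteqP; split => w /=; rewrite ge_max => /andP.
Qed.

(** Before [t] neither time has occurred, and from [t] on the event [A] is known. *)
Lemma stopping_time_paste t A tau sigma : 0 <= t -> F t A ->
  stopping_time F tau -> stopping_time F sigma ->
  (forall w, (t%:E <= tau w)%E) -> (forall w, (t%:E <= sigma w)%E) ->
  stopping_time F (fun w => if w \in A then tau w else sigma w).
Proof.
move=> t0 FA st ss tt ts; split => [w|s s0].
  by case: ifP => _; [have [] := st|have [] := ss].
have [ts'|st'] := leP t s; last first.
  rewrite (_ : [set _ | _] = set0); first exact: sub_measurable_set0.
  rewrite -subset0 => w /=; apply/negP; rewrite -ltNge.
  by case: ifP => _; apply: lt_le_trans (tt w) || apply: lt_le_trans (ts w);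
    rewrite lte_fin.
have FsA : F s A by exact: Fmono FA.
rewrite (_ : [set _ | _] = (A `&` [set w | tau w <= s%:E]%E) `|`
   (~` A `&` [set w | sigma w <= s%:E]%E)).
  apply: sub_measurable_setU => //; apply: sub_measurable_setI => //.
  - exact: stopping_timeP.
  - exact: sub_measurable_setC.
  - exact: stopping_timeP.
apply/seteqP; split => w /=.
  have [/set_mem Aw h|] := boolP (w \in A); first by left.
  by rewrite notin_setE => Aw h; right.
by move=> [[Aw h]|[Aw h]]; [rewrite mem_set|rewrite memNset].
Qed.

Lemma stopped_sigma_cst t A : 0 <= t -> F t A ->
  stopped_sigma F (fun=> t%:E) A.
Proof.
move=> t0 FA; split; first exact: Fm FA.
move=> s s0; have [ts|st] := leP t s.
  apply: sub_measurable_setI => //; first exact: Fmono FA.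
  by apply: stopping_timeP; exact: stopping_time_cst.
rewrite (_ : A `&` _ = set0); first exact: sub_measurable_set0.
by rewrite -subset0 => w /= []; rewrite lee_fin leNgt st.
Qed.

Lemma stopped_sigmaP sigma t A : stopping_time F sigma ->
  stopped_sigma F sigma A -> F t (A `&` [set w | (sigma w <= t%:E)%E]).
Proof.
move=> ss [mA h]; have [/h//|tneg] := leP 0 t.
rewrite (_ : A `&` _ = set0); first exact: sub_measurable_set0.
rewrite -subset0 => w /= [_ /(le_trans (ss.1 w))]; rewrite lee_fin.
by rewrite leNgt tneg.
Qed.

End stopping_times.

(** * Optional sampling along a grid *)

Section grid.
Local Open Scope ring_scope.
Context {R : realType}.

(** Since the grid is nondecreasing, the retained terms form an initial segment and telescope to the
    value at the first grid point not below [x], or at the last one. A sampled value thus becomes a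
    sum of grid increments, each kept only if its left end is before [x]. *)
Lemma grid_telescope (a t : nat -> R) (x : R) N :
  {homo t : i j / (i <= j)%N >-> i <= j} ->
  exists j, [/\ (j <= N)%N, forall k, (k < j)%N -> t k < x,
    (j < N)%N -> x <= t j &
    a 0%N + \sum_(k < N) (t k < x)%R%:R * (a k.+1 - a k) = a j].
Proof.
move=> tm; elim: N => [|N [j [jN h1 h2 h3]]].
  by exists 0%N; split => //; rewrite big_ord0 addr0.
have [tx|tx] := ltP (t N) x.
  have {}jN : j = N.
    apply/eqP; rewrite eqn_leq jN /= leqNgt; apply/negP => /[dup] /h2 xj /ltnW jN'.
    by have := lt_le_trans tx xj; rewrite ltNge tm.
  exists N.+1; split => //.
  - by move=> k; rewrite ltnS => /tm /le_lt_trans; exact.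
  - by rewrite ltnn.
  - by rewrite big_ord_recr/= addrA h3 jN tx mul1r addrC subrK.
exists j; split => //; first exact: leqW.
- by move=> _; have [/h2//|Nj] := ltnP j N; rewrite (le_trans tx)// tm.
- by rewrite big_ord_recr/= addrA h3 ltNge tx mul0r addr0.
Qed.

Variable K : R.
Hypothesis K0 : 0 <= K.

Definition grid n k : R := k%:R * (K / n.+1%:R).

Lemma grid_homo n : {homo grid n : i j / (i <= j)%N >-> i <= j}.
Proof. by move=> i j ij; rewrite ler_wpM2r ?divr_ge0// ler_nat. Qed.

Lemma grid_ge0 n k : 0 <= grid n k.
Proof. by rewrite mulr_ge0 ?divr_ge0. Qed.

Lemma grid_le n k : (k <= n.+1)%N -> grid n k <= K.
Proof.
move=> kn; rewrite (le_trans (grid_homo _ kn))// /grid mulrC divfK//.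
Qed.

Definition grid_sum (m : R -> R) n x : R :=
  m 0 + \sum_(k < n.+1) (grid n k < x)%R%:R * (m (grid n k.+1) - m (grid n k)).

Lemma grid_sumE m n x : 0 <= x <= K -> exists2 y, grid_sum m n x = m y &
  0 <= y <= K /\ `|y - x| <= K / n.+1%:R.
Proof.
move=> /andP[x0 xK].
have [j [jn h1 h2 h3]] := grid_telescope (m \o grid n) x n.+1 (@grid_homo n).
exists (grid n j); first by rewrite -[RHS]h3 /grid_sum/= [grid n 0]/grid mul0r.
rewrite grid_ge0 grid_le//; split => //.
have xj : x <= grid n j.
  move: jn; rewrite leq_eqVlt => /predU1P[->|]; last exact: h2.
  by rewrite /grid mulrC divfK.
rewrite ger0_norm ?subr_ge0// lerBlDl.
case: j {jn h2 h3 xj} h1 => [|j] h1.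
  by rewrite /grid mul0r addr_ge0// divr_ge0.
by rewrite /grid -natr1 mulrDl mul1r lerD2r ltW// h1.
Qed.

Lemma grid_sum_cvg m x : continuous m -> 0 <= x <= K ->
  grid_sum m n x @[n --> \oo] --> m x.
Proof.
move=> cm xK; pose y n := sval (cid2 (grid_sumE m n xK)).
have yE n : grid_sum m n x = m (y n) by rewrite /y; case: cid2.
have yx n : `|y n - x| <= K / n.+1%:R by rewrite /y; case: cid2 => ? ? [].
under eq_cvg do rewrite yE.
apply: (@cvg_comp _ _ _ y m _ (nbhs x)); last exact: cm.
apply/subr_cvg0/norm_cvg0P.
apply: (@squeeze_cvgr _ _ _ _ (fun=> 0) (fun n => K * n.+1%:R^-1)).
- by apply: nearW => n; rewrite normr_ge0 yx.
- exact: cvg_cst.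
- rewrite -[X in _ --> X](mulr0 K); apply: cvgMr; exact: cvg_harmonic.
Qed.

End grid.

Section optional_sampling.
Local Open Scope ring_scope.
Context d (T : measurableType d) (R : realType) (P : probability T R).
Variable F : R -> set_system T.
Hypotheses (sF : forall t, sigma_algebra setT (F t))
  (Fm : forall t, F t `<=` measurable)
  (Fmono : forall s t, s <= t -> F s `<=` F t).
Local Notation itg Z := (P.-integrable setT (EFin \o Z)).

Variables (M : R -> T -> R) (H : T -> \bar R) (K : R).
Hypotheses (Mc : forall w, continuous (M^~ w))
  (Mm : forall t, measurable_fun setT (M t)) (K0 : 0 <= K)
  (iH : P.-integrable setT H)
  (MH : forall t w, 0 <= t <= K -> (`|M t w|%:E <= H w)%E).

Lemma cap_bounds tau w : stopping_time F tau -> 0 <= cap tau K w <= K.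
Proof. by move=> [t0 _]; rewrite cap_ge0// cap_leK. Qed.

Lemma itg_process t : 0 <= t <= K -> itg (M t).
Proof. by move=> tK; apply: itg_dom iH _ => // w; exact: MH. Qed.

Lemma itg_cap tau : stopping_time F tau -> itg (fun w => M (cap tau K w) w).
Proof.
move=> st; apply: itg_dom iH _.
  by apply: measurable_eval => //; exact: measurable_cap.
by move=> w; apply: MH; exact: cap_bounds.
Qed.

Lemma optional_sampling sigma tau A :
  stopping_time F sigma -> stopping_time F tau ->
  (forall w, (sigma w <= tau w)%E) -> stopped_sigma F sigma A ->
  (forall s t B, 0 <= s -> s <= t -> t <= K -> F s B -> B `<=` A ->
     (forall w, B w -> (sigma w <= s%:E < tau w)%E) ->
     \int[P]_w (\1_B w * (M t w - M s w)) <= 0) ->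
  \int[P]_w (\1_A w * (M (cap tau K w) w - M (cap sigma K w) w)) <= 0.
Proof.
move=> ss st sst sA super; have mA : measurable A by case: sA.
pose D n w := \1_A w * (grid_sum K (M^~ w) n (cap tau K w) -
                        grid_sum K (M^~ w) n (cap sigma K w)).
pose B n (k : nat) := A `&` [set w | (sigma w <= (grid K n k)%:E < tau w)%E
                                /\ grid K n k < K].
have DE n w : D n w = \sum_(k < n.+1) \1_(B n k) w *
     (M (grid K n k.+1) w - M (grid K n k) w).
  rewrite /D /grid_sum opprD addrACA subrr add0r -sumrB mulr_sumr; apply: eq_bigr => k _.
  rewrite -mulrBl mulrA; congr (_ * _).
  rewrite !cap_gt//; [|by case: ss|by case: st].
  rewrite /B indicI !indicE; congr (_ * _).
  rewrite [RHS]indicE;  rewrite (_ : (w \in _) = (sigma w <= (grid K n k)%:E < tau w)%E &&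
      (grid K n k < K)); last first.
    apply/idP/idP => [/set_mem[-> ->]//|/andP[? ?]]; exact: mem_set.
  case: (ltP _ K) => _; rewrite ?andbT ?andbF; last by rewrite subrr.
  rewrite leNgt; case: (ltP _ (sigma w)) => /= h; last by rewrite subr0.
  by rewrite (lt_le_trans h (sst w)) subrr.
have FB n k : F (grid K n k) (B n k).
  have [gK|Kg] := ltP (grid K n k) K; last first.
    rewrite (_ : B n k = set0); first exact: sub_measurable_set0.
    by rewrite -subset0 => w [_ [_]]; rewrite ltNge Kg.
  rewrite (_ : B n k = (A `&` [set w | (sigma w <= (grid K n k)%:E)%E]) `&`
      [set w | ((grid K n k)%:E < tau w)%E]).
    apply: sub_measurable_setI => //; first exact: (stopped_sigmaP sF).
    exact: stopping_time_gt.
  by apply/seteqP; split => w /= [] => [Aw [/andP[? ?] _]|[? ?] ?]; split => //;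
     split => //; apply/andP.
have gK n k : (k <= n.+1)%N -> 0 <= grid K n k <= K.
  by move=> kn; rewrite grid_ge0// grid_le.
have igM n k : (k < n.+1)%N -> itg (fun w => \1_(B n k) w *
     (M (grid K n k.+1) w - M (grid K n k) w)).
  move=> kn; apply: itg_ind; first exact: Fm (FB _ _).
  by apply: itg_B; apply: itg_process; apply: gK => //; exact: ltnW.
have iD n : itg (D n).
  rewrite (_ : D n = fun w => \sum_(k < n.+1) \1_(B n k) w *
     (M (grid K n k.+1) w - M (grid K n k) w)).
    by apply: itg_sum => k; exact: igM.
  by apply/funext => w; exact: DE.
have ED n : \int[P]_w D n w <= 0.
  under eq_Rintegral do rewrite DE.
  rewrite E_sum; last by move=> k; exact: igM.
  apply: sumr_le0 => k _; apply: super => //.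
  - exact: grid_ge0.
  - exact: grid_homo.
  - exact: grid_le.
  - by move=> w [].
  - by move=> w [_ []].
have gH n w x : 0 <= x <= K -> (`|grid_sum K (M^~ w) n x|%:E <= H w)%E.
  by move=> xK; have [y -> [yK _]] := grid_sumE K0 (M^~ w) n xK; exact: MH.
have [_ cv] : itg (fun w => \1_A w * (M (cap tau K w) w - M (cap sigma K w) w)) /\
  \int[P]_w D n w @[n --> \oo] -->
  \int[P]_w (\1_A w * (M (cap tau K w) w - M (cap sigma K w) w)).
  apply: (@E_dominated _ _ _ _ D _ (fun w => H w + H w)%E) => //.
  - by move=> n; exact: itg_measurable (iD n).
  - apply: measurable_funM; first exact: measurable_indic.
    by apply: measurable_funB; apply: measurable_eval => //; exact: measurable_cap.
  - exact: integrableD.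
  - move=> n w; apply: (@le_trans _ _ (`|grid_sum K (M^~ w) n (cap tau K w)| +
        `|grid_sum K (M^~ w) n (cap sigma K w)|)%:E).
      rewrite lee_fin /D normrM (le_trans _ (ler_normB _ _))//.
      by rewrite ler_piMl// indicE; case: (_ \in _); rewrite ?normr1 ?normr0.
    by rewrite EFinD; apply: leeD; apply: gH; exact: cap_bounds.
  - apply: aeW => w; apply: cvgMr; apply: cvgB;
      by apply: grid_sum_cvg => //; exact: cap_bounds.
by rewrite -(cvg_lim _ cv)//; apply: limr_le; [exact: cvgP cv|exact: nearW].
Qed.

End optional_sampling.

(** * Integrals along paths *)

Section path_integral.
Local Open Scope ring_scope.
Context {R : realType}.
Local Notation leb := (@lebesgue_measure R).

Lemma continuous_itg (phi : R -> R) (a b : R) b0 b1 : continuous phi ->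
  leb.-integrable [set` Interval (BSide b0 a) (BSide b1 b)] (EFin \o phi).
Proof.
move=> cphi; have i : leb.-integrable `[a, b] (EFin \o phi).
  apply: continuous_compact_integrable; first exact: segment_compact.
  exact: continuous_subspaceT.
apply: integrableS i => //.
by apply: subset_itv; rewrite bnd_simp; case: b0 b1 => [] [].
Qed.

Definition prim (phi : R -> R) (t : R) : R := \int[leb]_(s in `[0, t]) phi s.

Variable phi : R -> R.
Hypothesis cphi : continuous phi.

Lemma primB s t : 0 <= s -> s <= t ->
  prim phi t - prim phi s = \int[leb]_(x in `]s, t]) phi x.
Proof.
by move=> s0 st; rewrite /prim Rintegral_itvB//; exact: continuous_itg.
Qed.

Lemma EFin_Rint a b b0 b1 :
  ((\int[leb]_(x in [set` Interval (BSide b0 a) (BSide b1 b)]) phi x)%R%:E =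
  \int[leb]_(x in [set` Interval (BSide b0 a) (BSide b1 b)]) (phi x)%:E)%E.
Proof.
rewrite /Rintegral fineK//; apply: integrable_fin_num => //.
exact: continuous_itg.
Qed.

(** This includes [t <= 0], where the integral vanishes. The integrand is cut to zero before 0 and
    integrated from a point [a] below both [t] and 0, so that the continuity of an integral in its
    upper end applies at an interior point. *)
Lemma prim_continuous : continuous (prim phi).
Proof.
move=> t.
pose a := Num.min t 0 - 1.
pose psi := phi \_ `[0, +oo[.
have a_lt : a < t /\ a < 0 by rewrite /a !ltrBlDr !gt_min ltrDl add0r ltr01 orbT.
have at1 : a < t < t + 1 by rewrite a_lt.1 ltrDl ltr01.
have primE x : prim phi x = \int[leb]_(s in `[a, x]) psi s.
  rewrite /prim /psi -Rintegral_mkcondr; congr (Rintegral _ _ _).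
  apply/seteqP; split => y /=; rewrite !in_itv/= andbT.
    move=> /andP[y0 ->]; rewrite andbT; split => //.
    by apply: le_trans y0; rewrite ltW// a_lt.2.
  by move=> [/andP[_ ->] ->].
have psi_itg : leb.-integrable `[a, t + 1] (EFin \o psi).
  rewrite /psi -restrict_EFin; apply/integrable_restrict => //.
  apply: (integrableS _ _ _ (@continuous_itg phi a (t + 1) true false cphi)) => //.
  exact: measurableI.
have at' : a <= t + 1 by lra.
have := parameterized_integral_continuous at' psi_itg.
move=> /continuous_within_itvP; case; first by lra.
move=> /(_ t) + _ _; rewrite in_itv/= => /(_ at1).
rewrite /continuous_at => c; apply: cvg_trans; last first.
  rewrite primE; exact: c.
by apply: near_eq_cvg; near=> x; rewrite primE.
Unshelve. all: end_near. Qed.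

Lemma prim_le t K : t <= K ->
  (`|prim phi t|%:E <= \int[leb]_(s in `[0%R, K]) `|phi s|%:E)%E.
Proof.
move=> tK; rewrite /prim EFin_normr_Rintegral//; last exact: continuous_itg.
have mphi : measurable_fun setT phi by exact: continuous_measurable_fun.
apply: le_trans (le_abse_integral _ _ _) _ => //.
  by apply: measurable_funTS; exact/measurable_EFinP.
apply: ge0_subset_integral => //.
  apply: measurable_funTS; apply/measurable_EFinP; exact: measurableT_comp.
by apply: subset_itvl; rewrite bnd_simp.
Qed.

End path_integral.

Section integral_of_process.
Local Open Scope ring_scope.
Context d (T : measurableType d) (R : realType).
Local Notation leb := (@lebesgue_measure R).

(** Fubini-Tonelli, after extending the integrand by zero outside [D]. *)
Lemma measurable_int_section (g : R * T -> \bar R) (D : set R) :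
  measurable D -> measurable_fun setT g -> (forall z, 0 <= g z)%E ->
  measurable_fun setT (fun w => \int[leb]_(s in D) g (s, w))%E.
Proof.
move=> mD mg g0.
under eq_fun do rewrite integral_mkcond.
have mD' : measurable (D `*` [set: T]) by exact: measurableX.
have mg' : measurable_fun setT (g \_ (D `*` setT)).
  by apply: (measurable_restrictT g mD').1; exact: measurable_funTS.
have g0' z : (0 <= (g \_ (D `*` setT)) z)%E.
  by rewrite patchE; case: ifP.
have := @measurable_fun_fubini_tonelli_G _ _ _ _ R leb _ mg' g0'.
rewrite /fubini_G (_ : (fun y => _) =
  (fun w => \int[leb]_x ((fun s => g (s, w)) \_ D) x)%E)//.
apply/funext => w; apply: eq_integral => x _; rewrite !patchE.
congr (if _ then _ else _); apply/idP/idP => [/set_mem[/= Dx _]|/set_mem Dx];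
  exact: mem_set.
Qed.

Variable f : R -> T -> R.
Hypotheses (fc : forall w, continuous (f^~ w))
  (fm : forall t, measurable_fun setT (f t)).

Lemma measurable_prim t : measurable_fun setT (fun w => prim (f^~ w) t).
Proof.
have mj := measurable_caratheodory fc fm.
have mjE : measurable_fun setT (fun z : R * T => (f z.1 z.2)%:E).
  exact/measurable_EFinP.
rewrite /prim /Rintegral; apply: measurableT_comp; first exact: fine_measurable.
under eq_fun do rewrite integralE.
apply: emeasurable_funB.
- have mp : measurable_fun setT
      (fun z : R * T => maxe (f z.1 z.2)%:E 0%E).
    exact: measurable_maxe.
  have p0 (z : R * T) : (0 <= maxe (f z.1 z.2)%:E 0)%E.
    by rewrite le_max lexx orbT.
  under eq_fun do under eq_integral do rewrite funeposE.
  exact: (measurable_int_section _ mp p0).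
- have mp : measurable_fun setT
      (fun z : R * T => maxe (- (f z.1 z.2)%:E) 0)%E.
    by apply: measurable_maxe => //; exact: measurableT_comp.
  have p0 (z : R * T) : (0 <= maxe (- (f z.1 z.2)%:E) 0)%E.
    by rewrite le_max lexx orbT.
  under eq_fun do under eq_integral do rewrite funenegE.
  exact: (measurable_int_section _ mp p0).
Qed.

End integral_of_process.

Section path_payoff.
Local Open Scope ring_scope.
Context {R : realType}.
Local Notation leb := (@lebesgue_measure R).
Variable phi : R -> R.
Hypothesis cphi : continuous phi.

(** A time interval whose right end may be infinite: the period over which a stopping problem
    started at [t] collects its running profit. *)
Definition window (t : R) (u : \bar R) : set R := [set s | t <= s /\ (s%:E <= u)%E].

Lemma measurable_window t u : measurable (window t u).
Proof.
rewrite (_ : window t u = `[t, +oo[ `&` (EFin @^-1` [set x | (x <= u)%E])).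
  apply: measurableI => //; rewrite -[X in measurable X]setTI.
  by apply: EFin_measurable => //; exact: emeasurable_itv `]-oo, u].
by apply/seteqP; split => s /=; rewrite in_itv/= andbT.
Qed.

Lemma window_fin t u : window t u%:E = `[t, u]%classic.
Proof.
by apply/seteqP; split => s; rewrite /window /= in_itv/= lee_fin => /andP.
Qed.

Lemma primB_window s t : 0 <= s -> s <= t ->
  ((prim phi t - prim phi s)%:E = \int[leb]_(x in window s t%:E) (phi x)%:E)%E.
Proof.
move=> s0 st; rewrite primB// Rintegral_itv_obnd_cbnd; last exact: continuous_itg.
by rewrite EFin_Rint// window_fin.
Qed.

Lemma window_cap t u (K : R) : (0 <= u)%E -> 0 <= K ->
  window t (fine (mine u K%:E))%:E = window t u `&` `]-oo, K].
Proof.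
move=> u0 K0; have -> : (fine (mine u K%:E))%:E = mine u K%:E.
  rewrite fineK//; case: u u0 => [x| |] //= _; by rewrite -EFin_min.
apply/seteqP; split => s; rewrite /window /= in_itv/= le_min lee_fin.
  by move=> [-> /andP[-> ->]].
by move=> [[-> ->] ->].
Qed.

(** Cutting [u] at [n] intersects the window with a half-line that grows with [n], so monotone
    convergence over sets applies. *)
Lemma cvg_window t u (g : R -> R) : (forall x, 0 <= g x) -> continuous g ->
  (0 <= u)%E ->
  (\int[leb]_(x in window t (fine (mine u n%:R%:E))%:E) (g x)%:E @[n --> \oo]
   --> \int[leb]_(x in window t u) (g x)%:E)%E.
Proof.
move=> g0 cg u0.
have wE n : window t (fine (mine u n%:R%:E))%:E = window t u `&` `]-oo, n%:R].
  exact: window_cap.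
under eq_cvg do rewrite wE.
have uE : \bigcup_n (window t u `&` `]-oo, n%:R]) = window t u.
  apply/seteqP; split => [s [n _ []]//|s ws].
  by exists (Num.truncn s).+1 => //; split => //=; rewrite in_itv/= ltW// truncnS_gt.
rewrite -[X in integral _ X]uE.
apply: ge0_nondecreasing_set_cvg_integral => //.
- apply/nondecreasing_seqP => n; apply/subsetPset; apply: setIS.
  by apply: subset_itvl; rewrite bnd_simp ler_nat.
- by move=> n; apply: measurableI => //; exact: measurable_window.
- move=> n; apply: measurable_funTS; apply/measurable_EFinP.
  exact: continuous_measurable_fun.
- by move=> n x _; rewrite lee_fin.
Qed.

End path_payoff.

(** * Optimal stopping *)

Lemma continuous_max0 (R : realType) (phi : R -> R) : continuous phi ->
  continuous (fun x => Num.max (phi x) 0)%R.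
Proof.
move=> c x; under eq_fun do rewrite maxr_absE subr0 addr0.
apply: cvgMl; apply: cvgD; first exact: c.
by apply: cvg_norm; exact: c.
Qed.

Lemma monotone_cvg d (T : measurableType d) (R : realType)
    (mu : {measure set T -> \bar R}) (g_ : nat -> T -> \bar R) g :
  (forall n, measurable_fun setT (g_ n)) -> (forall n w, 0 <= g_ n w) ->
  (forall w, nondecreasing_seq (g_ ^~ w)) ->
  (forall w, g_ n w @[n --> \oo] --> g w) ->
  \int[mu]_w g_ n w @[n --> \oo] --> \int[mu]_w g w.
Proof.
move=> mg g0 gn cg.
have gE w : g w = limn (g_ ^~ w) by apply/esym/cvg_lim.
under eq_integral do rewrite gE.
by apply: cvg_monotone_convergence => // w _; exact: gn.
Qed.

Lemma ler_combine (R : realFieldType) (a b c b' e : R) :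
  (a <= c -> b <= b' + e -> a - b' + b - c <= e)%R.
Proof. by move=> *; lra. Qed.

Lemma ler_combine3 (R : realFieldType) (a b b' e : R) :
  (a <= 0 -> b <= b' + e -> a - b' + b <= e)%R.
Proof. by move=> *; lra. Qed.

Lemma ler_combine4 (R : realFieldType) (a b b' e : R) :
  (0 <= a - b' + b -> b <= b' + e -> - e <= a)%R.
Proof. by move=> *; lra. Qed.

Lemma continuous_minr_cst (R : realType) (c : R) :
  continuous (fun t : R => Num.min t c).
Proof.
move=> t; under eq_fun do rewrite minr_absE.
apply: cvgMl; apply: cvgB; first by apply: cvgD => //; exact: cvg_cst.
by apply: cvg_norm; apply: cvgB => //; exact: cvg_cst.
Qed.

Lemma stopped_sigma_ge d (T : measurableType d) (R : realType)
    (F : R -> set_system T) (s : R) (A : set T) (tau : T -> \bar R) :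
  (forall t, sigma_algebra setT (F t)) -> (forall t, F t `<=` measurable) ->
  (forall s t, s <= t -> F s `<=` F t)%R ->
  stopping_time F tau -> (forall w, s%:E <= tau w) -> F s A ->
  stopped_sigma F tau A.
Proof.
move=> sF Fm Fmono st ts FA; split; first exact: Fm FA.
move=> t t0; have [le_st|ts'] := leP s t.
  apply: sub_measurable_setI => //; first exact: Fmono FA.
  exact: stopping_timeP.
rewrite (_ : A `&` _ = set0); first exact: sub_measurable_set0.
rewrite -subset0 => w /= [_ /(le_trans (ts w))].
by rewrite lee_fin leNgt ts'.
Qed.

Section Borel_Cantelli.
Local Open Scope ring_scope.
Context d (T : measurableType d) (R : realType) (P : probability T R).
Local Notation itg Z := (P.-integrable setT (EFin \o Z)).

(** The bounds sum to at most 1, so the series of absolute values has finite expectation; it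
    converges almost surely and its terms tend to 0. *)
Lemma ae_cvg0_of_E (Z : nat -> T -> R) : (forall k, itg (Z k)) ->
  (forall k, {ae P, forall w, 0 <= Z k w}) ->
  (forall k, \int[P]_w Z k w <= 2^-1 ^+ k.+1) ->
  {ae P, forall w, Z k w @[k --> \oo] --> 0}.
Proof.
move=> iZ Z0 EZ.
pose S n w := \sum_(k < n) `|Z k w|.
have iS n : itg (S n) by apply: itg_sum => k; exact: itg_norm.
have ES n : \int[P]_w S n w <= 1.
  rewrite E_sum; last by move=> k; exact: itg_norm.
  apply: (@le_trans _ _ (\sum_(k < n) 2^-1 ^+ k.+1)).
    apply: ler_sum => k _; apply: le_trans (EZ k).
    apply: E_le_ae => //; first exact: itg_norm.
    by apply: filterS (Z0 k) => w h; rewrite ger0_norm.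
  suff -> : \sum_(k < n) 2^-1 ^+ k.+1 = 1 - 2^-1 ^+ n :> R.
    by rewrite gerBl exprn_ge0// invr_ge0.
  elim: n => [|n IH]; first by rewrite big_ord0 expr0 subrr.
  rewrite big_ord_recr/= IH exprS; move: (2^-1 ^+ n) => q; lra.
have Snd w : nondecreasing_seq (fun n => (S n w)%:E).
  apply/nondecreasing_seqP => n; rewrite lee_fin /S big_ord_recr/= lerDl.
  exact: normr_ge0.
pose L w := ereal_sup (range (fun n => (S n w)%:E)).
have SL w : (S n w)%:E @[n --> \oo] --> L w.
  exact: ereal_nondecreasing_cvgn (Snd w).
have S0 n w : 0 <= S n w by apply: sumr_ge0 => k _; exact: normr_ge0.
have L0 w : (0 <= L w)%E.
  by apply: le_trans (_ : (S 0%N w)%:E <= _)%E; rewrite ?lee_fin//;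
    apply: ereal_sup_ubound; exists 0%N.
have mS n : measurable_fun setT (fun w => (S n w)%:E).
  exact: measurable_int (iS n).
have mL : measurable_fun setT L.
  by apply: (@emeasurable_fun_cvg _ _ _ _ (fun n w => (S n w)%:E)).
have cv : (\int[P]_w (S n w)%:E @[n --> \oo] --> \int[P]_w L w)%E.
  by apply: monotone_cvg => // n w; rewrite lee_fin.
have iL : P.-integrable setT L.
  apply/integrableP; split => //; under eq_integral do rewrite gee0_abs//.
  apply: (@le_lt_trans _ _ 1%E); last exact: ltry.
  rewrite -(cvg_lim _ cv)//; apply: lime_le; first exact: cvgP cv.
  by apply: nearW => n; rewrite E_EFin// lee_fin.
apply: filterS (integrable_ae measurableT iL) => w /(_ I) Lfin.
have Sb n : S n w <= fine (L w).
  by rewrite -lee_fin fineK//; apply: ereal_sup_ubound; exists n.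
apply/norm_cvg0P; apply: (@cvg_series_cvg_0 _ R^o).
have -> : series (fun k => `|Z k w|) = (fun n => S n w).
  by apply/funext => n; rewrite /series/= big_mkord.
apply: nondecreasing_is_cvgn.
  by move=> i j ij; have := Snd w i j ij; rewrite lee_fin.
by exists (fine (L w)) => _ [n _ <-].
Qed.

End Borel_Cantelli.

Section optimal_stopping_problem.
Local Open Scope ring_scope.
Context d (T : measurableType d) (R : realType) (P : probability T R).
Local Notation leb := (@lebesgue_measure R).
Variables (F : R -> set_system T) (f y h : R -> T -> R) (H : T -> \bar R).

Definition abs_int (K : R) (w : T) : \bar R :=
  (\int[leb]_(s in `[0%R, K]) `|f s w|%:E)%E.

Definition fpos s w := Num.max (f s w) 0.
Definition fneg s w := Num.max (- f s w) 0.

Definition payoff t (tau : T -> \bar R) w : \bar R :=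
  (\int[leb]_(s in window t (tau w)) (f s w)%:E +
   if tau w == +oo then 0 else (h (fine (tau w)) w)%:E)%E.

(* A running profit [f], an obstacle [h] collected on stopping (worth 0 at
   infinity) and the value [y] of the stopping problem. *)
Record optimal_stopping_problem : Prop := OptimalStoppingProblem {
  osp_sigma : forall t, sigma_algebra setT (F t) ;
  osp_sub : forall t, F t `<=` measurable ;
  osp_mono : forall s t, s <= t -> F s `<=` F t ;
  osp_fc : forall w, continuous (f^~ w) ;
  osp_yc : forall w, continuous (y^~ w) ;
  osp_hc : forall w, continuous (h^~ w) ;
  osp_fm : forall t, measurable_fun setT (f t) ;
  osp_ym : forall t, measurable_fun setT (y t) ;
  osp_hm : forall t, measurable_fun setT (h t) ;
  osp_y_ad : forall t : R, 0 <= t ->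
    measurable_fun (setT : set (g_sigma_algebraType (F t))) (y t) ;
  osp_h_ad : forall t : R, 0 <= t ->
    measurable_fun (setT : set (g_sigma_algebraType (F t))) (h t) ;
  osp_iH : P.-integrable setT H ;
  osp_yH : forall t w, (`|y t w|%:E <= H w)%E ;
  osp_hH : forall t w, (`|h t w|%:E <= H w)%E ;
  osp_h_lim : {ae P, forall w, h t w @[t --> +oo] --> 0} ;
  osp_loc : forall K, P.-integrable setT (abs_int K) ;
  osp_wd :
    (\int[P]_w \int[leb]_(s in `[0%R, +oo[) (fpos s w)%:E < +oo)%E \/
    (\int[P]_w \int[leb]_(s in `[0%R, +oo[) (fneg s w)%:E < +oo)%E ;
  osp_sup : forall t : R, 0 <= t -> is_ess_sup P (fun w => (y t w)%:E)
    [set V | exists tau, [/\ stopping_time F tau, forall w, (t%:E <= tau w)%E &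
     is_cond_exp P (F t) (payoff t tau) V]] }.

End optimal_stopping_problem.

(** * Truncated gains and integrability of the running profit *)

Section optimal_stopping.
Local Open Scope ring_scope.
Context d (T : measurableType d) (R : realType) (P : probability T R).
Local Notation itg Z := (P.-integrable setT (EFin \o Z)).
Local Notation leb := (@lebesgue_measure R).
Variables (F : R -> set_system T) (f y h : R -> T -> R) (H : T -> \bar R).
Hypothesis pb : optimal_stopping_problem P F f y h H.
Let sF := osp_sigma pb.
Let Fm := osp_sub pb.
Let Fmono := osp_mono pb.
Let fc := osp_fc pb.
Let yc := osp_yc pb.
Let hc := osp_hc pb.
Let fm := osp_fm pb.
Let ym := osp_ym pb.
Let hm := osp_hm pb.
Let y_ad := osp_y_ad pb.
Let h_ad := osp_h_ad pb.
Let iH := osp_iH pb.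
Let yH := osp_yH pb.
Let hH := osp_hH pb.
Let h_lim := osp_h_lim pb.
Let f_loc := osp_loc pb.
Let f_wd := osp_wd pb.
Let y_sup := osp_sup pb.
Local Notation fpos := (fpos f).
Local Notation fneg := (fneg f).
Local Notation abs_int := (abs_int f).
Local Notation payoff := (payoff f h).

Definition cum t w := prim (f^~ w) t.

(** The payoff from [t] when stopping at the minimum of [tau] and [K]; a finite horizon lets it be
    real-valued, the running part being a difference of primitives. *)
Definition gain t tau K w := cum (cap tau K w) w - cum t w + h (cap tau K w) w.

Lemma cum_continuous w : continuous (cum^~ w).
Proof. exact: prim_continuous. Qed.

Lemma cum_measurable t : measurable_fun setT (cum t).
Proof. exact: measurable_prim. Qed.

Lemma cum_bound t K w : t <= K -> (`|cum t w|%:E <= abs_int K w)%E.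
Proof. exact: prim_le. Qed.

Lemma itg_y t : itg (y t).
Proof. by apply: itg_dom iH _ => // w. Qed.

Lemma itg_cum t : itg (cum t).
Proof.
apply: itg_dom (f_loc t) _; first exact: cum_measurable.
by move=> w; exact: cum_bound.
Qed.

Lemma cum_cap_measurable tau K : stopping_time F tau -> 0 <= K ->
  measurable_fun setT (fun w => cum (cap tau K w) w).
Proof.
move=> st K0; apply: measurable_eval; first exact: cum_continuous.
  exact: cum_measurable.
exact: measurable_cap.
Qed.

Lemma itg_cum_cap tau K : stopping_time F tau -> 0 <= K ->
  itg (fun w => cum (cap tau K w) w).
Proof.
move=> st K0; apply: itg_dom (f_loc K) _; first exact: cum_cap_measurable.
by move=> w; apply: cum_bound; apply: cap_leK => //; case: st.
Qed.

Lemma itg_y_cap tau K : stopping_time F tau -> 0 <= K ->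
  itg (fun w => y (cap tau K w) w).
Proof.
move=> st K0; apply: itg_dom iH _ => //.
by apply: measurable_eval => //; exact: measurable_cap.
Qed.

Lemma itg_h_cap tau K : stopping_time F tau -> 0 <= K ->
  itg (fun w => h (cap tau K w) w).
Proof.
move=> st K0; apply: itg_dom iH _ => //.
by apply: measurable_eval => //; exact: measurable_cap.
Qed.

Lemma itg_gain t tau K : stopping_time F tau -> 0 <= K -> itg (gain t tau K).
Proof.
move=> st K0; apply: itg_D; last exact: itg_h_cap.
by apply: itg_B; [exact: itg_cum_cap|exact: itg_cum].
Qed.

Lemma payoff_min t tau K : 0 <= t -> t <= K -> stopping_time F tau ->
  (forall w, (t%:E <= tau w)%E) ->
  payoff t (fun w => mine (tau w) K%:E) = EFin \o gain t tau K.
Proof.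
move=> t0 tK [st0 _] tt; apply/funext => w /=.
have K0 := le_trans t0 tK.
rewrite /payoff -capE// /gain EFinD; congr (_ + _)%E.
by rewrite -primB_window// -lee_fin capE// le_min tt lee_fin.
Qed.

Lemma stopping_time_minK tau K : 0 <= K -> stopping_time F tau ->
  stopping_time F (fun w => mine (tau w) K%:E).
Proof.
by move=> K0 st; apply: stopping_time_min => //; exact: stopping_time_cst.
Qed.

(** A truncated time competes in the essential supremum, and its gain is integrable, hence has a
    real conditional version to compare with [y t]. *)
Lemma gain_le t tau K A : 0 <= t -> t <= K -> stopping_time F tau ->
  (forall w, (t%:E <= tau w)%E) -> F t A ->
  \int[P]_w (\1_A w * gain t tau K w) <= \int[P]_w (\1_A w * y t w).
Proof.
move=> t0 tK st tt FA; have K0 := le_trans t0 tK.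
have [V cV iV] := cond_version_ex (sF t) (@Fm t) (itg_gain t st K0).
apply: (cond_version_le (@Fm t) (itg_y t) FA cV).
have [_ /(_ (EFin \o V)) + _] := y_sup t0.
move=> h'; apply: filterS (h' _); first by move=> w; rewrite lee_fin.
exists (fun w => mine (tau w) K%:E); split.
- exact: stopping_time_minK.
- by move=> w; rewrite le_min tt lee_fin.
- by rewrite payoff_min.
Qed.

(** Each time is cut at its own horizon before pasting; cutting again at the larger horizon then
    changes nothing. *)
Lemma gain_paste t tau1 tau2 K1 K2 A : 0 <= t -> t <= K1 -> t <= K2 ->
  stopping_time F tau1 -> stopping_time F tau2 ->
  (forall w, (t%:E <= tau1 w)%E) -> (forall w, (t%:E <= tau2 w)%E) -> F t A ->
  exists tau K, [/\ t <= K, stopping_time F tau, forall w, (t%:E <= tau w)%E &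
    paste A (gain t tau1 K1) (gain t tau2 K2) = gain t tau K].
Proof.
move=> t0 tK1 tK2 st1 st2 tt1 tt2 FA.
have K10 := le_trans t0 tK1; have K20 := le_trans t0 tK2.
exists (fun w => if w \in A then mine (tau1 w) K1%:E else mine (tau2 w) K2%:E).
exists (Num.max K1 K2).
have tt1' w : (t%:E <= mine (tau1 w) K1%:E)%E by rewrite le_min tt1 lee_fin.
have tt2' w : (t%:E <= mine (tau2 w) K2%:E)%E by rewrite le_min tt2 lee_fin.
split.
- by rewrite le_max tK1.
- by apply: stopping_time_paste t0 FA _ _ tt1' tt2' => //; exact: stopping_time_minK.
- by move=> w; case: ifP.
- apply/funext => w; rewrite /paste /gain.
  have -> : cap (fun w => if w \in A then mine (tau1 w) K1%:E else
      mine (tau2 w) K2%:E) (Num.max K1 K2) w =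
      if w \in A then cap tau1 K1 w else cap tau2 K2 w.
    rewrite /cap; case: ifP => _; congr fine; apply/min_idPl.
      by rewrite ge_min lee_fin le_max lexx !orbT.
    by rewrite ge_min lee_fin le_max lexx !orbT.
  by case: ifP.
Qed.

Lemma fpos_ge0 s w : 0 <= fpos s w. Proof. by rewrite le_max lexx orbT. Qed.
Lemma fneg_ge0 s w : 0 <= fneg s w. Proof. by rewrite le_max lexx orbT. Qed.

Lemma fposneg s w : f s w = fpos s w - fneg s w.
Proof. by rewrite /fpos /fneg /Num.max; case: ltP => ?; case: ltP => ?; lra. Qed.

Lemma fpos_continuous w : continuous (fpos^~ w).
Proof. exact: continuous_max0. Qed.

Lemma fneg_continuous w : continuous (fneg^~ w).
Proof. by apply: continuous_max0 => x; apply: cvgN; exact: fc. Qed.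

Lemma fpos_measurable t : measurable_fun setT (fpos t).
Proof. exact: measurable_maxr. Qed.

Lemma fneg_measurable t : measurable_fun setT (fneg t).
Proof. by apply: measurable_maxr => //; exact: measurable_funN. Qed.

Lemma cumE t w : cum t w = prim (fpos^~ w) t - prim (fneg^~ w) t.
Proof.
rewrite /cum /prim -RintegralB//; last 2 first.
- by apply: continuous_itg; exact: fpos_continuous.
- by apply: continuous_itg; exact: fneg_continuous.
by apply: eq_Rintegral => s _; exact: fposneg.
Qed.

Lemma fpos_meas2 : measurable_fun setT (fun z : R * T => (fpos z.1 z.2)%:E).
Proof.
apply/measurable_EFinP; apply: measurable_caratheodory.
  exact: fpos_continuous.
exact: fpos_measurable.
Qed.

Lemma fneg_meas2 : measurable_fun setT (fun z : R * T => (fneg z.1 z.2)%:E).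
Proof.
apply/measurable_EFinP; apply: measurable_caratheodory.
  exact: fneg_continuous.
exact: fneg_measurable.
Qed.

Definition fpos_tot w := (\int[leb]_(s in `[0%R, +oo[) (fpos s w)%:E)%E.

Lemma measurable_fpos_tot : measurable_fun setT fpos_tot.
Proof.
apply: (measurable_int_section (g := fun z => (fpos z.1 z.2)%:E)) => //.
- exact: fpos_meas2.
- by move=> z; rewrite lee_fin fpos_ge0.
Qed.

Lemma fpos_tot_ge0 w : (0 <= fpos_tot w)%E.
Proof. by apply: integral_ge0 => s _; rewrite lee_fin fpos_ge0. Qed.

Lemma itg_prim_fpos K : itg (fun w => prim (fpos^~ w) K).
Proof.
apply: itg_dom (f_loc K) _.
  by apply: measurable_prim; [exact: fpos_continuous|exact: fpos_measurable].
move=> w; rewrite /abs_int.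
have /le_trans := prim_le (fpos_continuous (w := w)) (lexx K); apply.
apply: ge0_le_integral => //.
- apply: measurable_funTS; apply/measurable_EFinP; apply: measurableT_comp => //.
  apply: continuous_measurable_fun; exact: fpos_continuous.
- apply: measurable_funTS; apply/measurable_EFinP; apply: measurableT_comp => //.
  exact: continuous_measurable_fun.
- move=> s _; rewrite lee_fin ger0_norm ?fpos_ge0// /fpos ge_max normr_ge0 andbT.
  exact: ler_norm.
Qed.

Lemma itg_prim_fneg K : itg (fun w => prim (fneg^~ w) K).
Proof.
apply: eq_integrable (itg_B (itg_prim_fpos K) (itg_cum K)) => // w _ /=.
by rewrite cumE opprB addrCA subrr addr0.
Qed.

Lemma cum0 w : cum 0 w = 0.
Proof. by rewrite /cum /prim set_itv1 Rintegral_set1. Qed.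

Lemma windowy (t : R) : window t +oo%E = `[t, +oo[%classic.
Proof.
by apply/seteqP; split => s; rewrite /window /= in_itv/= leey andbT; [case|].
Qed.

Lemma nd_prim (phi : R -> R) s t : continuous phi -> (forall x, 0 <= phi x) -> s <= t ->
  prim phi s <= prim phi t.
Proof.
move=> c p0 st; rewrite -lee_fin /prim !EFin_Rint//.
apply: ge0_subset_integral => //.
- by apply: measurable_funTS; apply/measurable_EFinP; exact: continuous_measurable_fun.
- by move=> x _; rewrite lee_fin.
- by apply: subset_itvl; rewrite bnd_simp.
Qed.

Lemma prim_cvg (phi : R -> R) : continuous phi -> (forall x, 0 <= phi x) ->
  (prim phi n%:R)%:E @[n --> \oo] --> (\int[leb]_(s in `[0%R, +oo[) (phi s)%:E)%E.
Proof.
move=> c p0; have := cvg_window (t := 0) p0 c (leey 0%E).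
rewrite windowy; apply: cvg_trans; apply: near_eq_cvg; apply: nearW => n /=.
by rewrite /prim EFin_Rint// window_fin.
Qed.

(** Only the second alternative of [osp_wd] requires an argument. Stopping at the deterministic time
    [n] bounds the expected positive part up to [n] by the mean of [y 0], plus that of [H], plus the
    total negative part; this bound [B] does not depend on [n]. *)
Lemma fpos_tot_lty : (\int[P]_w fpos_tot w < +oo)%E.
Proof.
case: f_wd => [//|neg].
pose B := ((\int[P]_w y 0 w)%R%:E + \int[P]_w H w +
  \int[P]_w \int[leb]_(s in `[0%R, +oo[) (fneg s w)%:E)%E.
have H0 w : (0 <= H w)%E by apply: le_trans (yH 0 w); rewrite lee_fin.
have By : (B < +oo)%E.
  rewrite /B; do 2 (apply: lte_add_pinfty => //).
    exact: ltry.
  by apply: integrable_lty.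
apply: le_lt_trans By.
have cv : (\int[P]_w (prim (fpos^~ w) n%:R)%:E @[n --> \oo] --> \int[P]_w fpos_tot w)%E.
  apply: monotone_cvg.
  - by move=> n; apply/measurable_EFinP; exact: itg_measurable (itg_prim_fpos _).
  - by move=> n w; rewrite lee_fin; apply: Rintegral_ge0 => s _; exact: fpos_ge0.
  - move=> w; apply/nondecreasing_seqP => n; rewrite lee_fin.
    apply: nd_prim; [exact: fpos_continuous|by move=> x; exact: fpos_ge0|].
    by rewrite ler_nat.
  - by move=> w; apply: prim_cvg; [exact: fpos_continuous|by move=> x; exact: fpos_ge0].
rewrite -(cvg_lim _ cv)//; apply: lime_le; first exact: cvgP cv.
apply: nearW => n; rewrite E_EFin; last exact: itg_prim_fpos.
have sn : stopping_time F (fun=> n%:R%:E) by exact: stopping_time_cst.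
have gE w : gain 0 (fun=> n%:R%:E) n%:R w =
    prim (fpos^~ w) n%:R - prim (fneg^~ w) n%:R + h n%:R w.
  rewrite /gain cum0 subr0 -cumE.
  by have -> : cap (fun=> n%:R%:E) n%:R w = n%:R :> R by rewrite /cap minxx.
have ih : itg (h n%:R) by apply: itg_dom iH _ => // w.
have ip := itg_prim_fpos n%:R; have in' := itg_prim_fneg n%:R.
have le1 : \int[P]_w prim (fpos^~ w) n%:R <=
   \int[P]_w y 0 w + \int[P]_w (- h n%:R w) + \int[P]_w prim (fneg^~ w) n%:R.
  have n0 : 0 <= n%:R :> R by [].
  have n0e (w : T) : (0%:E <= n%:R%:E :> \bar R)%E by rewrite lee_fin.
  have := gain_le (lexx 0) n0 sn n0e (sub_measurable_setT (sF 0)).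
  rewrite (@eq_Rintegral _ _ _ P setT (fun w => prim (fpos^~ w) n%:R -
    prim (fneg^~ w) n%:R + h n%:R w)); last by move=> w _; rewrite indicT mul1r gE.
  rewrite [leRHS](@eq_Rintegral _ _ _ P setT (y 0)); last first.
    by move=> w _; rewrite indicT mul1r.
  rewrite E_D//; last exact: itg_B.
  by rewrite E_B// E_N// => {n0e} le1; lra.
have : ((\int[P]_w prim (fpos^~ w) n%:R)%:E <= (\int[P]_w y 0 w +
  \int[P]_w (- h n%:R w) + \int[P]_w prim (fneg^~ w) n%:R)%:E)%E by rewrite lee_fin.
move=> /le_trans; apply; rewrite !EFinD /B; apply: leeD.
  apply: leeD => //; rewrite -E_EFin; last exact: itg_N.
  apply: le_integral => //; first exact: itg_N.
  move=> w _; apply: le_trans (hH n%:R w); rewrite lee_fin -normrN; exact: ler_norm.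
rewrite -E_EFin; last exact: itg_prim_fneg.
apply: ge0_le_integral => //.
- by move=> w _; rewrite lee_fin; apply: Rintegral_ge0 => s _; exact: fneg_ge0.
- by apply/measurable_EFinP; exact: itg_measurable (itg_prim_fneg _).
- apply: (measurable_int_section (g := fun z => (fneg z.1 z.2)%:E)) => //.
    exact: fneg_meas2.
  by move=> z; rewrite lee_fin fneg_ge0.
- move=> w _; rewrite /prim EFin_Rint; last exact: fneg_continuous.
  apply: ge0_subset_integral => //.
  + apply: measurable_funTS; apply/measurable_EFinP.
    apply: continuous_measurable_fun; exact: fneg_continuous.
  + by move=> x _; rewrite lee_fin fneg_ge0.
  + by apply: subset_itvl; rewrite bnd_simp.
Qed.

Definition fpos_on t (u : T -> \bar R) w := (\int[leb]_(s in window t (u w)) (fpos s w)%:E)%E.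
Definition fneg_on t (u : T -> \bar R) w := (\int[leb]_(s in window t (u w)) (fneg s w)%:E)%E.

Definition terminal (tau : T -> \bar R) w :=
  if tau w == +oo%E then 0 else h (fine (tau w)) w.

Lemma payoffE t tau w :
  payoff t tau w = (fpos_on t tau w - fneg_on t tau w + (terminal tau w)%:E)%E.
Proof.
rewrite /payoff integralE /fpos_on /fneg_on /terminal; congr (_ - _ + _)%E.
- by apply: eq_integral => s _; rewrite funeposE /= EFin_max.
- by apply: eq_integral => s _; rewrite funenegE /= EFin_max.
- by case: ifP.
Qed.

(** * Payoffs of untruncated stopping times *)

Section cond_payoff.
Variables (t : R) (tau : T -> \bar R).
Hypotheses (t0 : 0 <= t) (st : stopping_time F tau)
  (tt : forall w, (t%:E <= tau w)%E).

Let tau0 w : (0 <= tau w)%E. Proof. by case: st. Qed.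

Let on_cvg (g : R -> T -> R) w : continuous (g^~ w) -> (forall s, 0 <= g s w) ->
  ((prim (g^~ w) (cap tau n%:R w) - prim (g^~ w) t)%:E @[n --> \oo] -->
  \int[leb]_(s in window t (tau w)) (g s w)%:E)%E.
Proof.
move=> c g0; apply: cvg_trans (cvg_window (t := t) g0 c (tau0 w)).
apply: near_eq_cvg; near=> n.
apply/esym/primB_window => //.
rewrite -lee_fin capE// le_min tt lee_fin.
by near: n; exact: nbhs_infty_ger.
Unshelve. all: end_near. Qed.

Let on_le (g : R -> T -> R) w K : continuous (g^~ w) -> (forall s, 0 <= g s w) ->
  t <= K ->
  ((prim (g^~ w) (cap tau K w) - prim (g^~ w) t)%:E <=
  \int[leb]_(s in window t (tau w)) (g s w)%:E)%E.
Proof.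
move=> c g0 tK; have K0 := le_trans t0 tK.
have tc : t <= cap tau K w by rewrite -lee_fin capE// le_min tt lee_fin.
rewrite primB_window//; apply: ge0_subset_integral => //.
- exact: measurable_window.
- exact: measurable_window.
- apply: measurable_funTS; apply/measurable_EFinP; exact: continuous_measurable_fun.
- by move=> x _; rewrite lee_fin.
- by move=> x [tx xc]; split => //; rewrite (le_trans xc)// capE// ge_min lexx.
Qed.

Let measurable_on (g : R -> T -> R) : (forall w, continuous (g^~ w)) ->
  (forall s w, 0 <= g s w) -> (forall s, measurable_fun setT (g s)) ->
  measurable_fun setT (fun w => \int[leb]_(s in window t (tau w)) (g s w)%:E)%E.
Proof.
move=> c g0 mg; apply: (@emeasurable_fun_cvg _ _ _ _
  (fun n w => (prim (g^~ w) (cap tau n%:R w) - prim (g^~ w) t)%:E)) => //.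
  move=> n; apply/measurable_EFinP; apply: measurable_funB; last exact: measurable_prim.
  apply: (measurable_eval (M := fun s w => prim (g^~ w) s)).
  - by move=> w; exact: prim_continuous.
  - by move=> s; exact: measurable_prim.
  - exact: measurable_cap.
by move=> w _; exact: on_cvg.
Qed.

Let mpos : measurable_fun setT (fpos_on t tau).
Proof.
by apply: measurable_on; [exact: fpos_continuous|move=> *; exact: fpos_ge0|exact: fpos_measurable].
Qed.

Let mneg : measurable_fun setT (fneg_on t tau).
Proof.
by apply: measurable_on; [exact: fneg_continuous|move=> *; exact: fneg_ge0|exact: fneg_measurable].
Qed.

Let pos0 w : (0 <= fpos_on t tau w)%E.
Proof. by apply: integral_ge0 => s _; rewrite lee_fin fpos_ge0. Qed.

Let neg0 w : (0 <= fneg_on t tau w)%E.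
Proof. by apply: integral_ge0 => s _; rewrite lee_fin fneg_ge0. Qed.

Let ipos : P.-integrable setT (fpos_on t tau).
Proof.
apply/integrableP; split => //; apply: le_lt_trans fpos_tot_lty.
apply: ge0_le_integral => //.
- exact: measurableT_comp.
- exact: measurable_fpos_tot.
move=> w _; rewrite gee0_abs//; apply: ge0_subset_integral => //.
- exact: measurable_window.
- apply: measurable_funTS; apply/measurable_EFinP.
  apply: continuous_measurable_fun; exact: fpos_continuous.
- by move=> x _; rewrite lee_fin fpos_ge0.
- by move=> x [tx _] /=; rewrite in_itv/= andbT (le_trans t0).
Qed.

Let mterminal : measurable_fun setT (terminal tau).
Proof.
have mtau := stopping_time_measurable sF Fm st.
apply: measurable_fun_ifT => //.
  apply: (measurable_fun_bool true); rewrite setTI.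
  rewrite (_ : _ @^-1` _ = tau @^-1` [set +oo%E]).
    by rewrite -[X in measurable X]setTI; apply: mtau.
  by apply/seteqP; split => w /= /eqP.
apply: measurable_eval => //.
by apply: measurableT_comp => //; exact: fine_measurable.
Qed.

Let H0 w : (0 <= H w)%E. Proof. by apply: le_trans (yH 0 w); rewrite lee_fin. Qed.

Let terminalH w : (`|terminal tau w|%:E <= H w)%E.
Proof. by rewrite /terminal; case: ifP => _ //; rewrite normr0. Qed.

Let terminal_cvg : {ae P, forall w, h (cap tau n%:R w) w @[n --> \oo] --> terminal tau w}.
Proof.
apply: filterS h_lim => w hw; rewrite /terminal; case: eqP => [ty|/eqP ty].
  apply: (@cvg_trans _ (h n%:R w @[n --> \oo])).
    apply: near_eq_cvg; near=> n; rewrite cap_cst//.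
    by rewrite ty leey.
  apply: (cvg_comp _ _ _ hw); exact: cvgr_idn.
have [x tx] : exists x, tau w = x%:E.
  by move: ty (tau0 w); case: (tau w) => [x| |]//; exists x.
rewrite tx /=; apply: cvg_near_cst; near=> n.
rewrite (cap_id tau0 tx)//; near: n; exact: nbhs_infty_ger.
Unshelve. all: end_near. Qed.

Let gainE K w : gain t tau K w = (prim (fpos^~ w) (cap tau K w) - prim (fpos^~ w) t) -
  (prim (fneg^~ w) (cap tau K w) - prim (fneg^~ w) t) + h (cap tau K w) w.
Proof. by rewrite /gain !cumE; lra. Qed.

Variables (Vx : T -> \bar R) (V : T -> R).
Hypotheses (xV : is_cond_exp P (F t) (payoff t tau) Vx)
  (mV : measurable_fun setT (V : g_sigma_algebraType (F t) -> R)) (iV : itg V)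
  (leV : forall K A, t <= K -> F t A ->
     \int[P]_w (\1_A w * gain t tau K w) <= \int[P]_w (\1_A w * V w)).

(** The negative part of the payoff may have infinite expectation, so the truncated gains cannot be
    passed to the limit globally. The limit is taken on the events [B n], where the claim fails
    while both parts of the conditional expectation are at most [n]. There the payoff is integrable,
    dominated convergence applies, and the resulting inequality makes [B n] negligible. *)
Lemma cond_payoff_le : {ae P, forall w, (Vx w <= (V w)%:E)%E}.
Proof.
have nNy (z : \bar R) : (0 <= z)%E -> z != -oo%E.
  by move=> z0; rewrite gt_eqF// (lt_le_trans _ z0)// ltNy0.
have [Vp [Vn [[mVp Vp0 eVp] [mVn Vn0 eVn] VxE]]] := xV.
pose x := payoff t tau.
have mx : measurable_fun setT x.
  have -> : x = (fun w => fpos_on t tau w - fneg_on t tau w + (terminal tau w)%:E)%E.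
    by apply/funext => w; exact: payoffE.
  apply: emeasurable_funD; last exact/measurable_EFinP.
  exact: emeasurable_funB.
pose B n := [set w | (Vp w <= n%:R%:E)%E] `&` [set w | (Vn w <= n%:R%:E)%E] `&`
   [set w | V w < fine (Vp w) - fine (Vn w)].
have FB n : F t (B n).
  apply: sub_measurable_setI => //; first apply: sub_measurable_setI => //.
  - apply: (sub_measurableE (sF t) _).1; rewrite -[X in measurable X]setTI.
    exact: emeasurable_fun_infty_c.
  - apply: (sub_measurableE (sF t) _).1; rewrite -[X in measurable X]setTI.
    exact: emeasurable_fun_infty_c.
  - apply: (sub_measurableE (sF t) _).1.
    have -> : [set w | V w < fine (Vp w) - fine (Vn w)] =
      (fun w : g_sigma_algebraType (F t) => V w < fine (Vp w) - fine (Vn w)) @^-1` [set true].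
      by apply/seteqP; split.
    rewrite -[X in measurable X]setTI; apply: measurable_fun_ltr => //.
    by apply: measurable_funB; apply: measurableT_comp => //; exact: fine_measurable.
have ltVpVn w n : B n w -> [/\ Vp w = (fine (Vp w))%:E & Vn w = (fine (Vn w))%:E].
  move=> [[Vpn Vnn] _]; split; rewrite fineK//.
    by rewrite ge0_fin_numE// (le_lt_trans Vpn)// ltry.
  by rewrite ge0_fin_numE// (le_lt_trans Vnn)// ltry.
have BN n : {ae P, forall w, ~ B n w}.
  have mB : measurable (B n) by exact: Fm (FB n).
  have finB : (P (B n) < +oo)%E by rewrite (le_lt_trans (probability_le1 P mB)) ?ltry.
  have mVpT := sub_measurable_fun (sF t) (@Fm t) mVp.
  have mVnT := sub_measurable_fun (sF t) (@Fm t) mVn.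
  have bounded_itg (W : T -> \bar R) : measurable_fun setT W ->
      (forall w, 0 <= W w)%E -> (forall w, B n w -> (W w <= n%:R%:E)%E) ->
      P.-integrable (B n) W.
    move=> mW W0 Wn; apply: (@le_integrable _ _ _ _ _ mB _ (cst n%:R%:E)).
    - exact: measurable_funTS.
    - by move=> w Bw /=; rewrite gee0_abs// ger0_norm// Wn.
    - exact: finite_measure_integrable_cst.
  have iVp : P.-integrable (B n) Vp by apply: bounded_itg => // w [[]].
  have iVn : P.-integrable (B n) Vn by apply: bounded_itg => // w [[]].
  (* On events of [F t] the negative part of the payoff has the same integral as [Vn], which is
     bounded on [B n]. *)
  have xneg : P.-integrable (B n) (x^\-)%E.
    apply/integrableP; split; first exact/measurable_funTS/measurable_funeneg.
    under eq_integral do rewrite gee0_abs ?funeneg_ge0//.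
    rewrite -eVn//; exact: integrable_lty.
  have iposB : P.-integrable (B n) (fpos_on t tau) by exact: integrableS ipos.
  have iHB : P.-integrable (B n) H by exact: integrableS iH.
  (* The running loss is at most the negative part of the payoff, plus the running income, plus the
     bound [H] of the terminal term. *)
  have ineg : P.-integrable (B n) (fneg_on t tau).
    apply: (@le_integrable _ _ _ _ _ mB _ (fun w => x^\- w + fpos_on t tau w + H w)%E).
    - exact: measurable_funTS.
    - move=> w _; rewrite gee0_abs// gee0_abs; last first.
        by do 2 apply: adde_ge0 => //; exact: funeneg_ge0.
      rewrite funenegE /x payoffE.
      move: (pos0 w) (neg0 w) (terminalH w).
      case: (fpos_on t tau w) => [a| |]//; last first.
        move=> _ _ _; rewrite addey; last by apply: nNy; rewrite le_max lexx orbT.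
        by rewrite addye ?leey ?nNy.
      case: (fneg_on t tau w) => [b| |]//; last first.
        by move=> _ _ _; rewrite /= maxye addye ?leey ?nNy.
      rewrite !lee_fin => a0 b0 tH.
      apply: (@le_trans _ _ ((Num.max (- (a - b + terminal tau w)) 0 + a)%:E +
          `|terminal tau w|%:E)%E); last by apply: leeD => //; rewrite EFinD EFin_max.
      rewrite -EFinD lee_fin.
      have := ler_norm (terminal tau w).
      have : - (a - b + terminal tau w) <= Num.max (- (a - b + terminal tau w)) 0.
        by rewrite le_max lexx.
      by move=> ? ?; lra.
    - by apply: integrableD => //; apply: integrableD.
  pose D := ((fun w => fpos_on t tau w + fneg_on t tau w + H w) \_ (B n))%E.
  have iD : P.-integrable setT D.
    by apply/(integrable_mkcond _ mB).1; apply: integrableD => //; apply: integrableD.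
  (* The shift makes all horizons exceed [t], as [leV] demands. *)
  pose k0 := (Num.truncn t).+1.
  have tk k : t <= (k + k0)%:R.
    by rewrite natrD ler_wpDl// ltW// truncnS_gt.
  pose Z w := \1_(B n) w * (fine (fpos_on t tau w) - fine (fneg_on t tau w) +
     terminal tau w).
  have [|||||iZ cZ] := @E_dominated _ _ _ P
    (fun k w => \1_(B n) w * gain t tau (k + k0)%:R w) Z D.
  - move=> k; apply: measurable_funM; first exact: measurable_indic.
    exact: itg_measurable (itg_gain t st (ler0n _ _)).
  - apply: measurable_funM; first exact: measurable_indic.
    by apply: measurable_funD => //; apply: measurable_funB;
      apply: measurableT_comp => //; exact: fine_measurable.
  - exact: iD.
  - move=> k w; rewrite /D patchE indicE; case: ifP => _; last by rewrite mul0r normr0.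
    rewrite mul1r gainE.
    apply: (@le_trans _ _ (`|(prim (fpos^~ w) (cap tau (k + k0)%:R w) - prim (fpos^~ w) t)|%:E
      + `|(prim (fneg^~ w) (cap tau (k + k0)%:R w) - prim (fneg^~ w) t)|%:E
      + `|h (cap tau (k + k0)%:R w) w|%:E)%E).
      by rewrite -!EFinD lee_fin (le_trans (ler_normD _ _))// lerD2r ler_normB.
    have tc : t <= cap tau (k + k0)%:R w.
      by rewrite -lee_fin capE// le_min tt lee_fin tk.
    apply: leeD => //; apply: leeD.
    + rewrite ger0_norm; last first.
        by rewrite subr_ge0; apply: nd_prim; [exact: fpos_continuous|move=> ?; exact: fpos_ge0|].
      by apply: on_le; [exact: fpos_continuous|move=> ?; exact: fpos_ge0|].
    + rewrite ger0_norm; last first.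
        by rewrite subr_ge0; apply: nd_prim; [exact: fneg_continuous|move=> ?; exact: fneg_ge0|].
      by apply: on_le; [exact: fneg_continuous|move=> ?; exact: fneg_ge0|].
  - have := integrable_ae mB iposB; have := integrable_ae mB ineg.
    apply: filterS3 terminal_cvg => w ct fb fa; rewrite /Z indicE.
    have [/set_mem Bw|_] := boolP (w \in B n); last first.
      under eq_cvg do rewrite mul0r; rewrite mul0r; exact: cvg_cst.
    rewrite mul1r.
    pose u k := prim (fpos^~ w) (cap tau k%:R w) - prim (fpos^~ w) t -
      (prim (fneg^~ w) (cap tau k%:R w) - prim (fneg^~ w) t) + h (cap tau k%:R w) w.
    suff c : u @ \oo --> fine (fpos_on t tau w) - fine (fneg_on t tau w) + terminal tau w.
      rewrite -(cvg_shiftn k0) in c; apply: cvg_trans c.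
      by apply: near_eq_cvg; apply: nearW => k; rewrite mul1r gainE.
    apply: cvgD => //; apply: cvgB.
      have := on_cvg (w := w) (fpos_continuous (w := w)) (fun s => fpos_ge0 s w).
      by rewrite -/(fpos_on t tau w) -[fpos_on t tau w]fineK ?fa// => /fine_cvg.
    have := on_cvg (w := w) (fneg_continuous (w := w)) (fun s => fneg_ge0 s w).
    by rewrite -/(fneg_on t tau w) -[fneg_on t tau w]fineK ?fb// => /fine_cvg.
  have EZ : \int[P]_w Z w <= \int[P]_w (\1_(B n) w * V w).
    rewrite -(cvg_lim _ cZ)//; apply: limr_le; first exact: cvgP cZ.
    by apply: nearW => k; apply: leV.
  pose W w := \1_(B n) w * (fine (Vp w) - fine (Vn w)).
  have iW : itg W.
    apply: itg_domR (itg_cst P (n%:R + n%:R)) _.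
      apply: measurable_funM; first exact: measurable_indic.
      by apply: measurable_funB; apply: measurableT_comp => //; exact: fine_measurable.
    move=> w; rewrite /W indicE; have [/set_mem Bw|_] := boolP (w \in B n); last first.
      by rewrite mul0r normr0 addr_ge0.
    have [ep en] := ltVpVn _ _ Bw; case: Bw => -[/=].
    rewrite ep en /= !lee_fin => hp hn _; rewrite mul1r (le_trans (ler_normB _ _))//.
    by rewrite !ger0_norm ?fine_ge0// lerD.
  have EZW : \int[P]_w Z w = \int[P]_w W w.
    apply: EFin_inj; rewrite -!E_EFin//.
    transitivity (\int[P]_(w in B n) x w)%E.
      rewrite [RHS]integral_mkcond; apply: ae_eq_integral => //.
      - exact: measurable_int iZ.
      - by apply/(measurable_restrictT x mB).1; exact: measurable_funTS.
      - have := integrable_ae mB iposB; have := integrable_ae mB ineg.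
        apply: filterS2 => w fb fa _; rewrite /Z indicE patchE.
        have [/set_mem Bw|_] := boolP (w \in B n); last by rewrite mul0r.
        by rewrite mul1r /x payoffE EFinD EFinB !fineK ?fa ?fb.
    rewrite integralE -eVp// -eVn// -integralB//.
    rewrite integral_mkcond; apply: eq_integral => w _; rewrite patchE /W indicE.
    have [/set_mem Bw|_] := boolP (w \in B n); last by rewrite mul0r.
    by have [ep en] := ltVpVn _ _ Bw; rewrite ep en mul1r EFinB.
  apply: (ae_le_of_ind iW iV mB).
    by move=> w Bw; rewrite /W indicE mem_set// mul1r; case: Bw.
  rewrite (@eq_Rintegral _ _ _ P setT W) -?EZW// => w _.
  by rewrite /W mulrA -expr2 indicE; case: (_ \in _); rewrite ?expr1n ?expr0n.
(* With [Vp] finite, an outcome violating the claim has [Vn] finite as well, since otherwise [Vx] is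
   [-oo]; it therefore lies in some [B n]. *)
have VpT : {ae P, forall w, Vp w \is a fin_num}.
  have mVpT := sub_measurable_fun (sF t) (@Fm t) mVp.
  suff iVp : P.-integrable setT Vp.
    by apply: filterS (integrable_ae measurableT iVp) => w; exact.
  apply/integrableP; split => //.
  under eq_integral do rewrite gee0_abs//.
  rewrite eVp; last exact: sub_measurable_setT.
  apply: (@le_lt_trans _ _ (\int[P]_w (fpos_on t tau w + H w))%E); last first.
    by apply: integrable_lty => //; exact: integrableD.
  apply: ge0_le_integral => //.
  - exact: measurable_funepos.
  - by apply: measurable_int (integrableD _ ipos iH).
  move=> w _; rewrite funeposE payoffE ge_max adde_ge0// andbT.
  apply: leeD; first by rewrite -[leRHS]adde0 leeD2l// leeNl oppe0.
  by apply: le_trans (terminalH w); rewrite lee_fin ler_norm.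
have : {ae P, forall w, forall n, ~ B n w} by exact/ae_foralln.
move: VpT; apply: filterS2 => w Vpy nB; rewrite leNgt; apply/negP.
rewrite VxE; case Vnw : (Vn w) (Vn0 w) => [v| |]//; last first.
  by move=> _; rewrite addeNy.
move: Vpy; case Vpw : (Vp w) (Vp0 w) => [u| |]// u0 _ v0; rewrite -EFinB lte_fin => Vuv.
pose N := maxn (Num.truncn u).+1 (Num.truncn v).+1.
apply: (nB N); split; last by rewrite /= Vpw Vnw.
split; rewrite /= ?Vpw ?Vnw lee_fin.
  by rewrite (le_trans (ltW (truncnS_gt u)))// ler_nat leq_maxl.
by rewrite (le_trans (ltW (truncnS_gt v)))// ler_nat leq_maxr.
Qed.

End cond_payoff.

(** Truncated times suffice: the upper envelope [V] of their gains bounds all payoffs by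
    [cond_payoff_le], so [y t <= V] by minimality of the essential supremum. One time serves for
    every [A]: the deficit on the complement of [A] is nonnegative by [gain_le], so the deficit on
    [A] is at most the total one. *)
Lemma eps_optimal t e : 0 <= t -> 0 < e -> exists tau K,
  [/\ t <= K, stopping_time F tau, forall w, (t%:E <= tau w)%E &
   forall A, F t A ->
   \int[P]_w (\1_A w * y t w) <= \int[P]_w (\1_A w * gain t tau K w) + e].
Proof.
move=> t0 e0.
pose fam Z := exists tau K, [/\ t <= K, stopping_time F tau,
  forall w, (t%:E <= tau w)%E & Z = gain t tau K].
have fam_itg Z : fam Z -> itg Z.
  by move=> [tau [K [tK st _ ->]]]; apply: itg_gain => //; exact: le_trans tK.
have fam_paste A Z1 Z2 : F t A -> fam Z1 -> fam Z2 -> fam (paste A Z1 Z2).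
  move=> FA [tau1 [K1 [tK1 st1 tt1 ->]]] [tau2 [K2 [tK2 st2 tt2 ->]]].
  have [tau [K [tK st tt ->]]] := gain_paste t0 tK1 tK2 st1 st2 tt1 tt2 FA.
  by exists tau, K.
have EindT (Z : T -> R) : \int[P]_w (\1_setT w * Z w) = \int[P]_w Z w.
  by apply: eq_Rintegral => w _; rewrite indicT mul1r.
have fam_bound Z : fam Z -> \int[P]_w Z w <= \int[P]_w y t w.
  move=> [tau [K [tK st tt ->]]].
  have := gain_le t0 tK st tt (sub_measurable_setT (sF t)).
  by rewrite !EindT.
have fam0 : fam (gain t (fun=> t%:E) t).
  by exists (fun=> t%:E), t; split => //; exact: stopping_time_cst.
have [V [mV iV leV eV]] :=
  upper_family_sup (sF t) (@Fm t) fam_itg fam_paste fam_bound fam0.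
have iy := itg_y t.
have yV : {ae P, forall w, y t w <= V w}.
  have [_ _ /(_ (EFin \o V))] := y_sup t0.
  suff mVT : measurable_fun setT (EFin \o V).
    move=> /(_ mVT) h'; apply: filterS (h' _); first by move=> w; rewrite lee_fin.
    move=> Vx [tau [st tt xV]]; apply: (cond_payoff_le t0 st tt xV mV iV).
    move=> K A tK FA; apply: leV => //.
    by exists tau, K.
  exact/measurable_EFinP/(sub_measurable_fun (sF t) (@Fm t)).
have [_ [tau [K [tK st tt ->]]] le_e] := eV e e0.
exists tau, K; split => // A FA.
have K0 := le_trans t0 tK; have ig := itg_gain t st K0.
have mA := Fm FA.
have := gain_le t0 tK st tt (sub_measurable_setC (sF t) FA).
have Eset (Z : T -> R) : itg Z ->
    \int[P]_w Z w = \int[P]_w (\1_A w * Z w) + \int[P]_w (\1_(~` A) w * Z w).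
  move=> iZ; rewrite -E_D//; try (apply: itg_ind => //; exact: measurableC).
  apply: eq_Rintegral => w _; rewrite !indicE in_setC.
  by case: (w \in A); rewrite /= ?mul1r ?mul0r ?addr0 ?add0r.
have := E_le_ae iy iV yV; move: le_e; rewrite (Eset (y t))// (Eset (gain t tau K))//.
by move=> ? ? ?; lra.
Qed.

(** * The supermartingale above the obstacle *)

Definition snell t w := cum t w + y t w.

Lemma snell_continuous w : continuous (snell^~ w).
Proof. by move=> t; apply: cvgD; [exact: cum_continuous|exact: yc]. Qed.

Lemma snell_measurable t : measurable_fun setT (snell t).
Proof. by apply: measurable_funD => //; exact: cum_measurable. Qed.

Lemma snell_bound K t w : 0 <= t <= K -> (`|snell t w|%:E <= abs_int K w + H w)%E.
Proof.
move=> /andP[_ tK]; apply: (@le_trans _ _ (`|cum t w|%:E + `|y t w|%:E)%E).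
  by rewrite -EFinD lee_fin ler_normD.
by apply: leeD => //; exact: cum_bound.
Qed.

Lemma itg_bound K : P.-integrable setT (fun w => abs_int K w + H w)%E.
Proof. exact: integrableD. Qed.

Lemma itg_snell t : 0 <= t -> itg (snell t).
Proof. by move=> t0; apply: itg_D; [exact: itg_cum|exact: itg_y]. Qed.

Lemma itg_snell_cap tau K : stopping_time F tau -> 0 <= K ->
  itg (fun w => snell (cap tau K w) w).
Proof. by move=> st K0; apply: itg_D; [exact: itg_cum_cap|exact: itg_y_cap]. Qed.

(** A time that is [e]-optimal from [t] on also competes from [s] on, and its gain from [s] is its
    gain from [t] plus the profit collected in between. *)
Lemma supermartingale_det s t A : 0 <= s -> s <= t -> F s A ->
  \int[P]_w (\1_A w * (snell t w - snell s w)) <= 0.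
Proof.
move=> s0 st FA; have t0 := le_trans s0 st; have mA := Fm FA.
apply/ler_addgt0Pl => e e0; rewrite addr0.
have [tau [K [tK stau tt eopt]]] := eps_optimal t0 e0.
have FtA : F t A by exact: Fmono FA.
have ts w : (s%:E <= tau w)%E by apply: le_trans (tt w); rewrite lee_fin.
have K0 := le_trans t0 tK.
have le1 := gain_le s0 (le_trans st tK) stau ts FA.
have le2 := eopt _ FtA.
have iyt := itg_ind mA (itg_y t); have iys := itg_ind mA (itg_y s).
have igt := itg_ind mA (itg_gain t stau K0).
have igs := itg_ind mA (itg_gain s stau K0).
have -> : \int[P]_w (\1_A w * (snell t w - snell s w)) =
   \int[P]_w (\1_A w * gain s tau K w) - \int[P]_w (\1_A w * gain t tau K w) +
   \int[P]_w (\1_A w * y t w) - \int[P]_w (\1_A w * y s w).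
  rewrite -E_B// -E_D//; last exact: itg_B.
  rewrite -E_B//; last by apply: itg_D => //; exact: itg_B.
  apply: eq_Rintegral => w _; rewrite /snell /gain.
  by move: (\1_A w) (cum _ _) (cum _ _) (y _ _) (y _ _) (cum _ _) (h _ _) => *; ring.
exact: ler_combine le1 le2.
Qed.

Lemma supermartingale sigma tau K A : 0 <= K -> stopping_time F sigma ->
  stopping_time F tau -> (forall w, (sigma w <= tau w)%E) ->
  stopped_sigma F sigma A ->
  \int[P]_w (\1_A w * (snell (cap tau K w) w - snell (cap sigma K w) w)) <= 0.
Proof.
move=> K0 ss st sst sA.
apply: (optional_sampling sF Fm snell_continuous snell_measurable K0
  (itg_bound K) (@snell_bound K) ss st sst sA).
by move=> s t B s0 st' tK FB _ _; exact: supermartingale_det.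
Qed.

(** Stopping at once yields [h t], hence the inequality at each fixed time. The countably many
    fractions [k/(n+1)] share one negligible set, and continuity extends the inequality from them to
    all times. *)
Lemma obstacle_le : {ae P, forall w, forall t : R, 0 <= t -> h t w <= y t w}.
Proof.
have det (t : R) : 0 <= t -> {ae P, forall w, h t w <= y t w}.
  move=> t0; pose A := [set w | y t w < h t w].
  have FA : F t A.
    apply: (sub_measurableE (sF t) _).1.
    have -> : A = (fun w : g_sigma_algebraType (F t) => y t w < h t w) @^-1` [set true].
      by apply/seteqP; split.
    by rewrite -[X in measurable X]setTI; apply: measurable_fun_ltr => //;
      [exact: y_ad|exact: h_ad].
  have st : stopping_time F (fun=> t%:E) by exact: stopping_time_cst.
  have := gain_le t0 (lexx t) st (fun w => lexx _) FA.
  have gE w : gain t (fun=> t%:E) t w = h t w.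
    by rewrite /gain /cap minxx /= subrr add0r.
  under eq_Rintegral do rewrite gE.
  have ih : itg (h t) by apply: itg_dom iH _ => // w.
  move=> /(ae_le_of_ind ih (itg_y t) (Fm FA)) h'.
  by apply: filterS (h' _) => // w; rewrite /A/= => /negP; rewrite -leNgt.
have : {ae P, forall w, forall k n, h (k%:R / n.+1%:R) w <= y (k%:R / n.+1%:R) w}.
  by apply/ae_foralln => k; apply/ae_foralln => n; apply: det; rewrite divr_ge0.
apply: filterS => w hw t t0.
have cv (M : R -> T -> R) : continuous (M^~ w) ->
   M ((Num.floor (t * n.+1%:R))%:~R / n.+1%:R) w @[n --> \oo] --> M t w.
  move=> c; apply: (@cvg_comp _ _ _ _ (M^~ w) _ (nbhs (t : R))); last exact: c.
  exact: cvg_floor_grid.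
rewrite -(cvg_lim _ (cv h (@hc w)))// -(cvg_lim _ (cv y (@yc w)))//.
apply: ler_lim; first exact: cvgP (cv _ (@hc w)).
  exact: cvgP (cv _ (@yc w)).
apply: nearW => n.
have : 0 <= Num.floor (t * n.+1%:R) by rewrite floor_ge0 mulr_ge0.
by case: (Num.floor _) => // k _; exact: hw.
Qed.

(** * The martingale property until the obstacle is met *)

Section hitting_the_obstacle.

Variables (sigma D : T -> \bar R).
Hypotheses (ss : stopping_time F sigma) (sD : stopping_time F D)
  (hitD : forall w u, (sigma w <= u%:E)%E -> y u w = h u w -> (D w <= u%:E)%E).

(** By [hitD] the gap has no zero on the compact interval from [s] to [cap D t w - e], so it is
    bounded away from 0 there. Times along which the gap tends to 0 must eventually leave that
    interval, and they can only leave it to the right. *)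
Lemma hitting_cvg w (s t : R) (c : nat -> R) : 0 <= s -> s <= t ->
  (sigma w <= s%:E < D w)%E -> (forall k, s <= c k) ->
  y (c k) w - h (c k) w @[k --> \oo] --> 0 ->
  Num.min (c k) (cap D t w) @[k --> \oo] --> cap D t w.
Proof.
move=> s0 st /andP[sigs sD'] sc c0; have t0 := le_trans s0 st.
have D0 w' : (0 <= D w')%E by case: sD.
set th := cap D t w.
apply/cvgrPdist_lt => e e0.
suff : \forall k \near \oo, th - e < c k.
  apply: filterS => k kc; rewrite ger0_norm; last by rewrite subr_ge0 ge_min lexx orbT.
  by rewrite ltrBlDr -ltrBlDl lt_min kc gtrBl e0.
have [ths|ths] := ltP (th - e) s.
  by apply: nearW => k; exact: lt_le_trans (sc k).
pose q u := `|y u w - h u w|.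
have qc : continuous q.
  by move=> u; apply: cvg_norm; apply: cvgB; [exact: yc|exact: hc].
have [u uI umin] := EVT_min ths (continuous_subspaceT qc).
have qu : 0 < q u.
  rewrite normr_gt0 subr_eq0; apply/eqP => yh.
  move: uI; rewrite in_itv/= => /andP[su ut].
  have : (sigma w <= u%:E)%E by rewrite (le_trans sigs)// lee_fin.
  move=> /hitD /(_ yh) Du.
  have : th <= u by rewrite /th cap_le// Du.
  by move=> /le_trans /(_ ut); rewrite leNgt ltrBlDr ltrDl e0.
have : q (c k) @[k --> \oo] --> 0.
  by rewrite -(normr0 R); apply: cvg_norm.
move=> /cvgrPdist_lt /(_ _ qu); apply: filterS => k.
rewrite sub0r normrN ger0_norm ?normr_ge0// => qk.
rewrite ltNge; apply/negP => kc.
have : q u <= q (c k) by apply: umin; rewrite in_itv/= sc kc.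
by rewrite leNgt qk.
Qed.

(** The deficit of the [k]-th nearly optimal time splits into the mean gap when it stops and the
    mean loss of [snell] until then. Both are nonnegative, so each is at most [2^-(k+1)]. The first
    bound drives the gap to 0 almost surely; the second passes to the earlier time [rho k] by the
    supermartingale property, and [rho k] tends to [D] capped at [t]. *)
Lemma submartingale_det s t A : 0 <= s -> s <= t -> F s A ->
  (forall w, A w -> (sigma w <= s%:E < D w)%E) ->
  0 <= \int[P]_w (\1_A w * (snell (cap D t w) w - snell s w)).
Proof.
move=> s0 st FA AsD; have t0 := le_trans s0 st; have mA := Fm FA.
have D0 w' : (0 <= D w')%E by case: sD.
have approx (k : nat) : exists p : (T -> \bar R) * R,
   [/\ s <= p.2, stopping_time F p.1, forall w, (s%:E <= p.1 w)%E &
   \int[P]_w (\1_A w * y s w) <=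
     \int[P]_w (\1_A w * gain s p.1 p.2 w) + 2^-1 ^+ k.+1].
  have e0 : 0 < 2^-1 ^+ k.+1 :> R by rewrite exprn_gt0// invr_gt0.
  have [tau [K [sK stau ts /(_ _ FA) h']]] := eps_optimal s0 e0.
  by exists (tau, K).
have [tK htK] := choice approx.
pose c k w := cap (tK k).1 (tK k).2 w.
have c_ge k w : s <= c k w.
  have [sK [tau0 _] ts _] := htK k.
  by rewrite -lee_fin capE// le_min ts lee_fin.
have K0 k : 0 <= (tK k).2 by have [sK _ _ _] := htK k; exact: le_trans sK.
have stK k : stopping_time F (tK k).1 by case: (htK k).
have igain k : itg (gain s (tK k).1 (tK k).2) by exact: itg_gain.
have iyc k : itg (fun w => y (c k w) w) by exact: itg_y_cap.
have ihc k : itg (fun w => h (c k w) w) by exact: itg_h_cap.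
have itc k : itg (fun w => snell (c k w) w) by exact: itg_snell_cap.
have its : itg (snell s) by exact: itg_snell.
have iys : itg (y s) by exact: itg_y.
have split k : \int[P]_w (\1_A w * (y (c k w) w - h (c k w) w)) =
   \int[P]_w (\1_A w * (snell (c k w) w - snell s w)) -
   \int[P]_w (\1_A w * gain s (tK k).1 (tK k).2 w) + \int[P]_w (\1_A w * y s w).
  rewrite -E_B; [|by apply: itg_ind => //; exact: itg_B|exact: itg_ind].
  rewrite -E_D; [|by apply: itg_B; apply: itg_ind => //; exact: itg_B|exact: itg_ind].
  apply: eq_Rintegral => w _; rewrite /snell /gain -/(c k w).
  by move: (\1_A w) (cum _ _) (cum _ _) (y _ _) (y _ _) (h _ _) => *; ring.
have Z0 k : {ae P, forall w, 0 <= \1_A w * (y (c k w) w - h (c k w) w)}.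
  apply: filterS obstacle_le => w hw; rewrite mulr_ge0//.
  by rewrite subr_ge0 hw// (le_trans s0).
have iZ k : itg (fun w => \1_A w * (y (c k w) w - h (c k w) w)).
  by apply: itg_ind => //; exact: itg_B.
have snell_c k : \int[P]_w (\1_A w * (snell (c k w) w - snell s w)) <= 0.
  have [sK _ ts _] := htK k.
  have := supermartingale (K0 k) (stopping_time_cst sF s0) (stK k) ts
    (stopped_sigma_cst sF Fm Fmono s0 FA).
  rewrite (@eq_Rintegral _ _ _ P setT
    (fun w => \1_A w * (snell (c k w) w - snell s w)))// => w _.
  by rewrite (_ : cap (fun=> s%:E) _ w = s)// /cap min_l ?lee_fin.
have Z_le k : \int[P]_w (\1_A w * (y (c k w) w - h (c k w) w)) <= 2^-1 ^+ k.+1.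
  rewrite split; have [_ _ _ le2] := htK k.
  exact: ler_combine3 (snell_c k) le2.
have snell_ge k : - 2^-1 ^+ k.+1 <= \int[P]_w (\1_A w * (snell (c k w) w - snell s w)).
  have : 0 <= \int[P]_w (\1_A w * (y (c k w) w - h (c k w) w)).
    have -> : 0 = \int[P]_w (0 : R) by rewrite E_cst.
    by apply: E_le_ae => //; exact: itg_cst.
  rewrite split; have [_ _ _ le2] := htK k => ge0.
  exact: ler_combine4 ge0 le2.
(* Stopping also at [D] gives the desired limit, stopping at [t] gives a bound uniform in [k], and
   the maximum with [s] keeps [rho k] above [s] outside [A], so that [A] is known at [rho k]. *)
pose rho k w := mine (mine ((tK k).1 w) (tK k).2%:E) (mine (maxe (D w) s%:E) t%:E).
have s_rho k : stopping_time F (rho k).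
  apply: stopping_time_min => //; apply: stopping_time_min => //.
  - exact: stopping_time_cst.
  - by apply: stopping_time_max => //; exact: stopping_time_cst.
  - exact: stopping_time_cst.
have s_mK k : stopping_time F (fun w => mine ((tK k).1 w) (tK k).2%:E).
  by apply: stopping_time_min => //; exact: stopping_time_cst.
(* A horizon beyond both times, so that capping alters neither. *)
pose L k := Num.max (tK k).2 t.
have L0 k : 0 <= L k by rewrite le_max t0 orbT.
have cL k w : cap (fun w => mine ((tK k).1 w) (tK k).2%:E) (L k) w = c k w.
  by rewrite /cap /c /cap; congr fine; apply/min_idPl; rewrite ge_min lee_fin le_max lexx !orbT.
pose r k w := cap (rho k) (L k) w.
have r_le k w : r k w <= t.
  rewrite /r cap_le//; last by case: (s_rho k).
  by rewrite !ge_min lexx !orbT.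
have r_ge0 k w : 0 <= r k w by apply: cap_ge0 => //; case: (s_rho k).
have rE k w : A w -> r k w = Num.min (c k w) (cap D t w).
  move=> /AsD /andP[_ sDw]; apply: EFin_inj.
  rewrite capE//; last by case: (s_rho k).
  rewrite EFin_min /c !capE//; last by case: (stK k).
  rewrite /rho (max_l (ltW sDw)); apply/min_idPl.
  by rewrite ge_min; apply/orP; left; rewrite ge_min lee_fin le_max lexx orbT.
have ir k : itg (fun w => snell (r k w) w) by exact: itg_snell_cap.
have r_ge k : - 2^-1 ^+ k.+1 <= \int[P]_w (\1_A w * (snell (r k w) w - snell s w)).
  have srho w : (s%:E <= rho k w)%E.
    have [sK _ ts _] := htK k.
    by rewrite /rho !le_min ts !lee_fin sK st le_max lexx orbT.
  have le_rho w : (rho k w <= mine ((tK k).1 w) (tK k).2%:E)%E.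
    by rewrite /rho ge_min lexx.
  have := supermartingale (L0 k) (s_rho k) (s_mK k) le_rho
    (stopped_sigma_ge sF Fm Fmono (s_rho k) srho FA).
  under eq_Rintegral do rewrite cL -/(r k _).
  have -> : \int[P]_w (\1_A w * (snell (c k w) w - snell (r k w) w)) =
     \int[P]_w (\1_A w * (snell (c k w) w - snell s w)) -
     \int[P]_w (\1_A w * (snell (r k w) w - snell s w)).
    rewrite -E_B; try (by apply: itg_ind => //; exact: itg_B).
    apply: eq_Rintegral => w _.
    by move: (\1_A w) (snell _ _) (snell _ _) (snell _ _) => *; ring.
  by rewrite subr_le0; apply: le_trans.
have iD : itg (fun w => snell (cap D t w) w) by exact: itg_snell_cap.
have [_ cv] : itg (fun w => \1_A w * (snell (cap D t w) w - snell s w)) /\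
   \int[P]_w (\1_A w * (snell (r k w) w - snell s w)) @[k --> \oo] -->
   \int[P]_w (\1_A w * (snell (cap D t w) w - snell s w)).
  apply: (@E_dominated _ _ _ _ _ _
    (fun w => (abs_int t w + H w) + (abs_int t w + H w))%E).
  - move=> k; exact: itg_measurable (itg_ind mA (itg_B (ir k) its)).
  - exact: itg_measurable (itg_ind mA (itg_B iD its)).
  - by apply: integrableD => //; exact: itg_bound.
  - move=> k w; apply: (@le_trans _ _ (`|snell (r k w) w|%:E + `|snell s w|%:E)%E).
      rewrite -EFinD lee_fin normrM (le_trans _ (ler_normB _ _))//.
      by rewrite ler_piMl// indicE; case: (_ \in _); rewrite ?normr1 ?normr0.
    by apply: leeD; apply: snell_bound; rewrite ?r_ge0 ?r_le ?s0 ?st.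
  - apply: filterS (ae_cvg0_of_E iZ Z0 Z_le) => w cZ; rewrite indicE.
    have [/set_mem Aw|_] := boolP (w \in A); last first.
      by rewrite mul0r; under eq_cvg do rewrite mul0r; exact: cvg_cst.
    rewrite mul1r; under eq_cvg do rewrite mul1r rE//.
    apply: cvgB; last exact: cvg_cst.
    apply: (@cvg_comp _ _ _ _ (snell^~ w) _ (nbhs (cap D t w))); last first.
      exact: snell_continuous.
    apply: (hitting_cvg s0 st (AsD _ Aw)) => //.
    apply: cvg_trans cZ; apply: near_eq_cvg; apply: nearW => k.
    by rewrite indicE mem_set// mul1r.
have c0 : - 2^-1 ^+ k.+1 @[k --> \oo] --> (0 : R).
  rewrite -oppr0; apply: cvgN; rewrite (cvg_shiftS (fun k => 2^-1 ^+ k : R)).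
  apply: cvg_expr; rewrite ger0_norm ?invr_ge0//.
  by rewrite invf_lt1// ltr1n.
rewrite -(cvg_lim _ cv)// -(cvg_lim _ c0)//; apply: ler_lim.
- exact: cvgP c0.
- exact: cvgP cv.
- exact: nearW.
Qed.

(** Optional sampling is applied to the negative of [snell] stopped at [cap D K]; on events inside
    [sigma <= s < D], its increments are those controlled by [submartingale_det]. *)
Lemma submartingale_before_hit K A : 0 <= K ->
  (forall w, (sigma w <= D w)%E) -> stopped_sigma F sigma A ->
  0 <= \int[P]_w (\1_A w * (snell (cap D K w) w - snell (cap sigma K w) w)).
Proof.
move=> K0 le_sD sA.
have D0 w' : (0 <= D w')%E by case: sD.
have s0' w' : (0 <= sigma w')%E by case: ss.
pose M t w := - snell (Num.min t (cap D K w)) w.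
have Mc w : continuous (M^~ w).
  move=> t; apply: cvgN.
  apply: (@cvg_comp _ _ _ (fun t => Num.min t (cap D K w)) (snell^~ w) _
    (nbhs (Num.min t (cap D K w)))); last exact: snell_continuous.
  exact: continuous_minr_cst.
have Mm t : measurable_fun setT (M t).
  apply: measurableT_comp => //; apply: measurable_eval.
  - by move=> w; exact: snell_continuous.
  - by move=> u; exact: snell_measurable.
  - by apply: measurable_minr => //; exact: measurable_cap.
have Mb t w : 0 <= t <= K -> (`|M t w|%:E <= abs_int K w + H w)%E.
  move=> /andP[t0 tK]; rewrite /M normrN; apply: snell_bound.
  by rewrite le_min t0 cap_ge0//= ge_min tK.
have := optional_sampling sF Fm Mc Mm K0 (itg_bound K) Mb ss sD le_sD sA.
rewrite (@eq_Rintegral _ _ _ P setT (fun w => - (\1_A w *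
  (snell (cap D K w) w - snell (cap sigma K w) w)))); last first.
  move=> w _; rewrite /M minxx min_l; last exact: le_cap.
  by rewrite opprK -mulrN opprB addrC.
rewrite E_N; last first.
  apply: itg_ind; first by case: sA.
  by apply: itg_B; exact: itg_snell_cap.
rewrite oppr_le0; apply=> s t B s0 st tK FB _ BsD.
have t0 := le_trans s0 st.
rewrite (@eq_Rintegral _ _ _ P setT (fun w => - (\1_B w *
  (snell (cap D t w) w - snell s w)))); last first.
  move=> w _; rewrite indicE; have [/set_mem Bw|_] := boolP (w \in B); last first.
    by rewrite !mul0r oppr0.
  have /andP[_ sDw] := BsD _ Bw.
  rewrite !mul1r /M opprB opprK addrC; congr (snell _ _ - snell _ _).
    apply/min_idPl; have [<-|sK] := eqVneq s K.
      by rewrite cap_cst// ltW.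
    by rewrite ltW// cap_gt// sDw lt_neqAle sK (le_trans st).
  apply: EFin_inj; rewrite EFin_min !capE//; apply/eqP.
  by rewrite eq_le !le_min !ge_min !lexx !lee_fin tK ?orbT /= ?orbT ?andbT.
rewrite E_N; last first.
  apply: itg_ind; first exact: Fm FB.
  by apply: itg_B; [exact: itg_snell_cap|exact: itg_snell].
by rewrite oppr_le0; exact: submartingale_det.
Qed.

End hitting_the_obstacle.

End optimal_stopping.

(** * Paths on the half-line, finite maxima and path suprema *)

Section nonnegative_times.
Local Open Scope ring_scope.
Context {R : realType}.

Lemma continuous_maxr_cst (c : R) : continuous (fun t : R => Num.max t c).
Proof.
move=> t; under eq_fun do rewrite maxr_absE.
apply: cvgMl; apply: cvgD; first by apply: cvgD => //; exact: cvg_cst.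
by apply: cvg_norm; apply: cvgB => //; exact: cvg_cst.
Qed.

Lemma continuous_max_time (U : topologicalType) (p : R -> U) :
  {within `[0, +oo[, continuous p} -> continuous (fun t : R => p (Num.max t 0)).
Proof.
move=> /subspace_continuousP cp t.
have t0 : `[0, +oo[%classic (Num.max t 0) by rewrite /= in_itv/= andbT le_max lexx orbT.
apply: (@cvg_comp _ _ _ (fun s => Num.max s 0) p _ (within `[0, +oo[ (nbhs (Num.max t 0)))).
  move=> V VA; have : nbhs t ((fun s : R => Num.max s 0) @^-1` _) :=
    @continuous_maxr_cst 0 t _ VA.
  apply: filterS => s /=; apply.
  by rewrite in_itv/= andbT le_max lexx orbT.
exact: cp.
Qed.

Lemma measurable_cont_comp (U : ptopologicalType) d (T : measurableType d)
    (p : U -> R) (q : T -> g_sigma_algebraType (@open U)) :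
  continuous p -> measurable_fun setT q -> measurable_fun setT (p \o q).
Proof.
move=> cp mq; apply: (measurability _ (RGenOpens.measurableE R)) => //.
move=> _ [_ [a [b ->]] <-]; rewrite setTI comp_preimage.
rewrite -[X in measurable X]setTI; apply: mq => //.
apply: sub_sigma_algebra; apply: open_comp => //; exact: interval_open.
Qed.

End nonnegative_times.

Section bigmax_over_others.
Local Open Scope ring_scope.
Context {R : realType} (m : nat).
Hypothesis m_ge2 : (1 < m)%N.

Definition other (i : 'I_m) : 'I_m := odflt i [pick j | j != i].

Lemma otherP i : other i != i.
Proof.
rewrite /other; case: pickP => //= h.
have /card_gt0P[j] : (0 < #|predC1 i|)%N by rewrite cardC1 card_ord -subn1 subn_gt0.
by rewrite inE /= => ji; have := h j; rewrite ji.
Qed.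

Lemma bigmaxe_fin (i : 'I_m) (v : 'I_m -> R) :
  (\big[maxe/-oo]_(j < m | j != i) (v j)%:E =
  (\big[Num.max/v (other i)]_(j < m | j != i) v j)%:E)%E.
Proof.
apply/le_anti/andP; split.
  apply: bigmax_le => [|j ji]; first exact: leNye.
  by rewrite lee_fin; exact: (le_bigmax_cond (v (other i)) v ji).
rewrite (big_morph EFin (op1 := maxe) (id1 := (v (other i))%:E) (@EFin_max R))//.
apply: bigmax_le => [|j ji].
  exact: (le_bigmax_cond -oo%E (fun j => (v j)%:E) (otherP i)).
exact: (le_bigmax_cond -oo%E (fun j => (v j)%:E) ji).
Qed.

Lemma bigmaxe_attained (i : 'I_m) (v : 'I_m -> R) :
  exists2 j, j != i & (\big[maxe/-oo]_(j < m | j != i) (v j)%:E = (v j)%:E)%E.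
Proof.
rewrite (@bigmax_eq_arg _ _ _ -oo%E (other i) (fun j => j != i)
  (fun j => (v j)%:E) (otherP i)); last by move=> j _; exact: leNye.
by case: arg_maxP; [exact: otherP|move=> j ji _; exists j].
Qed.

Lemma continuous_bigmax (I : Type) (s : seq I) (p : pred I) (u : I -> R -> R) (u0 : R -> R) :
  continuous u0 -> (forall i, p i -> continuous (u i)) ->
  continuous (fun t => \big[Num.max/u0 t]_(i <- s | p i) u i t).
Proof.
move=> cu0 cu; elim: s => [|i s IH].
  by under eq_fun do rewrite big_nil.
case pi : (p i); last by under eq_fun do rewrite big_cons pi.
under eq_fun do rewrite big_cons pi maxr_absE.
move=> t; apply: cvgMl; apply: cvgD.
  by apply: cvgD; [exact: cu|exact: IH].
by apply: cvg_norm; apply: cvgB; [exact: cu|exact: IH].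
Qed.

Lemma measurable_bigmax d (T : measurableType d) (I : Type) (s : seq I) (p : pred I)
    (u : I -> T -> R) (u0 : T -> R) :
  measurable_fun setT u0 -> (forall i, p i -> measurable_fun setT (u i)) ->
  measurable_fun setT (fun t => \big[Num.max/u0 t]_(i <- s | p i) u i t).
Proof.
move=> cu0 cu; elim: s => [|i s IH].
  by under eq_fun do rewrite big_nil.
under eq_fun do rewrite big_cons; case: (boolP (p i)) => // pi.
by apply: measurable_maxr => //; exact: cu.
Qed.

End bigmax_over_others.

Section path_supremum.
Local Open Scope ring_scope.
Context d (T : measurableType d) (R : realType).

(** By continuity the supremum exceeds [x] exactly when the value at some fraction [k/(n+1)] does,
    so countably many times decide. *)
Lemma measurable_path_sup (Z : R -> T -> R) :
  (forall w, {within `[0, +oo[, continuous (Z^~ w)}) ->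
  (forall t, 0 <= t -> measurable_fun setT (Z t)) ->
  measurable_fun setT
    (fun w => ereal_sup [set (`|Z t w| ^+ 2)%:E | t in `[0, +oo[]).
Proof.
move=> cZ mZ.
apply: (measurability _ (ErealGenOInfty.measurableE R)) => //.
move=> _ [_ [x ->] <-]; rewrite setTI.
pose q (k n : nat) : R := k%:R / n.+1%:R.
have q0 k n : 0 <= q k n by rewrite divr_ge0.
rewrite (_ : _ @^-1` _ = \bigcup_k \bigcup_n [set w | x < `|Z (q k n) w| ^+ 2]).
  apply: bigcupT_measurable => k; apply: bigcupT_measurable => n.
  rewrite (_ : [set w | _] = (fun w => x < `|Z (q k n) w| ^+ 2) @^-1` [set true]).
    rewrite -[X in measurable X]setTI; apply: measurable_fun_ltr => //.
    by apply: measurable_funX; apply: measurableT_comp => //; exact: mZ.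
  by apply/seteqP; split.
apply/seteqP; split => w /=; rewrite in_itv/= andbT.
  move=> /ereal_sup_gt[_ [t t0 <-]]; rewrite lte_fin => xt.
  move: t0; rewrite /= in_itv/= andbT => t0.
  pose p s := `|Z (Num.max s 0) w| ^+ 2.
  have cp : continuous p.
    have cZ' := continuous_max_time (cZ w).
    by move=> s; rewrite /p /continuous_at; apply: cvgM; apply: cvg_norm; exact: cZ'.
  have : p ((Num.floor (t * n.+1%:R))%:~R / n.+1%:R) @[n --> \oo] --> p t.
    apply: (@cvg_comp _ _ _ _ p _ (nbhs (t : R))); last exact: cp.
    exact: cvg_floor_grid.
  have xpt : x < p t by rewrite /p max_l.
  move=> /cvgrPdist_lt /(_ (p t - x)); rewrite subr_gt0 => /(_ xpt) [n _ /(_ n (leqnn n))].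
  have : 0 <= Num.floor (t * n.+1%:R) by rewrite floor_ge0 mulr_ge0.
  case: (Num.floor _) => // k _; rewrite /= ltr_distlC subKr => /andP[h _].
  by exists k => //; exists n => //=; move: h; rewrite /p max_l// q0.
move=> [k _ [n _ /= xq]]; apply: (@lt_le_trans _ _ (`|Z (q k n) w| ^+ 2)%:E).
  by rewrite lte_fin.
by apply: ereal_sup_ubound; exists (q k n) => //=; rewrite in_itv/= andbT q0.
Qed.

End path_supremum.

(** * The completed Brownian filtration *)

Lemma progressive_adapted d (T : measurableType d) (R : realType)
    (F : R -> set_system T) d' (U : measurableType d') (Z : R -> T -> U) (t : R) :
  progressive F Z -> (0 <= t)%R ->
  measurable_fun (setT : set (g_sigma_algebraType (F t))) (Z t).
Proof.
move=> pZ t0; have mD : measurable (`[0%R, t]%classic `*`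
    [set: g_sigma_algebraType (F t)]) by exact: measurableX.
have mp : measurable_fun [set: g_sigma_algebraType (F t)] (fun w => (t, w)).
  exact: measurable_fun_pair.
apply: (measurable_comp mD _ (pZ t t0) mp) => _ [w _ <-] /=.
by rewrite in_itv/= t0 lexx.
Qed.

Section completed_filtration.
Context d (T : measurableType d) (R : realType) (P : probability T R).
Variables (n : nat) (B : R -> T -> 'rV[R]_n).
Hypothesis hB : brownian_motion P B.
Local Notation F := (completed_filtration P B).

Lemma filtration_sigma t : sigma_algebra setT (F t).
Proof. exact: smallest_sigma_algebra. Qed.

Lemma filtration_measurable t : F t `<=` measurable.
Proof.
apply: smallest_sub; first exact: sigma_algebra_measurable.
move=> E [[s [j [A [/andP[s0 _] mA ->]]]]|[]//].
have [mB _ _ _] := hB; rewrite -[X in measurable X]setTI.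
exact: (mB s j s0).
Qed.

Lemma filtration_mono s t : (s <= t)%R -> F s `<=` F t.
Proof.
move=> st; apply: sub_sigma_algebra2; apply: setSU.
move=> E [u [j [A [/andP[u0 us] mA ->]]]]; exists u, j, A; split => //.
by rewrite u0 (le_trans us).
Qed.

(** The events of probability 0 or 1 form a sigma-algebra. It contains the null sets, and also the
    events observed from [B 0], which is almost surely 0. *)
Lemma filtration0_trivial A : F 0%R A -> P A = 0 \/ P A = 1.
Proof.
pose G : set_system T := [set A | measurable A /\ (P A = 0 \/ P A = 1)].
suff : F 0%R `<=` G by move=> h /h [].
apply: smallest_sub.
  split.
  - by split => //; left; exact: measure0.
  - move=> C [mC PC]; split; first exact: measurableD.
    rewrite setTD probability_setC//.
    by case: PC => ->; [right; rewrite sube0|left; rewrite subee].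
  - move=> C GC; have mC i : measurable (C i) by case: (GC i).
    split; first exact: bigcupT_measurable.
    have [[i Pi]|none] := pselect (exists i, P (C i) = 1).
      right; apply/le_anti; rewrite probability_le1/=; last exact: bigcupT_measurable.
      rewrite -Pi le_measure ?inE//; first exact: bigcupT_measurable.
      exact: bigcup_sup.
    left; apply/negligibleP; first exact: bigcupT_measurable.
    apply: negligible_bigcup => i; apply/negligibleP => //.
    by have [_ [//|Ci]] := GC i; exfalso; apply: none; exists i.
move=> E [[s [j [A' [s0 mA ->]]]]|[mE PE]]; last by split => //; left.
have [mB B0 _ _] := hB.
have {s0} -> : s = 0%R by apply/le_anti; rewrite andbC.
have mE : measurable [set w | A' (B 0%R w ord0 j)].
  by rewrite -[X in measurable X]setTI; apply: mB.
split => //.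
have [A0|A0] := pselect (A' 0%R).
  right; have : P (~` [set w | A' (B 0%R w ord0 j)]) = 0.
    apply/negligibleP; first exact: measurableC.
    by apply: negligibleS B0 => w /= nA B0w; apply: nA; rewrite B0w mxE.
  move=> PC; rewrite -[X in P X]setCK probability_setC; last exact: measurableC.
  by rewrite PC sube0.
left; apply/negligibleP => //.
by apply: negligibleS B0 => w /= Aw B0w; apply: A0; move: Aw; rewrite B0w mxE.
Qed.

End completed_filtration.

(** * First zeros of adapted continuous processes *)

Section first_zero.
Local Open Scope ring_scope.
Context d (T : measurableType d) (R : realType).
Variable F : R -> set_system T.
Hypotheses (sF : forall t, sigma_algebra setT (F t))
  (Fm : forall t, F t `<=` measurable)
  (Fmono : forall s t, s <= t -> F s `<=` F t).

Lemma cap_adapted sigma t : stopping_time F sigma -> 0 <= t ->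
  measurable_fun (setT : set (g_sigma_algebraType (F t))) (cap sigma t).
Proof.
move=> ss t0; apply: (measurability _ (RGenOInfty.measurableE R)) => //.
move=> _ [_ [x ->] <-]; rewrite setTI; apply: (sub_measurableE (sF t) _).2.
rewrite (_ : _ @^-1` _ = [set w | (x%:E < sigma w)%E && (x < t)]); last first.
  by apply/seteqP; split => w /=; rewrite in_itv/= andbT cap_gt//; case: ss.
have [xt|tx] := ltP x t; last first.
  rewrite (_ : [set _ | _] = set0); first exact: sub_measurable_set0.
  by rewrite -subset0 => w /=; rewrite andbF.
rewrite (_ : [set _ | _] = [set w | (x%:E < sigma w)%E]).
  by apply: (Fmono (ltW xt)); exact: stopping_time_gt.
by apply/seteqP; split => w /=; rewrite andbT.
Qed.

(** [q] is known to be [F t]-measurable only at times in [[0, t]]; clamping the time to this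
    interval extends it to the whole line, where [measurable_eval] applies with [F t] as
    sigma-algebra. *)
Lemma eval_adapted (q : R -> T -> R) t (tau : T -> R) :
  (forall w, continuous (q^~ w)) ->
  (forall u, 0 <= u -> u <= t ->
     measurable_fun (setT : set (g_sigma_algebraType (F t))) (q u)) ->
  0 <= t ->
  measurable_fun (setT : set (g_sigma_algebraType (F t))) tau ->
  (forall w, 0 <= tau w <= t) ->
  measurable_fun (setT : set (g_sigma_algebraType (F t))) (fun w => q (tau w) w).
Proof.
move=> cq mq t0 mtau taut.
have -> : (fun w => q (tau w) w) = (fun w => q (Num.max (Num.min (tau w) t) 0) w).
  by apply/funext => w; have /andP[? ?] := taut w; rewrite min_l// max_l.
apply: (@measurable_eval R _ (g_sigma_algebraType (F t))
  (fun u w => q (Num.max (Num.min u t) 0) w)) => //.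
- move=> w u; apply: (@cvg_comp _ _ _ (fun u => Num.max (Num.min u t) 0) (q^~ w) _
    (nbhs (Num.max (Num.min u t) 0))); last exact: cq.
  apply: (@cvg_comp _ _ _ (fun u => Num.min u t) (fun u => Num.max u 0) _
    (nbhs (Num.min u t))); first exact: continuous_minr_cst.
  exact: continuous_maxr_cst.
- move=> u; apply: mq; first by rewrite le_max lexx orbT.
  by rewrite ge_max t0 andbT ge_min lexx orbT.
Qed.

(** A random subset of a finite set takes finitely many values, and each value is decided by
    finitely many events and complements. *)
Lemma finite_event (m : nat) t (p : 'I_m -> T -> bool) (Q : pred {set 'I_m}) :
  (forall j, F t [set w | p j w]) -> F t [set w | Q [set j | p j w]%SET].
Proof.
move=> Fp; rewrite (_ : [set w | _] = \bigcup_(A : {set 'I_m})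
  (if Q A then ~` \bigcup_(j : 'I_m) [set w | p j w != (j \in A)] else set0)).
  apply: (sub_measurableE (sF t) _).1.
  apply: (@countable_bigcupT_measurable _ (g_sigma_algebraType (F t))) => [|A].
    exact: countableP.
  case: (Q A) => //; apply: measurableC.
  apply: (@countable_bigcupT_measurable _ (g_sigma_algebraType (F t))) => [|j].
    exact: countableP.
  apply: (sub_measurableE (sF t) _).2; case: (j \in A).
    rewrite (_ : [set w | _] = ~` [set w | p j w]); first exact: sub_measurable_setC.
    by apply/seteqP; split => w /=; case: (p j w).
  rewrite (_ : [set w | _] = [set w | p j w])//.
  by apply/seteqP; split => w /=; case: (p j w).
apply/seteqP; split => w /=.
  move=> Qw; exists [set j | p j w]%SET => //; rewrite Qw => -[j _ /=].
  by rewrite inE eqxx.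
move=> [A _]; case QA : (Q A) => //= nj.
suff -> : [set j | p j w]%SET = A by [].
apply/setP => j; rewrite inE; apply/eqP; apply: contrapT => pj.
by apply: nj; exists j => //=; apply/negP.
Qed.

Definition first_zero (q : R -> T -> R) (sigma : T -> \bar R) w : \bar R :=
  ereal_inf [set t%:E | t in [set t : R | (sigma w <= t%:E)%E /\ q t w = 0]].

Variables (q : R -> T -> R) (sigma : T -> \bar R).
Hypotheses (cq : forall w, continuous (q^~ w)) (s0 : forall w, (0 <= sigma w)%E).

Lemma first_zero_ge w : (sigma w <= first_zero q sigma w)%E.
Proof. by apply: le_ereal_inf_tmp => _ [t [st _] <-]. Qed.

Lemma first_zero_le w u : (sigma w <= u%:E)%E -> q u w = 0 ->
  (first_zero q sigma w <= u%:E)%E.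
Proof. by move=> su qu; apply: ereal_inf_lbound; exists u. Qed.

Lemma first_zero_attained w x : first_zero q sigma w = x%:E -> q x w = 0.
Proof.
move=> zx; apply: contrapT => /eqP qx.
have [e /= e0 near_x] : nbhs x [set u | q u w != 0].
  have := cq (w := w) (x := x) => /cvgrPdist_lt /(_ `|q x w|).
  rewrite normr_gt0 => /(_ qx); apply: filterS => u /=.
  by apply: contraTneq => ->; rewrite subr0 ltxx.
have : (x%:E < (x + e)%:E)%E by rewrite lte_fin ltrDl.
rewrite -zx => /ereal_inf_lt[_ [u [su qu] <-]]; rewrite lte_fin => ux.
have xu : x <= u by rewrite -lee_fin -zx; exact: first_zero_le.
have : q u w != 0.
  by apply: near_x; rewrite /= ler0_norm ?subr_le0// opprB ltrBlDl.
by rewrite qu eqxx.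
Qed.

Lemma first_zero_leP w t : (first_zero q sigma w <= t%:E)%E <->
  exists2 u, (sigma w <= u%:E)%E /\ u <= t & q u w = 0.
Proof.
split => [zt|[u [su ut] qu]]; last first.
  by apply: le_trans (first_zero_le su qu) _; rewrite lee_fin.
have : first_zero q sigma w \is a fin_num.
  by rewrite ge0_fin_numE ?(le_lt_trans zt) ?ltry// (le_trans (s0 w))// first_zero_ge.
move=> /fineK/esym zx; exists (fine (first_zero q sigma w)).
  by split; [rewrite -zx first_zero_ge|rewrite -lee_fin -zx].
exact: first_zero_attained.
Qed.

Hypotheses (ss : stopping_time F sigma)
  (mq : forall u t, 0 <= u -> u <= t ->
     measurable_fun (setT : set (g_sigma_algebraType (F t))) (q u)).

(** On the compact interval from [cap sigma t w] to [t], a continuous path has a zero if and only if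
    its absolute value gets arbitrarily small, which countably many times detect. These times are
    the fractions [k/(l+1)], clamped to [[0, t]] by [v] and then pushed above [cap sigma t w]. *)
Lemma first_zero_stopping : stopping_time F (first_zero q sigma).
Proof.
split => [w|t t0]; first by rewrite (le_trans (s0 w))// first_zero_ge.
pose v k l : R := Num.max (Num.min (k%:R / l.+1%:R) t) 0.
have vt k l : 0 <= v k l <= t by rewrite /v le_max lexx orbT ge_max t0 andbT ge_min lexx orbT.
rewrite (_ : [set w | _] = [set w | (sigma w <= t%:E)%E] `&`
   \bigcap_n \bigcup_k \bigcup_l
     [set w | `|q (Num.max (v k l) (cap sigma t w)) w| <= n.+1%:R^-1]).
  apply: sub_measurable_setI => //; first exact: stopping_timeP.
  apply: (sub_measurableE (sF t) _).1.
  apply: (@bigcapT_measurable _ (g_sigma_algebraType (F t))) => n.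
  apply: (@bigcupT_measurable _ (g_sigma_algebraType (F t))) => k.
  apply: (@bigcupT_measurable _ (g_sigma_algebraType (F t))) => l.
  rewrite (_ : [set w | _] = (fun w : g_sigma_algebraType (F t) =>
    `|q (Num.max (v k l) (cap sigma t w)) w| <= n.+1%:R^-1) @^-1` [set true]); last first.
    by apply/seteqP; split.
  rewrite -[X in measurable X]setTI; apply: measurable_fun_ler => //.
  apply: measurableT_comp => //; apply: eval_adapted => //.
  - by move=> u u0 ut; exact: mq.
  - by apply: measurable_maxr => //; exact: cap_adapted.
  - move=> w; have /andP[v0 vt'] := vt k l; rewrite le_max v0/= ge_max vt'.
    by apply: cap_leK.
apply/seteqP; split => w /=.
  move=> /first_zero_leP[u [su ut] qu].
  have st := le_trans su (_ : (u%:E <= t%:E)%E).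
  split; first by apply: st; rewrite lee_fin.
  move=> n _.
  have u0 : 0 <= u by rewrite -lee_fin (le_trans (s0 w)).
  have sE : Num.max u (cap sigma t w) = u.
    apply/max_idPl; rewrite -lee_fin capE// ge_min su.
    by [].
  pose p x := `|q (Num.max x (cap sigma t w)) w|.
  have : p ((Num.floor (u * l.+1%:R))%:~R / l.+1%:R) @[l --> \oo] --> p u.
    apply: (@cvg_comp _ _ _ _ p _ (nbhs (u : R))); first exact: cvg_floor_grid.
    apply: cvg_norm; apply: (@cvg_comp _ _ _ (fun x => Num.max x (cap sigma t w)) (q^~ w) _
      (nbhs (Num.max u (cap sigma t w)))); last exact: cq.
    exact: continuous_maxr_cst.
  rewrite {2}/p sE qu normr0 => /cvgrPdist_lt /(_ n.+1%:R^-1).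
  rewrite invr_gt0 ltr0n => /(_ isT) [l _ /(_ l (leqnn l))].
  have /andP[fl _] := floor_itv (u * l.+1%:R).
  have : 0 <= Num.floor (u * l.+1%:R) by rewrite floor_ge0 mulr_ge0.
  move: fl; case: (Num.floor _) => // k kl _ /=.
  rewrite sub0r normrN ger0_norm ?normr_ge0// => pk.
  exists k => //; exists l => //=; apply: ltW.
  rewrite /v min_l; last by rewrite (le_trans _ ut)// ler_pdivrMr.
  by rewrite (max_l (divr_ge0 (ler0n _ _) (ler0n _ _))).

move=> [st Q]; apply/first_zero_leP.
have ct : cap sigma t w <= t by exact: cap_leK.
pose p x := `|q x w|.
have cp : continuous p by move=> x; apply: cvg_norm; exact: cq.
have [u uI umin] := EVT_min ct (continuous_subspaceT cp).
move: uI; rewrite in_itv/= => /andP[cu ut].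
exists u; first by split => //; move: cu; rewrite -lee_fin capE// min_l.
apply: contrapT => /eqP qu.
have pu : 0 < p u by rewrite normr_gt0.
pose n := Num.truncn (p u)^-1.
have np : n.+1%:R^-1 < p u by rewrite invf_plt ?posrE// truncnS_gt.
have [k _ [l _ /= qk]] := Q n I.
have : p u <= p (Num.max (v k l) (cap sigma t w)).
  apply: umin; rewrite in_itv/= le_max lexx orbT ge_max ct andbT.
  by have /andP[] := vt k l.
by move=> /le_trans /(_ qk); rewrite leNgt np.
Qed.

End first_zero.

(** Monotone convergence along the diagonal: the number of terms and the terms grow together. Fees
    counted up to the [n]-th switch and time [n] have this shape. *)
Lemma sum_nondecreasing_cvg (R : realType) (a : nat -> nat -> R) (b : nat -> R) :
  (forall n l, 0 <= a n l)%R -> (forall l, nondecreasing_seq (a ^~ l)) ->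
  (forall l, \forall n \near \oo, a n l = b l) ->
  nondecreasing_seq (fun n => \sum_(l < n) a n l)%R /\
  (\sum_(l < n) a n l)%:E @[n --> \oo] --> \sum_(0 <= l <oo) (b l)%:E.
Proof.
move=> a0 nda ab.
have b0 l : (0 <= b l)%R.
  have [N _ /(_ N (leqnn N))/= <-] := ab l; exact: a0.
have leab n l : (a n l <= b l)%R.
  have [N _ H] := ab l; rewrite -(H (maxn N n)) /= ?leq_maxl//.
  by apply: nda; exact: leq_maxr.
have nd : nondecreasing_seq (fun n => \sum_(l < n) a n l)%R.
  move=> i j ij; rewrite -(subnKC ij) big_split_ord/=.
  apply: le_trans (_ : \sum_(l < i) a (i + (j - i))%N l <= _)%R.
    apply: ler_sum => q _; apply: nda; exact: leq_addr.
  by rewrite lerDl sumr_ge0.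
split => //.
have ndE : nondecreasing_seq (fun n => (\sum_(l < n) a n l)%:E).
  by move=> i j ij; rewrite lee_fin; exact: nd.
have cvS := ereal_nondecreasing_cvgn ndE; set S := ereal_sup _ in cvS.
suff -> : \sum_(0 <= l <oo) (b l)%:E = S by [].
apply/eqP; rewrite eq_le; apply/andP; split.
  apply: lime_le; first by apply: is_cvg_nneseries => n _ _; rewrite lee_fin.
  apply: nearW => N; rewrite big_mkord.
  have [M _ HM] : \forall n \near \oo, forall l : 'I_N, a n l = b l.
    by apply: filter_forall => l; exact: ab.
  apply: le_trans (_ : (\sum_(l < maxn M N) a (maxn M N) l)%:E <= _); last first.
    by apply: ereal_sup_ubound; exists (maxn M N).
  rewrite sumEFin lee_fin -(subnKC (leq_maxr M N)) big_split_ord/=.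
  rewrite (eq_bigr (fun l : 'I_N => a (maxn M N) l)); last first.
    by move=> l _; rewrite (HM (maxn M N)) //= leq_maxl.
  by rewrite subnKC ?leq_maxr// lerDl sumr_ge0.
apply: ge_ereal_sup => _ [n _ <-].
apply: (@le_trans _ _ (\sum_(0 <= l < n) (b l)%:E)).
  by rewrite big_mkord sumEFin lee_fin; apply: ler_sum.
by apply: nneseries_lim_ge => k _ _; rewrite lee_fin.
Qed.

(* The expectation of a difference of nonnegative variables is [-oo] when only
   the second one has infinite expectation. *)
Lemma ge0_integralB d (T : measurableType d) (R : realType)
    (mu : {measure set T -> \bar R}) (p q : T -> \bar R) :
  measurable_fun setT p -> measurable_fun setT q -> (forall w, 0 <= p w) ->
  (forall w, 0 <= q w) -> \int[mu]_w p w < +oo ->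
  \int[mu]_w (p w - q w) = \int[mu]_w p w - \int[mu]_w q w.
Proof.
move=> mp mq p0 q0 ip.
have itg_of z : measurable_fun setT z -> (forall w, 0 <= z w) ->
    \int[mu]_w z w < +oo -> mu.-integrable setT z.
  move=> mz z0 iz; apply/integrableP; split => //.
  by under eq_integral do rewrite gee0_abs//.
have [iq|] := ltP (\int[mu]_w q w) +oo.
  by rewrite (integralB measurableT (itg_of p _ _ _) (itg_of q _ _ _)).
rewrite leye_eq => /eqP iq; rewrite iq addeNy integralE.
have mB : measurable_fun setT (fun w => p w - q w) by exact: emeasurable_funB.
set pq := fun w => p w - q w in mB *.
have iP : \int[mu]_w pq^\+ w < +oo.
  apply: le_lt_trans ip; apply: ge0_le_integral => //.
    exact: measurable_funepos.
  move=> w _; rewrite funeposE /pq ge_max p0 andbT.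
  by rewrite -[leRHS]adde0; apply: leeD => //; rewrite oppe_le0.
have iN : \int[mu]_w pq^\- w = +oo.
  apply/eqP; rewrite -leye_eq leNgt; apply/negP => iN.
  suff : \int[mu]_w q w < +oo by rewrite iq ltxx.
  apply: le_lt_trans (_ : \int[mu]_w (p w + pq^\- w) < _).
    apply: ge0_le_integral => //.
      by apply: emeasurable_funD => //; exact: measurable_funeneg.
    move=> w _; rewrite funenegE /pq; have := p0 w; have := q0 w.
    case: (p w) (q w) => [a| |] [b| |]// _ _.
    - rewrite -EFinB -EFinN -EFin_max -EFinD lee_fin opprB.
      have : (b - a <= Num.max (b - a) 0)%R by rewrite le_max lexx.
      by move: (Num.max _ _) => c; lra.
    - by rewrite /= addye ?leey// maxNye.
  by rewrite ge0_integralD//; [exact: lte_add_pinfty|exact: measurable_funeneg].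
by rewrite iN; move: iP; case: (integral _ _ _) => //.
Qed.

(** The event that [Z] exceeds its mean has probability 0 or 1; either way the deviation from the
    mean keeps one sign and has mean 0, hence vanishes. *)
Lemma trivial_constant d (T : measurableType d) (R : realType) (P : probability T R)
    (G : set_system T) (Z : T -> R) :
  sigma_algebra setT G -> G `<=` measurable -> (forall A, G A -> P A = 0 \/ P A = 1) ->
  measurable_fun (setT : set (g_sigma_algebraType G)) Z -> P.-integrable setT (EFin \o Z) ->
  {ae P, forall w, Z w = (\int[P]_w Z w)%R}.
Proof.
move=> sG Gm triv mZ iZ; set c := (\int[P]_w Z w)%R.
have ic := itg_cst P c.
have GA : G [set w | (c < Z w)%R].
  apply: (sub_measurableE sG _).1; rewrite (_ : [set w | _] = Z @^-1` `]c, +oo[%classic).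
    by rewrite -[X in measurable X]setTI; exact: mZ.
  by apply/seteqP; split => w /=; rewrite in_itv/= andbT.
have mA := Gm _ GA; have [A0|A1] := triv _ GA.
- have : {ae P, forall w, (0 <= c - Z w)%R}.
    exists [set w | (c < Z w)%R]; split => // w /= /negP; rewrite subr_ge0 -ltNge.
    exact.
  move=> /(ae0_of_E_le0 (itg_B ic iZ)); rewrite E_B// E_cst subrr => /(_ (lexx _)).
  by apply: filterS => w /eqP; rewrite subr_eq0 eq_sym => /eqP.
- have : {ae P, forall w, (0 <= Z w - c)%R}.
    exists (~` [set w | (c < Z w)%R]); split; first exact: measurableC.
      by rewrite probability_setC// A1 subee.
    by move=> w /= nle lt; apply: nle; rewrite subr_ge0 ltW.
  move=> /(ae0_of_E_le0 (itg_B iZ ic)); rewrite E_B// E_cst subrr => /(_ (lexx _)).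
  by apply: filterS => w /eqP; rewrite subr_eq0 => /eqP.
Qed.

Lemma expR_discount_cvg (R : realType) (r : R) : (0 < r)%R ->
  expR (- (r * t)) @[t --> +oo%R] --> (0 : R)%R.
Proof.
move=> r0; apply: (@cvg_comp _ _ _ (fun t => r * t)%R (fun x => expR (- x)) _ (pinfty_nbhs R)).
  apply/cvgryPge => A; apply: filterS (nbhs_pinfty_ge (num_real (A / r))) => t /=.
  by rewrite ler_pdivrMr// mulrC.
exact: cvgr_expR.
Qed.

(* Processes are only meaningful at times [t >= 0]; freezing them before 0 makes
   their paths continuous on the whole line. *)
Definition frozen (T : Type) (R : realType) (U : Type) (Z : R -> T -> U) (t : R) (w : T) : U :=
  Z (Num.max t 0)%R w.

(** * The switching problem *)

Section switching_data.
Local Open Scope ring_scope.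
Context d (T : measurableType d) (R : realType) (P : probability T R).
Local Notation itg Z := (P.-integrable setT (EFin \o Z)).
Local Notation leb := (@lebesgue_measure R).
Variable F : R -> set_system T.
Hypotheses (sF : forall t, sigma_algebra setT (F t))
  (Fm : forall t, F t `<=` measurable)
  (Fmono : forall s t, s <= t -> F s `<=` F t).
Variables (m : nat) (m_ge2 : (1 < m)%N) (k : nat) (r : R) (r_gt0 : 0 < r).
Variables (X : R -> T -> 'rV[R]_k)
  (X_prog : progressive F (X : R -> T -> g_sigma_algebraType (@open 'rV[R]_k)))
  (X_cont : continuous_process X).
Variables (g : 'I_m -> 'I_m -> 'rV[R]_k -> R)
  (g_cont : forall i j, i != j -> continuous (g i j))
  (alpha : R) (alpha_gt0 : 0 < alpha)
  (g_bounds : forall i j x, i != j -> alpha^-1 <= g i j x <= alpha).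
Variables (psi : 'I_m -> 'rV[R]_k -> R)
  (psi_cont : forall i, continuous (psi i))
  (psi_M2 : forall i, spaceM2 P F (discounted_profit r X psi i))
  (psi_wd : forall i, well_defined_profit P r X psi i).
Variables (Y : 'I_m -> R -> T -> R)
  (hY : solves_switching_system P F r X psi g Y).

Definition switch_fin i t w : R :=
  \big[Num.max/- g i (other i) (X t w) + Y (other i) t w]_(j < m | j != i)
    (- g i j (X t w) + Y j t w).

Lemma switch_valueE i t w : switch_value X g Y i t w = (switch_fin i t w)%:E.
Proof. exact: (bigmaxe_fin m_ge2 i (fun j => - g i j (X t w) + Y j t w)). Qed.

Lemma switch_fin_ge i j t w : j != i -> - g i j (X t w) + Y j t w <= switch_fin i t w.
Proof.
move=> ji; exact: (le_bigmax_cond _ (fun j => - g i j (X t w) + Y j t w) ji).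
Qed.

Lemma switch_fin_attained i t w :
  exists2 j, j != i & switch_fin i t w = - g i j (X t w) + Y j t w.
Proof.
have [j ji e] := bigmaxe_attained m_ge2 i (fun j => - g i j (X t w) + Y j t w).
by exists j => //; apply: EFin_inj; rewrite -e -switch_valueE.
Qed.

Definition profit i := frozen (discounted_profit r X psi i).
Definition dvalue i := frozen (fun t w => expR (- (r * t)) * Y i t w).
Definition obstacle i := frozen (fun t w => expR (- (r * t)) * switch_fin i t w).

(** A single integrable bound for the discounted values and obstacles of all modes at all times,
    from [|a| <= 1 + a^2] and the bound [alpha] on the costs. *)
Definition majorant w : \bar R := (alpha%:E + \sum_(i < m)
  (1 + ereal_sup [set (`|Y i t w| ^+ 2)%:E | t in `[0%R, +oo[]))%E.

Lemma X_frozen_continuous w : continuous (fun t : R => X (Num.max t 0) w).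
Proof. exact: (@continuous_max_time _ _ (X^~ w) (@X_cont w)). Qed.

Lemma Y_frozen_continuous i w : continuous (fun t : R => Y i (Num.max t 0) w).
Proof. by have [[_ Yc _] _ _] := hY i; exact: (@continuous_max_time _ _ ((Y i)^~ w) (Yc w)). Qed.

Lemma discount_frozen_continuous : continuous (fun t : R => expR (- (r * Num.max t 0))).
Proof.
move=> t; apply: (@cvg_comp _ _ _ (fun t : R => - (r * Num.max t 0)) expR _
  (nbhs (- (r * Num.max t 0)))); last exact: continuous_expR.
by apply: cvgN; apply: cvgMr; exact: continuous_maxr_cst.
Qed.

Lemma profit_continuous i w : continuous (profit i ^~ w).
Proof.
move=> t; apply: cvgM; first exact: discount_frozen_continuous.
apply: (@cvg_comp _ _ _ (fun t : R => X (Num.max t 0) w) (psi i) _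
  (nbhs (X (Num.max t 0) w))); last exact: psi_cont.
exact: X_frozen_continuous.
Qed.

Lemma dvalue_continuous i w : continuous (dvalue i ^~ w).
Proof.
by move=> t; apply: cvgM; [exact: discount_frozen_continuous|exact: Y_frozen_continuous].
Qed.

Lemma option_continuous i j w : j != i ->
  continuous (fun t : R => - g i j (X (Num.max t 0) w) + Y j (Num.max t 0) w).
Proof.
move=> ji t; apply: cvgD; last exact: Y_frozen_continuous.
apply: cvgN; apply: (@cvg_comp _ _ _ (fun t : R => X (Num.max t 0) w) (g i j) _
  (nbhs (X (Num.max t 0) w))); last by apply: g_cont; rewrite eq_sym.
exact: X_frozen_continuous.
Qed.

Lemma switch_continuous i w : continuous (fun t : R => switch_fin i (Num.max t 0) w).
Proof.
apply: continuous_bigmax; first exact: option_continuous (otherP m_ge2 i).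
by move=> j; exact: option_continuous.
Qed.

Lemma obstacle_continuous i w : continuous (obstacle i ^~ w).
Proof.
by move=> t; apply: cvgM; [exact: discount_frozen_continuous|exact: switch_continuous].
Qed.

Section adapted.
Variables (s t : R).
Hypotheses (s0 : 0 <= s) (st : s <= t).
Local Notation Ft := (g_sigma_algebraType (F t)).

Let coarser d' (U : measurableType d') (Z : T -> U) :
  measurable_fun (setT : set (g_sigma_algebraType (F s))) Z ->
  measurable_fun (setT : set Ft) Z.
Proof.
move=> mZ _ A mA; apply: (sub_measurableE (sF t) _).2; apply: (Fmono st).
by apply: (sub_measurableE (sF s) _).1; exact: mZ.
Qed.

Lemma profit_adapted i : measurable_fun (setT : set Ft) (profit i s).
Proof.
have [pp _] := psi_M2 i; have := coarser (progressive_adapted pp s0).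
by rewrite /profit /frozen max_l.
Qed.

Lemma Y_adapted i : measurable_fun (setT : set Ft) (Y i s).
Proof. by have [[pY _ _] _ _] := hY i; exact: coarser (progressive_adapted pY s0). Qed.

Lemma option_adapted i j : j != i ->
  measurable_fun (setT : set Ft) (fun w => - g i j (X s w) + Y j s w).
Proof.
move=> ji; apply: measurable_funD; last exact: Y_adapted.
apply: measurableT_comp => //; apply: (measurable_cont_comp (p := g i j)).
  by apply: g_cont; rewrite eq_sym.
exact: coarser (progressive_adapted X_prog s0).
Qed.

Lemma switch_adapted i : measurable_fun (setT : set Ft) (switch_fin i s).
Proof.
apply: measurable_bigmax; first exact: option_adapted (otherP m_ge2 i).
by move=> j; exact: option_adapted.
Qed.

Lemma dvalue_adapted i : measurable_fun (setT : set Ft) (dvalue i s).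
Proof. by rewrite /dvalue /frozen max_l//; apply: measurable_funM => //; exact: Y_adapted. Qed.

Lemma obstacle_adapted i : measurable_fun (setT : set Ft) (obstacle i s).
Proof.
by rewrite /obstacle /frozen max_l//; apply: measurable_funM => //; exact: switch_adapted.
Qed.

End adapted.

Let frozen_measurable (Z : R -> T -> R) : (forall t, 0 <= t ->
    measurable_fun (setT : set (g_sigma_algebraType (F t))) (frozen Z t)) ->
  forall t, measurable_fun setT (frozen Z t).
Proof.
move=> mZ t; have t0 : 0 <= Num.max t 0 by rewrite le_max lexx orbT.
have := sub_measurable_fun (sF _) (@Fm _) (mZ _ t0).
by rewrite /frozen (max_l t0).
Qed.

Lemma profit_measurable i t : measurable_fun setT (profit i t).
Proof. by apply: frozen_measurable => s s0; exact: profit_adapted. Qed.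

Lemma dvalue_measurable i t : measurable_fun setT (dvalue i t).
Proof. by apply: frozen_measurable => s s0; exact: dvalue_adapted. Qed.

Lemma obstacle_measurable i t : measurable_fun setT (obstacle i t).
Proof. by apply: frozen_measurable => s s0; exact: obstacle_adapted. Qed.

Let Ysup i w := ereal_sup [set (`|Y i t w| ^+ 2)%:E | t in `[0, +oo[].

Let Ysup_ge0 i w : (0 <= Ysup i w)%E.
Proof.
apply: (@le_trans _ _ (`|Y i 0 w| ^+ 2)%:E); first by rewrite lee_fin exprn_ge0.
by apply: ereal_sup_ubound; exists 0 => //=; rewrite in_itv/= lexx.
Qed.

Lemma majorant_integrable : P.-integrable setT majorant.
Proof.
have iY i : P.-integrable setT (Ysup i).
  have [[pY Yc Yi] _ _] := hY i.
  apply/integrableP; split.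
    apply: measurable_path_sup => // t t0.
    have := sub_measurable_fun (sF t) (@Fm t) (Y_adapted t0 (lexx t) i). exact.
  by under eq_integral do rewrite gee0_abs//.
have i1 c : P.-integrable setT (cst c%:E) by exact: finite_measure_integrable_cst.
have i1Y i := integrableD measurableT (i1 1) (iY i).
have isum : P.-integrable setT (fun w => \sum_(i < m) (1 + Ysup i w))%E.
  by apply: (@integrable_sum _ _ _ P setT measurableT _ _ _
    (fun i w => 1 + Ysup i w)%E) => i _; exact: i1Y.
by have := integrableD measurableT (i1 alpha) isum.
Qed.

Lemma Y_majorant i t w : 0 <= t -> (`|Y i t w|%:E <= majorant w - alpha%:E)%E.
Proof.
move=> t0; rewrite /majorant addeAC subee// add0e.
apply: (@le_trans _ _ (1 + Ysup i w)%E).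
  apply: (@le_trans _ _ (1 + (`|Y i t w| ^+ 2)%:E)%E).
    rewrite -EFinD lee_fin; move: (`|Y i t w|) => a; nra.
  by apply: leeD2l; apply: ereal_sup_ubound; exists t => //=; rewrite in_itv/= andbT.
rewrite (bigD1 i)//= leeDl//; apply: sume_ge0 => j _.
by rewrite adde_ge0// Ysup_ge0.
Qed.

Lemma discount_le1 t : 0 <= t -> expR (- (r * t)) <= 1.
Proof. by move=> t0; rewrite -expR0 ler_expR oppr_le0 mulr_ge0// ltW. Qed.

Lemma dvalue_majorant i t w : (`|dvalue i t w|%:E <= majorant w)%E.
Proof.
rewrite /dvalue /frozen; set u := Num.max t 0.
have u0 : 0 <= u by rewrite le_max lexx orbT.
apply: (@le_trans _ _ `|Y i u w|%:E).
  by rewrite lee_fin normrM ger0_norm ?expR_ge0// ler_piMl// discount_le1.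
apply: le_trans (Y_majorant i w u0) _.
by rewrite -[leRHS]adde0; apply: leeD => //; rewrite -EFinN lee_fin oppr_le0 ltW.
Qed.

Lemma obstacle_majorant i t w : (`|obstacle i t w|%:E <= majorant w)%E.
Proof.
rewrite /obstacle /frozen; set u := Num.max t 0.
have u0 : 0 <= u by rewrite le_max lexx orbT.
have [j ji ->] := switch_fin_attained i u w.
apply: (@le_trans _ _ (alpha%:E + `|Y j u w|%:E)%E).
  rewrite -EFinD lee_fin normrM ger0_norm ?expR_ge0//.
  apply: le_trans (_ : `|- g i j (X u w) + Y j u w| <= _).
    by rewrite ler_piMl// discount_le1.
  rewrite (le_trans (ler_normD _ _))// lerD2r normrN.
  have ij : i != j by rewrite eq_sym.
  have /andP[gl gu] := g_bounds (X u w) ij.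
  by rewrite ger0_norm// (le_trans _ gl)// invr_ge0 ltW.
have := Y_majorant j w u0; rewrite -leeBrDl//.
Qed.

Lemma dvalue_vanish : {ae P, forall w, forall i, dvalue i t w @[t --> +oo] --> 0}.
Proof.
apply: filter_forall => i; have [_ _] := hY i; apply: filterS => w.
apply: cvg_trans; apply: near_eq_cvg; near=> t.
by rewrite /dvalue /frozen max_l.
Unshelve. all: end_near. Qed.

(** The obstacle is a discounted value of another mode minus a discounted cost. The best mode
    changes with time, so its value is bounded by the sum over all modes. *)
Lemma obstacle_vanish i : {ae P, forall w, obstacle i t w @[t --> +oo] --> 0}.
Proof.
apply: filterS dvalue_vanish => w yw.
apply/norm_cvg0P.
apply: (@squeeze_cvgr _ _ _ _ (fun=> 0)
  (fun t => expR (- (r * t)) * alpha + \sum_(j < m) `|dvalue j t w|)).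
- near=> t; rewrite normr_ge0/= /obstacle /frozen.
  have t0 : 0 <= t by near: t; exact: nbhs_pinfty_ge.
  rewrite max_l//; have [j ji ->] := switch_fin_attained i t w.
  rewrite mulrDr (le_trans (ler_normD _ _))//; apply: lerD.
    rewrite normrM ger0_norm ?expR_ge0// ler_wpM2l ?expR_ge0// normrN.
    have ij : i != j by rewrite eq_sym.
    have /andP[gl gu] := g_bounds (X t w) ij.
    by rewrite ger0_norm// (le_trans _ gl)// invr_ge0 ltW.
  by rewrite (bigD1 j)//= /dvalue /frozen max_l// lerDl sumr_ge0.
- exact: cvg_cst.
- rewrite -[X in _ --> X](addr0 0); apply: cvgD.
    by rewrite -[X in _ --> X](mul0r alpha); apply: cvgMl; exact: expR_discount_cvg.
  have : \sum_(j < m) `|dvalue j t w| @[t --> +oo] --> \sum_(j < m) (0 : R).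
    by apply: cvg_big => [|j _]; [exact: add_continuous|exact/norm_cvg0P].
  by rewrite big1_eq.
Unshelve. all: end_near. Qed.

(** On a bounded interval, [|a| <= 1 + a^2] turns square integrability into integrability at the
    price of the length of the interval. *)
Lemma profit_loc i K : P.-integrable setT (abs_int (profit i) K).
Proof.
have mp2 := measurable_caratheodory (@profit_continuous i) (profit_measurable i).
have mabs : measurable_fun setT (abs_int (profit i) K).
  apply: (measurable_int_section (g := fun z => `|profit i z.1 z.2|%:E)) => //.
  by apply/measurable_EFinP; exact: measurableT_comp.
have [_ M2] := psi_M2 i.
pose S w := (\int[leb]_(s in `[0%R, +oo[) (`|discounted_profit r X psi i s w| ^+ 2)%:E)%E.
have SE w : S w = (\int[leb]_(s in `[0%R, +oo[) (`|profit i s w| ^+ 2)%:E)%E.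
  apply: eq_integral => s; rewrite inE/= in_itv/= andbT => s0.
  by rewrite /profit /frozen max_l.
have mS : measurable_fun setT S.
  rewrite (funext SE).
  apply: (measurable_int_section (g := fun z => (`|profit i z.1 z.2| ^+ 2)%:E)) => //.
  by apply/measurable_EFinP; apply: measurable_funX; exact: measurableT_comp.
have S0 w : (0 <= S w)%E by apply: integral_ge0 => s _; rewrite lee_fin exprn_ge0.
have iS : P.-integrable setT S.
  by apply/integrableP; split => //; under eq_integral do rewrite gee0_abs//.
have lS w : (0 <= leb `[0%R, K] + S w)%E.
  by apply: adde_ge0 => //; exact: measure_ge0.
apply: (@le_integrable _ _ _ _ _ measurableT _ (fun w => leb `[0%R, K] + S w)%E) => //.
  move=> w _; rewrite [X in (X <= _)%E]gee0_abs; last first.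
    by apply: integral_ge0 => s _; rewrite lee_fin.
  rewrite (gee0_abs (lS w)).
  have mphi : measurable_fun setT (profit i ^~ w).
    exact: continuous_measurable_fun (@profit_continuous i w).
  apply: (@le_trans _ _ (\int[leb]_(s in `[0%R, K]) (1 + (`|profit i s w| ^+ 2)%:E))%E).
    apply: ge0_le_integral => //.
    - by apply: measurable_funTS; apply/measurable_EFinP; exact: measurableT_comp.
    - apply: measurable_funTS; apply: emeasurable_funD => //; apply/measurable_EFinP.
      by apply: measurable_funX; exact: measurableT_comp.
    - move=> s _; rewrite -EFinD lee_fin; move: (`|profit i s w|) => a; nra.
  rewrite ge0_integralD//=; last first.
    apply: measurable_funTS; apply/measurable_EFinP.
    by apply: measurable_funX; exact: measurableT_comp.
  rewrite integral_cst//= mul1e; apply: leeD2l; rewrite SE.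
  apply: ge0_subset_integral => //.
  - apply: measurable_funTS; apply/measurable_EFinP.
    by apply: measurable_funX; exact: measurableT_comp.
  - by apply: subset_itvl; rewrite bnd_simp.
have ic : P.-integrable setT (cst (leb `[0%R, K])).
  have fin_c : leb `[0%R, K] \is a fin_num.
    rewrite lebesgue_measure_itv/=; case: ifP => _ //.
  by rewrite -(fineK fin_c); exact: finite_measure_integrable_cst.
by have := integrableD measurableT ic iS.
Qed.

Lemma profit_well_defined i :
  (\int[P]_w \int[leb]_(s in `[0%R, +oo[) (fpos (profit i) s w)%:E < +oo)%E \/
  (\int[P]_w \int[leb]_(s in `[0%R, +oo[) (fneg (profit i) s w)%:E < +oo)%E.
Proof.
case: (psi_wd i) => h; [left|right]; apply: le_lt_trans h; rewrite le_eqVlt;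
  apply/orP; left; apply/eqP; apply: eq_integral => w _; apply: eq_integral => s;
  rewrite inE/= in_itv/= andbT => s0; by rewrite /fpos /fneg /profit /frozen (max_l s0).
Qed.

Lemma stopping_payoffE i t tau : 0 <= t -> (forall w, (t%:E <= tau w)%E) ->
  stopping_payoff r X psi g Y i t tau = payoff (profit i) (obstacle i) t tau.
Proof.
move=> t0 tt; apply/funext => w; rewrite /stopping_payoff /payoff; congr (_ + _)%E.
  apply: eq_integral => s; rewrite inE => -[ts _].
  by rewrite /profit /frozen max_l// (le_trans t0).
have := tt w; case tw: (tau w) => [x| |]//=.
  rewrite lee_fin => tx; rewrite switch_valueE /obstacle /frozen max_l ?(le_trans t0)//.
by move=> _; rewrite /discount gt0_muley ?lte_fin//= mul0e.
Qed.

(** Each mode has its own stopping problem; the other modes enter only through the obstacle. *)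
Lemma switching_osp i :
  optimal_stopping_problem P F (profit i) (dvalue i) (obstacle i) majorant.
Proof.
split=> //.
- exact: profit_continuous.
- exact: dvalue_continuous.
- exact: obstacle_continuous.
- exact: profit_measurable.
- exact: dvalue_measurable.
- exact: obstacle_measurable.
- by move=> t t0; exact: dvalue_adapted.
- by move=> t t0; exact: obstacle_adapted.
- exact: majorant_integrable.
- exact: dvalue_majorant.
- exact: obstacle_majorant.
- exact: obstacle_vanish.
- exact: profit_loc.
- exact: profit_well_defined.
- move=> t t0; have [_ /(_ t t0) + _] := hY i.
  rewrite {1}/dvalue /frozen max_l//.
  set V1 := [set _ | _]; set V2 := [set _ | _]; suff -> : V1 = V2 by [].
  by apply/seteqP; split => V [tau [st tt xV]]; exists tau; split => //;
    move: xV; rewrite stopping_payoffE.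
Qed.

(** * Existence and admissibility of hitting strategies *)

Section hitting_strategies.
Variable i1 : 'I_m.

Definition gap i u w := dvalue i u w - obstacle i u w.

Lemma gap_continuous i w : continuous (gap i ^~ w).
Proof.
move=> t; apply: cvgB; first exact: dvalue_continuous.
exact: obstacle_continuous.
Qed.

Lemma gap_adapted i u t : 0 <= u -> u <= t ->
  measurable_fun (setT : set (g_sigma_algebraType (F t))) (gap i u).
Proof.
move=> u0 ut; apply: measurable_funB.
  exact: (dvalue_adapted u0 ut).
exact: (obstacle_adapted u0 ut).
Qed.

Lemma gap_eq0 i t w : 0 <= t ->
  gap i t w = 0 <-> (Y i t w)%:E = switch_value X g Y i t w.
Proof.
move=> t0; rewrite /gap /dvalue /obstacle /frozen max_l// switch_valueE.
split => [/eqP|[->]]; last by rewrite subrr.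
rewrite subr_eq0 => /eqP; rewrite /=.
by move=> /(mulfI (lt0r_neq0 (expR_gt0 _))) ->.
Qed.

Lemma hitting_timeE i (sigma : T -> \bar R) w : (0 <= sigma w)%E ->
  ereal_inf [set t%:E | t in [set t : R | (sigma w <= t%:E)%E /\
     (Y i t w)%:E = switch_value X g Y i t w]] = first_zero (gap i) sigma w.
Proof.
move=> s0; congr ereal_inf; apply/seteqP.
by split => _ [t [st qt] <-]; exists t => //; split => //; apply/gap_eq0 => //;
  rewrite -lee_fin (le_trans s0).
Qed.

Lemma fz_stopping i sigma : stopping_time F sigma ->
  stopping_time F (first_zero (gap i) sigma).
Proof.
move=> ss; apply: first_zero_stopping => //.
- exact: gap_continuous.
- by case: ss.
- by move=> u t; exact: gap_adapted.
Qed.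

(** Splitting by the value of [xi] reduces to a fixed mode: that value is known at [tau], and the
    hitting time is not earlier. *)
Lemma hit_mode_stopping (tau : T -> \bar R) (xi : T -> 'I_m) : stopping_time F tau ->
  (forall j, stopped_sigma F tau [set w | xi w = j]) ->
  stopping_time F (fun w => first_zero (gap (xi w)) tau w).
Proof.
move=> st sxi; split => [w|t t0].
  by apply: le_trans (first_zero_ge _ _ _); case: st.
rewrite (_ : [set w | _] = \bigcup_(i : 'I_m)
   (([set w | xi w = i] `&` [set w | (tau w <= t%:E)%E]) `&`
   [set w | (first_zero (gap i) tau w <= t%:E)%E])).
  apply: (sub_measurableE (sF t) _).1.
  apply: (@countable_bigcupT_measurable _ (g_sigma_algebraType (F t))) => [|i].
    exact: countableP.
  apply: (sub_measurableE (sF t) _).2; apply: sub_measurable_setI => //.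
    by have [_ /(_ t t0)] := sxi i.
  by apply: stopping_timeP => //; exact: fz_stopping.
apply/seteqP; split => w /=.
  move=> zt; exists (xi w) => //; split => //; split => //=.
  exact: le_trans (first_zero_ge _ _ _) zt.
by move=> [i _ [[/= <- _]]].
Qed.

(** The times are stopping times by induction, each being a hitting time for the mode held before
    it; for the modes chosen at the switches, measurability is part of [hitting_strategy]. *)
Lemma hitting_admissible s : hitting_strategy F X g i1 Y s -> admissible F i1 s.
Proof.
move=> [[s0 m0] st sm sF'].
have both n : stopping_time F (stime s n) /\
    forall j, stopped_sigma F (stime s n) [set w | smode s n w = j].
  elim: n => [|n [IHt IHm]].
    have e0 : stime s 0 = (fun=> 0%:E) by apply/funext => w; rewrite s0.
    split; first by rewrite e0; exact: stopping_time_cst.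
    move=> j; rewrite e0; apply: stopped_sigma_cst => //.
    have [<-|ij] := eqVneq i1 j.
      rewrite (_ : [set _ | _] = setT); first exact: sub_measurable_setT.
      by apply/seteqP; split => // w _ /=; rewrite m0.
    rewrite (_ : [set _ | _] = set0); first exact: sub_measurable_set0.
    by rewrite -subset0 => w /=; rewrite m0 => /eqP; rewrite (negbTE ij).
  split; last exact: sF'.
  have -> : stime s n.+1 = (fun w => first_zero (gap (smode s n w)) (stime s n) w).
    by apply/funext => w; rewrite st hitting_timeE//; case: IHt.
  exact: hit_mode_stopping.
split => //.
- by move=> n; case: (both n).
- move=> n w; rewrite st hitting_timeE; first exact: first_zero_ge.
  by have [[]] := both n.
- by move=> n; case: (both n).
- by move=> n w lty; have [] := sm n w lty.
Qed.

Definition best_modes i u w : {set 'I_m} :=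
  [set j | (j != i) && (switch_fin i u w == - g i j (X u w) + Y j u w)]%SET.

(** The tie is broken by a function of the set of maximizers alone; this set takes finitely many
    values, which makes the choice measurable. *)
Definition pick_mode (i : 'I_m) (A : {set 'I_m}) : 'I_m := odflt i [pick j in A].

Definition next_time (tau : T -> \bar R) (xi : T -> 'I_m) w :=
  first_zero (gap (xi w)) tau w.

Definition next_mode (tau : T -> \bar R) (xi : T -> 'I_m) w :=
  if (next_time tau xi w < +oo)%E
  then pick_mode (xi w) (best_modes (xi w) (fine (next_time tau xi w)) w)
  else xi w.

Lemma pick_modeP i u w : let j := pick_mode i (best_modes i u w) in
  j != i /\ switch_value X g Y i u w = (- g i j (X u w) + Y j u w)%:E.
Proof.
rewrite /pick_mode; case: pickP => [j|none] /=.
  by rewrite inE switch_valueE => /andP[-> /eqP ->].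
have [j ji e] := switch_fin_attained i u w.
by have := none j; rewrite inE ji e eqxx.
Qed.

(** At the capped time, membership in the set of best modes is a comparison of two [F t]-measurable
    variables, so [finite_event] applies. *)
Lemma best_event i j t (tau : T -> \bar R) : stopping_time F tau -> 0 <= t ->
  F t [set w | pick_mode i (best_modes i (cap tau t w) w) = j].
Proof.
move=> st t0.
have capt w : 0 <= cap tau t w <= t by rewrite cap_ge0 ?cap_leK//; case: st.
rewrite (_ : [set w | _] = [set w | (fun A => pick_mode i A == j)
    [set j | (j != i) && (switch_fin i (cap tau t w) w ==
      - g i j (X (cap tau t w) w) + Y j (cap tau t w) w)]%SET]); last first.
  by apply/seteqP; split => w /=; rewrite -/(best_modes _ _ _) => /eqP.
apply: (@finite_event _ _ _ _ sF m t (fun j w => (j != i) && (switch_fin i (cap tau t w) w ==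
      - g i j (X (cap tau t w) w) + Y j (cap tau t w) w))
   (fun A => pick_mode i A == j)) => // l.
have [->|li] := eqVneq l i.
  rewrite (_ : [set w | _] = set0); first exact: sub_measurable_set0.
  by rewrite -subset0 => w.
pose q1 u w := switch_fin i (Num.max u 0) w.
pose q2 u w := - g i l (X (Num.max u 0) w) + Y l (Num.max u 0) w.
have mcap := cap_adapted sF Fmono st t0.
have m1 : measurable_fun (setT : set (g_sigma_algebraType (F t)))
    (fun w => q1 (cap tau t w) w).
  apply: eval_adapted => //.
    by move=> w; exact: switch_continuous.
  by move=> u u0 ut; rewrite /q1 max_l//;
    exact: (switch_adapted u0 ut).
have m2 : measurable_fun (setT : set (g_sigma_algebraType (F t)))
    (fun w => q2 (cap tau t w) w).
  apply: eval_adapted => //.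
    by move=> w; exact: option_continuous.
  by move=> u u0 ut; rewrite /q2 max_l//;
    exact: (option_adapted u0 ut).
rewrite (_ : [set w | _] = (fun w : g_sigma_algebraType (F t) =>
   q1 (cap tau t w) w == q2 (cap tau t w) w) @^-1` [set true]); last first.
  apply/seteqP; split => w /=; rewrite /q1 /q2; have /andP[c0 _] := capt w;
    by rewrite (max_l c0).
apply: (sub_measurableE (sF t) _).1; rewrite -[X in measurable X]setTI.
exact: measurable_fun_eqr.
Qed.

Lemma next_mode_stopped (tau : T -> \bar R) (xi : T -> 'I_m) : stopping_time F tau ->
  (forall j, stopped_sigma F tau [set w | xi w = j]) ->
  forall j, stopped_sigma F (next_time tau xi) [set w | next_mode tau xi w = j].
Proof.
move=> st sxi j.
have s' : stopping_time F (next_time tau xi) by exact: hit_mode_stopping.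
have Ft t : 0 <= t ->
    F t ([set w | next_mode tau xi w = j] `&` [set w | (next_time tau xi w <= t%:E)%E]).
  move=> t0.
  rewrite (_ : _ `&` _ = \bigcup_(i : 'I_m)
     ((([set w | xi w = i] `&` [set w | (tau w <= t%:E)%E]) `&`
     [set w | (next_time tau xi w <= t%:E)%E]) `&`
     [set w | pick_mode i (best_modes i (cap (next_time tau xi) t w) w) = j])).
    apply: (sub_measurableE (sF t) _).1.
    apply: (@countable_bigcupT_measurable _ (g_sigma_algebraType (F t))) => [|i].
      exact: countableP.
    apply: (sub_measurableE (sF t) _).2; apply: sub_measurable_setI => //; last first.
      exact: best_event.
    apply: sub_measurable_setI => //; last exact: stopping_timeP.
    by have [_ /(_ t t0)] := sxi i.
  have capE' w : (next_time tau xi w <= t%:E)%E ->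
      cap (next_time tau xi) t w = fine (next_time tau xi w).
    by move=> le; rewrite /cap min_l.
  apply/seteqP; split => w /=.
    move=> [nj nt]; exists (xi w) => //=; split.
      split => //; split => //; exact: le_trans (first_zero_ge _ _ _) nt.
    by rewrite capE'//; move: nj; rewrite /next_mode (le_lt_trans nt (ltry _)).
  move=> [i _ [[[/= <- _] nt]]]; rewrite capE'// => pj; split => //.
  by rewrite /next_mode (le_lt_trans nt (ltry _)).
split => //.
rewrite (_ : [set w | _] = \bigcup_n ([set w | next_mode tau xi w = j] `&`
   [set w | (next_time tau xi w <= n%:R%:E)%E]) `|`
   ([set w | xi w = j] `&` [set w | next_time tau xi w = +oo%E])).
  apply: measurableU; first by apply: bigcupT_measurable => n; exact: Fm (Ft _ (ler0n _ _)).
  apply: measurableI; first by case: (sxi j).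
  rewrite (_ : [set w | _] = next_time tau xi @^-1` [set +oo%E])//.
  by rewrite -[X in measurable X]setTI; apply: (stopping_time_measurable sF Fm s').
apply/seteqP; split => w /=.
  move=> nj; case ty : (next_time tau xi w) => [x| |].
  - left; exists (Num.truncn x).+1 => //; split => //=.
    by rewrite ty lee_fin ltW// truncnS_gt.
  - by right; split => //; move: nj; rewrite /next_mode ty ltxx.
  - by have := s'.1 w; rewrite ty.
move=> [[n _ []]//|[xj ty]]; by rewrite /next_mode ty ltxx.
Qed.

Lemma hitting_strategy_ex : exists s, hitting_strategy F X g i1 Y s.
Proof.
pose st := fix st n : (T -> \bar R) * (T -> 'I_m) := if n is n'.+1
  then (next_time (st n').1 (st n').2, next_mode (st n').1 (st n').2)
  else ((fun=> 0%E), (fun=> i1)).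
have ok n : stopping_time F (st n).1 /\
   forall j, stopped_sigma F (st n).1 [set w | (st n).2 w = j].
  elim: n => [|n [IHt IHm]] /=.
    split; first exact: (stopping_time_cst sF (lexx 0)).
    move=> j; apply: (stopped_sigma_cst sF Fm Fmono (lexx 0)).
    have [<-|ij] := eqVneq i1 j.
      rewrite (_ : [set _ | _] = setT); first exact: sub_measurable_setT.
      by apply/seteqP; split.
    rewrite (_ : [set _ | _] = set0); first exact: sub_measurable_set0.
    by rewrite -subset0 => w /= /eqP; rewrite (negbTE ij).
  by split; [exact: hit_mode_stopping|exact: next_mode_stopped].
exists (Strategy (fun n => (st n).1) (fun n => (st n).2)); split => //=.
- by move=> n w; rewrite hitting_timeE//; have [[]] := ok n.
- move=> n w lty; rewrite /next_mode lty; exact: pick_modeP.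
- by move=> n; have [_] := ok n.+1.
Qed.

End hitting_strategies.

(** * Balance of a strategy up to a horizon *)

Section verification.
Variables (i1 : 'I_m) (s : strategy T R m).
Hypothesis adm : admissible F i1 s.
Local Notation tau := (stime s).
Local Notation xi := (smode s).

Let pb i : optimal_stopping_problem P F (profit i) (dvalue i) (obstacle i) majorant :=
  switching_osp i.

Let tau_st n : stopping_time F (tau n). Proof. by have [_ + _ _ _] := adm; apply. Qed.

Let tau_ge0 n w : (0 <= tau n w)%E. Proof. by case: (tau_st n). Qed.

Let tau_le n w : (tau n w <= tau n.+1 w)%E. Proof. by have [_ _ + _ _] := adm; apply. Qed.

Let tau_mono w : {homo tau^~ w : i j / (i <= j)%N >-> (i <= j)%E}.
Proof.
move=> i j /subnK <-; elim: (j - i)%N => [|k' IH]; first by rewrite add0n.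
by rewrite addSn; exact: le_trans IH (tau_le _ _).
Qed.

Let xi_stopped n j : stopped_sigma F (tau n) [set w | xi n w = j].
Proof. by have [_ _ _ + _] := adm; apply. Qed.

Let xi_neq n w : (tau n.+1 w < +oo)%E -> xi n.+1 w != xi n w.
Proof. by have [_ _ _ _ +] := adm; apply. Qed.

Let tau0 w : tau 0 w = 0%E. Proof. by have [[]] := adm. Qed.

Let xi0 w : xi 0 w = i1. Proof. by have [[]] := adm. Qed.

(* Switches after the horizon [K] are ignored. *)
Fixpoint mode_before (K : R) n w : 'I_m :=
  if n is n'.+1 then if (tau n w <= K%:E)%E then xi n w else mode_before K n' w
  else xi 0 w.

Local Notation stage K n := (cap (tau n) K).

Lemma mode_before_id K n w : (tau n w <= K%:E)%E -> mode_before K n w = xi n w.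
Proof. by case: n => [//|n] /= ->. Qed.

(** The discounted cost of switch [n+1], and 0 if this switch never occurs; the shifted index lets
    sums start at 0. *)
Definition switch_cost n w : R := if (tau n.+1 w < +oo)%E then
  expR (- (r * fine (tau n.+1 w))) * g (xi n w) (xi n.+1 w) (X (fine (tau n.+1 w)) w)
  else 0.

Definition paid K n w : R := if (tau n.+1 w <= K%:E)%E then switch_cost n w else 0.

Definition wealth K n w : R := dvalue (mode_before K n w) (stage K n w) w.

Lemma measurable_mode_fun (e : T -> 'I_m) (Z : 'I_m -> T -> R) :
  (forall i, measurable [set w | e w = i]) -> (forall i, measurable_fun setT (Z i)) ->
  measurable_fun setT (fun w => Z (e w) w).
Proof.
move=> me mZ; have -> : (fun w => Z (e w) w) = (fun w => \sum_(i < m) \1_[set w | e w = i] w * Z i w).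
  apply/funext => w; rewrite (bigD1 (e w))//= indicE mem_set// mul1r big1 ?addr0// => i ie.
  by rewrite indicE memNset ?mul0r//= => ei; rewrite ei eqxx in ie.
apply: measurable_sum => i; apply: measurable_funM => //; exact: measurable_indic.
Qed.

Lemma measurable_xi n i : measurable [set w | xi n w = i].
Proof. by case: (xi_stopped n i). Qed.

Lemma measurable_tau_le n (K : R) : measurable [set w | (tau n w <= K%:E)%E].
Proof. by apply: (@Fm K); exact: stopping_timeP. Qed.

Lemma measurable_mode_before K n i : measurable [set w | mode_before K n w = i].
Proof.
elim: n => [|n IH]; first exact: measurable_xi.
have mK := measurable_tau_le n.+1 K.
rewrite (_ : [set w | _] = ([set w | (tau n.+1 w <= K%:E)%E] `&` [set w | xi n.+1 w = i]) `|`
   (~` [set w | (tau n.+1 w <= K%:E)%E] `&` [set w | mode_before K n w = i])).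
  apply: measurableU; apply: measurableI => //; last exact: measurableC.
  exact: measurable_xi.
apply/seteqP; split => w /=; case: ifPn => h.
- by move=> ?; left.
- by move=> ?; right; split => //; apply/negP.
- by case=> [[]|[]].
- by case=> [[]|[]]//; rewrite (negbTE h).
Qed.

Lemma switch_cost_ge0 n w : 0 <= switch_cost n w.
Proof.
rewrite /switch_cost; case: ifPn => // ty; rewrite mulr_ge0 ?expR_ge0//.
have ne : xi n w != xi n.+1 w by rewrite eq_sym; exact: xi_neq.
have /andP[gl _] := g_bounds (X (fine (tau n.+1 w)) w) ne.
by rewrite (le_trans _ gl)// invr_ge0 ltW.
Qed.

Lemma switch_cost_le n w : switch_cost n w <= alpha.
Proof.
rewrite /switch_cost; case: ifPn => [ty|_]; last exact: ltW.
have ne : xi n w != xi n.+1 w by rewrite eq_sym; exact: xi_neq.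
have /andP[gl gu] := g_bounds (X (fine (tau n.+1 w)) w) ne.
rewrite -[leRHS]mul1r ler_pM ?expR_ge0//.
  by rewrite (le_trans _ gl)// invr_ge0 ltW.
by apply: discount_le1 => //; rewrite fine_ge0.
Qed.

Lemma measurable_switch_cost n : measurable_fun setT (switch_cost n).
Proof.
pose q i j u w := expR (- (r * Num.max u 0)) *
  (if i == j then 0 else g i j (X (Num.max u 0) w)).
have cq i j w : continuous (q i j ^~ w).
  move=> t; apply: cvgM; first exact: discount_frozen_continuous.
  rewrite /=; case: eqVneq => [_|ij]; first exact: cvg_cst.
  apply: (@cvg_comp _ _ _ (fun t : R => X (Num.max t 0) w) (g i j) _
    (nbhs (X (Num.max t 0) w))); last exact: g_cont.
  exact: X_frozen_continuous.
have mq i j u : measurable_fun setT (q i j u).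
  apply: measurable_funM => //; case: eqVneq => // ij.
  have u0 : 0 <= Num.max u 0 by rewrite le_max lexx orbT.
  apply: (measurable_cont_comp (p := g i j)); first exact: g_cont.
  exact: (sub_measurable_fun (sF _) (@Fm _) (progressive_adapted X_prog u0)).
have mtau := stopping_time_measurable sF Fm (tau_st n.+1).
have mq' i j : measurable_fun setT (fun w => q i j (fine (tau n.+1 w)) w).
  by apply: measurable_eval => //; apply: measurableT_comp => //; exact: fine_measurable.
have -> : switch_cost n = fun w => if (tau n.+1 w < +oo)%E then
    q (xi n w) (xi n.+1 w) (fine (tau n.+1 w)) w else 0.
  apply/funext => w; rewrite /switch_cost; case: ifPn => // ty.
  by rewrite /q max_l ?fine_ge0// eq_sym (negbTE (xi_neq ty)).
apply: measurable_fun_ifT => //.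
  apply: (measurable_fun_bool true); exact: measurable_lte.
apply: (measurable_mode_fun (Z := fun i w => q i (xi n.+1 w) (fine (tau n.+1 w)) w)) => i.
  exact: measurable_xi.
apply: (measurable_mode_fun (Z := fun j w => q i j (fine (tau n.+1 w)) w)) => // j.
exact: measurable_xi.
Qed.

Section horizon.
Variable K : R.
Hypothesis K0 : 0 <= K.

Lemma itg_wealth n : itg (wealth K n).
Proof.
apply: (itg_dom _ majorant_integrable).
  apply: (measurable_mode_fun (Z := fun i w => dvalue i (stage K n w) w)) => i.
    exact: measurable_mode_before.
  apply: measurable_eval; last exact: measurable_cap.
    by move=> w; exact: dvalue_continuous.
  by move=> t; exact: dvalue_measurable.
by move=> w; exact: dvalue_majorant.
Qed.

Lemma itg_paid n : itg (paid K n).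
Proof.
apply: itg_domR (itg_cst P alpha) _.
  apply: measurable_fun_ifT => //; last exact: measurable_switch_cost.
  apply: (measurable_fun_bool true); rewrite setTI.
  exact: (measurable_tau_le n.+1 K).
move=> w; rewrite /paid; case: ifP => _; last by rewrite normr0 ltW.
by rewrite ger0_norm ?switch_cost_ge0// switch_cost_le.
Qed.

(** Increment, over the phase between switches [n] and [n+1], of the Snell process of the mode held
    during that phase. *)
Definition jump n w := snell (profit (mode_before K n w)) (dvalue (mode_before K n w)) (stage K n.+1 w) w -
  snell (profit (mode_before K n w)) (dvalue (mode_before K n w)) (stage K n w) w.

Definition started n i := [set w | xi n w = i] `&` [set w | (tau n w <= K%:E)%E].

(** For [t < K] the bound by [K] follows from the bound by [t]; for [t >= K] it is an event of
    [F K], contained in [F t]. *)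
Lemma started_stopped n i : stopped_sigma F (tau n) (started n i).
Proof.
have [mx sx] := xi_stopped n i; split.
  by apply: measurableI => //; exact: measurable_tau_le.
move=> t t0; have [Kt|tK] := leP K t.
  rewrite /started -setIA [X in _ `&` X]setIC setIA.
  apply: sub_measurable_setI => //; first exact: sx.
  by apply: (Fmono Kt); exact: stopping_timeP.
rewrite (_ : started n i `&` _ = [set w | xi n w = i] `&` [set w | (tau n w <= t%:E)%E]).
  exact: sx.
apply/seteqP; split => w /=; first by move=> [[? _] ?].
by move=> [? tt]; split => //; split => //=; rewrite (le_trans tt)// lee_fin ltW.
Qed.

(** Each term has a deterministic mode, as the results on a single stopping problem require. If
    switch [n] comes after [K], both ends of the phase are [K] and the jump is 0. *)
Lemma jumpE n w : jump n w = \sum_(i < m) \1_(started n i) w *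
  (snell (profit i) (dvalue i) (stage K n.+1 w) w - snell (profit i) (dvalue i) (stage K n w) w).
Proof.
have [tK|Kt] := leP (tau n w) K%:E; last first.
  rewrite big1 => [|i _].
    rewrite /jump !cap_cst ?subrr//; first exact: ltW.
    by rewrite (le_trans (ltW Kt)).
  by rewrite indicE memNset ?mul0r// => -[_ /=]; rewrite leNgt Kt.
rewrite (bigD1 (xi n w))//= indicE mem_set// mul1r big1 ?addr0.
  by rewrite /jump mode_before_id.
move=> i ne; rewrite indicE memNset ?mul0r// => -[/= e _].
by rewrite e eqxx in ne.
Qed.

Lemma itg_stage n i : itg (fun w => snell (profit i) (dvalue i) (stage K n w) w).
Proof. exact: (itg_snell_cap (pb i)). Qed.

Lemma itg_jump n : itg (jump n).
Proof.
rewrite (funext (jumpE n)).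
apply: itg_sum => i; apply: itg_ind; first by case: (started_stopped n i).
by apply: itg_B; exact: itg_stage.
Qed.

Lemma E_jump_le0 n : \int[P]_w jump n w <= 0.
Proof.
under eq_Rintegral do rewrite jumpE.
rewrite E_sum; last first.
  move=> i; by apply: itg_ind; [case: (started_stopped n i)|apply: itg_B; exact: itg_stage].
apply: sumr_le0 => i _; apply: (supermartingale (pb i)) => //; exact: started_stopped.
Qed.

End horizon.

Section horizon_balance.
Variable K : R.
Hypothesis K0 : 0 <= K.
Local Notation stage n := (cap (tau n) K).

Let stage_leK n w : stage n w <= K. Proof. exact: cap_leK. Qed.

Definition increment (phi : 'I_m -> R -> R) n w :=
  prim (phi (mode_before K n w)) (stage n.+1 w) - prim (phi (mode_before K n w)) (stage n w).

Definition income n w := \sum_(l < n) increment (fun i u => fpos (profit i) u w) l w.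
Definition outlay n w := \sum_(l < n) increment (fun i u => fneg (profit i) u w) l w.
Definition fees n w := \sum_(l < n) paid K l w.

Lemma itg_increment (f : 'I_m -> R -> T -> R) n :
  (forall i w, continuous (f i ^~ w)) -> (forall i t, measurable_fun setT (f i t)) ->
  (forall i t w, 0 <= f i t w) -> (forall i, itg (fun w => prim (f i ^~ w) K)) ->
  itg (fun w => increment (fun i u => f i u w) n w).
Proof.
move=> fc fm f0 fK.
have iS j i : itg (fun w => prim (f i ^~ w) (stage j w)).
  apply: itg_domR (fK i) _ => [|w].
    apply: (measurable_eval (M := fun t w => prim (f i ^~ w) t)).
    - by move=> w; apply: prim_continuous; exact: fc.
    - by move=> t; apply: measurable_prim => // w; exact: fc.
    - exact: measurable_cap.
  rewrite ger0_norm; last by apply: Rintegral_ge0 => u _; exact: f0.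
  by apply: nd_prim => //; exact: fc.
rewrite (_ : (fun w => _) = fun w => \sum_(i < m) \1_[set w | mode_before K n w = i] w *
  (prim (f i ^~ w) (stage n.+1 w) - prim (f i ^~ w) (stage n w))).
  apply: itg_sum => i; apply: itg_ind; last exact: itg_B.
  exact: (measurable_mode_before).
apply/funext => w; rewrite (bigD1 (mode_before K n w))//= indicE mem_set// mul1r big1 ?addr0// => i ie.
by rewrite indicE memNset ?mul0r//= => ei; rewrite ei eqxx in ie.
Qed.

Lemma itg_income n : itg (income n).
Proof.
apply: itg_sum => l; apply: (itg_increment (f := fun i => fpos (profit i))).
- by move=> i w; exact: (fpos_continuous (pb i)).
- by move=> i t; exact: (fpos_measurable (pb i)).
- by move=> i t w; exact: fpos_ge0.
- by move=> i; exact: (itg_prim_fpos (pb i)).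
Qed.

Lemma itg_outlay n : itg (outlay n).
Proof.
apply: itg_sum => l; apply: (itg_increment (f := fun i => fneg (profit i))).
- by move=> i w; exact: (fneg_continuous (pb i)).
- by move=> i t; exact: (fneg_measurable (pb i)).
- by move=> i t w; exact: fneg_ge0.
- by move=> i; exact: (itg_prim_fneg (pb i)).
Qed.

Lemma itg_fees n : itg (fees n).
Proof. by apply: itg_sum => l; exact: itg_paid. Qed.

Let iW n : itg (wealth K n).
Proof. exact: (itg_wealth K0). Qed.

(* The value lost at the switch number [n.+1]; zero when that switch is optimal. *)
Definition slack n w :=
  dvalue (mode_before K n w) (stage n.+1 w) w - wealth K n.+1 w + paid K n w.

Lemma slackE n w : slack n w = if (tau n.+1 w <= K%:E)%E
  then let t := fine (tau n.+1 w) in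
    dvalue (xi n w) t w -
    expR (- (r * t)) * (- g (xi n w) (xi n.+1 w) (X t w) + Y (xi n.+1 w) t w)
  else 0.
Proof.
rewrite /slack /wealth /paid /=; case: ifPn => tK; last by rewrite subrr addr0.
have ty : (tau n.+1 w < +oo)%E by rewrite (le_lt_trans tK)// ltry.
rewrite mode_before_id; last exact: le_trans (tau_le _ _) tK.
rewrite /switch_cost ty /cap min_l//= /dvalue /frozen max_l ?fine_ge0//.
by rewrite mulrDr mulrN opprD opprK addrA addrAC.
Qed.

(** Values at the ends of successive phases telescope except for the change of mode at each switch;
    [slack] records this change together with its cost. *)
Lemma jump_sum n w : \sum_(l < n) jump K l w = (income n w - outlay n w + wealth K n w)
  - (wealth K 0 w + fees n w) + \sum_(l < n) slack l w.
Proof.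
rewrite /income /outlay /fees; elim: n => [|n IH].
  by rewrite !big_ord0 subrr add0r !addr0 subrr.
have -> : \sum_(l < n.+1) jump K l w = \sum_(l < n) jump K l w + jump K n w by rewrite big_ord_recr.
rewrite IH !big_ord_recr/= /increment /slack /jump /snell -/(mode_before K n w).
rewrite !(cumE (pb _)) /wealth.
do 3 move: (\sum_(_ < n) _) => ?.
repeat (move: (prim _ _) => ?).
repeat (move: (dvalue _ _ _) => ?).
move: (paid _ _ _) => *; ring.
Qed.

(** The chosen mode is one candidate in the maximum defining the obstacle, and the value lies above
    the obstacle. *)
Lemma slack_ge0 : {ae P, forall w, forall n, 0 <= slack n w}.
Proof.
have : {ae P, forall w, forall i, forall t : R, 0 <= t -> obstacle i t w <= dvalue i t w}.
  by apply: filter_forall => i; exact: (obstacle_le (pb i)).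
apply: filterS => w ob n; rewrite slackE; case: ifPn => // tK.
have ty : (tau n.+1 w < +oo)%E by rewrite (le_lt_trans tK)// ltry.
set t := fine _; have t0 : 0 <= t by rewrite fine_ge0.
rewrite subr_ge0; apply: le_trans (ob _ _ t0).
rewrite /obstacle /frozen max_l// ler_wpM2l ?expR_ge0//.
by apply: switch_fin_ge; exact: xi_neq.
Qed.

Lemma itg_slack n : itg (slack n).
Proof.
apply: itg_D; last exact: itg_paid.
apply: itg_B => //.
apply: (itg_dom _ majorant_integrable).
  apply: (measurable_mode_fun (Z := fun i w => dvalue i (stage n.+1 w) w)) => i.
    exact: (measurable_mode_before).
  apply: measurable_eval; last exact: measurable_cap.
    by move=> w; exact: dvalue_continuous.
  by move=> t; exact: dvalue_measurable.
by move=> w; exact: dvalue_majorant.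
Qed.

(** Slacks have nonnegative and jumps nonpositive expectation: dropping both gives [horizon_le], and
    showing both null gives [horizon_hitting]. Income and outlay are kept apart so that each is
    monotone when the horizon grows. *)
Lemma horizon_balance n :
  \int[P]_w income n w + \int[P]_w wealth K n w + \sum_(l < n) \int[P]_w slack l w =
  \int[P]_w wealth K 0 w + (\int[P]_w outlay n w + \int[P]_w fees n w)
  + \sum_(l < n) \int[P]_w jump K l w.
Proof.
have iJ l : itg (jump K l).
  exact: (itg_jump K0).
rewrite -(E_sum _ _ (fun l : 'I_n => iJ l)) -(E_sum _ _ (fun l : 'I_n => itg_slack l)).
under [X in _ = _ + X]eq_Rintegral do rewrite jump_sum.
have iI := itg_income n; have iO := itg_outlay n; have iC := itg_fees n.
have iW0 := iW 0; have iWn := iW n.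
have iS : itg (fun w => \sum_(l < n) slack l w) by apply: itg_sum => l; exact: itg_slack.
rewrite (@E_D _ _ _ P (fun w => income n w - outlay n w + wealth K n w
  - (wealth K 0 w + fees n w)))//; last by apply: itg_B; [apply: itg_D => //; exact: itg_B|exact: itg_D].
rewrite (@E_B _ _ _ P (fun w => income n w - outlay n w + wealth K n w)
  (fun w => wealth K 0 w + fees n w))//; [|by apply: itg_D => //; exact: itg_B|exact: itg_D].
rewrite (@E_D _ _ _ P (fun w => income n w - outlay n w))//; last exact: itg_B.
rewrite E_B// E_D//.
repeat (move: (Rintegral _ _ _) => ?); ring.
Qed.

Lemma horizon_le n : \int[P]_w income n w + \int[P]_w wealth K n w <=
  \int[P]_w wealth K 0 w + (\int[P]_w outlay n w + \int[P]_w fees n w).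
Proof.
have := horizon_balance n.
have s0 : 0 <= \sum_(l < n) \int[P]_w slack l w.
  apply: sumr_ge0 => l _; rewrite -(E_cst P 0); apply: E_le_ae => //.
  - exact: itg_cst.
  - exact: itg_slack.
  - by apply: filterS slack_ge0.
have j0 : \sum_(l < n) \int[P]_w jump K l w <= 0.
  apply: sumr_le0 => l _.
  exact: (E_jump_le0 K0).
move: s0 j0; repeat (move: (\sum_(_ < n) _) => ?).
repeat (move: (Rintegral _ _ _) => ?); move=> *; lra.
Qed.

End horizon_balance.

(** * Equality along hitting strategies *)

Section hitting_balance.
Hypothesis hit : hitting_strategy F X g i1 Y s.

Let tauE n w : tau n.+1 w = first_zero (gap (xi n w)) (tau n) w.
Proof. by have [_ -> _ _] := hit; exact: hitting_timeE. Qed.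

Variable K : R.
Hypothesis K0 : 0 <= K.
Local Notation stage n := (cap (tau n) K).

(** Where the mode is [i], the next switching time agrees with [D i], the first zero after [tau n]
    of the gap of mode [i]. [D i] is a stopping time defined for all outcomes, so
    [submartingale_before_hit] applies to it. *)
Lemma E_jump_ge0 n : 0 <= \int[P]_w jump K n w.
Proof.
have iS i (D : T -> \bar R) : stopping_time F D ->
    itg (fun w => snell (profit i) (dvalue i) (cap D K w) w).
  by move=> sD; exact: (itg_snell_cap (pb i)).
pose D i := first_zero (gap i) (tau n).
have sD i : stopping_time F (D i).
  exact: fz_stopping.
have -> : jump K n = fun w => \sum_(i < m) \1_(started K n i) w *
  (snell (profit i) (dvalue i) (cap (D i) K w) w - snell (profit i) (dvalue i) (stage n w) w).
  apply/funext => w; rewrite (jumpE); apply: eq_bigr => i _.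
  rewrite indicE; have [|_] := boolP (w \in started K n i); last by rewrite !mul0r.
  by rewrite inE => -[/= <- _]; rewrite /cap tauE.
rewrite E_sum => [|i].
  apply: sumr_ge0 => i _; apply: (submartingale_before_hit (pb i)) => //.
  - move=> w u su yh; apply: first_zero_le => //.
    by rewrite /gap yh subrr.
  - by move=> w; exact: first_zero_ge.
  - exact: (started_stopped).
apply: itg_ind; first by case: (started_stopped K n i).
by apply: itg_B; exact: iS.
Qed.

(** The infimum defining the switching time is attained by continuity, so the gap is 0 there, and
    the new mode attains the maximum. *)
Lemma slack_eq0 n w : slack K n w = 0.
Proof.
rewrite (slackE); case: ifPn => // tK.
have ty : (tau n.+1 w < +oo)%E by rewrite (le_lt_trans tK)// ltry.
have [_ _ sm _] := hit; have [_] := sm n w ty.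
rewrite switch_valueE => -[]; cbv zeta; set t := fine _ => <-.
have t0 : 0 <= t by rewrite fine_ge0.
have te : tau n.+1 w = t%:E by rewrite fineK// ge0_fin_numE.
have := @first_zero_attained _ _ _ (gap (xi n w)) (tau n)
  (fun w0 => @gap_continuous (xi n w) w0) w t.
rewrite -tauE => /(_ te); rewrite /gap /obstacle /frozen max_l//.
Qed.

Lemma horizon_hitting n : \int[P]_w income K n w + \int[P]_w wealth K n w =
  \int[P]_w wealth K 0 w + (\int[P]_w outlay K n w + \int[P]_w fees K n w).
Proof.
have := horizon_balance K0 n.
rewrite [X in _ + X = _]big1 => [|l _]; last first.
  by under eq_Rintegral do rewrite slack_eq0; rewrite E_cst.
rewrite [X in _ = _ + X]big1 => [|l _]; last first.
  apply: le_anti; rewrite E_jump_ge0 andbT.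
  exact: (E_jump_le0 K0).
by rewrite !addr0.
Qed.

End hitting_balance.

(** * Cash flows along one path *)

Section income_along_a_path.
Variable w : T.
Variables (phi : 'I_m -> R -> R) (u : R -> R).
Hypotheses (cphi : forall i, continuous (phi i)) (phi0 : forall i t, 0 <= phi i t)
  (u_in : forall l t, 0 < t -> (tau l w < t%:E <= tau l.+1 w)%E -> u t = phi (xi l w) t)
  (u_out : forall t, 0 < t -> (forall l, (tau l w < t%:E)%E) -> u t = 0).

(** Phases are open on the left, so that consecutive ones are disjoint; this omits time 0, which is
    negligible. *)
Let window_rate K l t := phi (mode_before K l w) t *
  \1_(`]cap (tau l) K w, cap (tau l.+1) K w]%classic) t.

Let rate K n t := \sum_(l < n) window_rate K l t.

(** Consecutive phases fit together, so their rates rebuild the flow up to the [n]-th switch or the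
    horizon. *)
Let rateE K n t : 0 <= K ->
  rate K n t = if 0 < t <= cap (tau n) K w then u t else 0.
Proof.
move=> K0; rewrite /rate; elim: n => [|n IH].
  rewrite big_ord0 (cap_id (tau_ge0 0) (tau0 w) K0).
  by case: ifPn => // /andP[/lt_le_trans /[apply]]; rewrite ltxx.
rewrite big_ord_recr/= IH /window_rate indicE.
have le_st : cap (tau n) K w <= cap (tau n.+1) K w by exact: le_cap.
have [t0|t0] := ltP 0 t; last first.
  rewrite /= add0r memNset ?mulr0//= in_itv/= => /andP[+ _].
  by rewrite ltNge (le_trans t0)// cap_ge0.
rewrite /=; have [tn|nt] := leP t (cap (tau n) K w).
  by rewrite (le_trans tn le_st) memNset ?mulr0 ?addr0//= in_itv/= ltNge tn.
rewrite add0r; have [tn1|n1t] := leP t (cap (tau n.+1) K w); last first.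
  by rewrite memNset ?mulr0//= in_itv/= [X in _ && X]leNgt n1t andbF.
rewrite mem_set ?mulr1/= ?in_itv/= ?nt//.
have tK : t <= K by rewrite (le_trans tn1)// cap_leK.
have tt : (tau n w < t%:E)%E.
  have := nt; rewrite -lte_fin capE// gt_min => /orP[//|].
  by rewrite lte_fin ltNge tK.
rewrite mode_before_id; last by rewrite (le_trans (ltW tt))// lee_fin.
apply/esym/u_in => //; rewrite tt /=.
by have := tn1; rewrite -lee_fin capE// le_min => /andP[].
Qed.

Let window_rate_ge0 K l t : 0 <= window_rate K l t.
Proof. by rewrite mulr_ge0// indicE. Qed.

Let measurable_window_rate K l : measurable_fun setT (window_rate K l).
Proof.
apply: measurable_funM; last exact: measurable_indic.
exact: continuous_measurable_fun.
Qed.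

Let measurable_rate K n : measurable_fun setT (rate K n).
Proof. by apply: measurable_sum => l; exact: measurable_window_rate. Qed.

Lemma increment_sumE K n : 0 <= K ->
  ((\sum_(l < n) increment K phi l w)%:E = \int[leb]_t (rate K n t)%:E)%E.
Proof.
move=> K0; rewrite /rate.
under eq_integral do rewrite -sumEFin.
rewrite ge0_integral_sum//; last 2 first.
  by move=> l; apply/measurable_EFinP; exact: measurable_window_rate.
  by move=> l t _; rewrite lee_fin.
rewrite -sumEFin; apply: eq_bigr => l _; rewrite /increment primB ?cap_ge0//; last exact: le_cap.
rewrite EFin_Rint// [LHS]integral_mkcond; apply: eq_integral => t _.
by rewrite /window_rate patchE indicE; case: ifPn; rewrite ?mulr1 ?mulr0.
Qed.

Let lim_rate t := if 0 < t then u t else 0.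

Let stage_mono : {homo (fun n => cap (tau n) n%:R w) : i j / (i <= j)%N >-> i <= j}.
Proof.
move=> i j ij; rewrite -lee_fin !capE//; apply: le_min2; first exact: tau_mono.
by rewrite lee_fin ler_nat.
Qed.

Let u_ge0 t : 0 < t -> 0 <= u t.
Proof.
move=> t0; have [out|] := pselect (forall l, (tau l w < t%:E)%E).
  by rewrite u_out.
move=> /existsNP ex; have [|n] := ex_minnP (P := fun n => ~~ (tau n w < t%:E)%E).
  by have [n /negP ?] := ex; exists n.
case: n => [|n]; first by rewrite tau0 lte_fin t0.
rewrite -leNgt => tn min; rewrite (u_in (l := n))//.
rewrite tn andbT; apply/negPn/negP => /min; by rewrite ltnn.
Qed.

Let rate_mono t : nondecreasing_seq (fun n => rate n%:R n t).
Proof.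
move=> n p np; rewrite !rateE//.
have [t0|//] := ltP 0 t; rewrite /=.
have [tn|_] := leP t _; first by rewrite (le_trans tn)// stage_mono.
by case: ifP => // _; exact: u_ge0.
Qed.

Let rate_cvg t : rate n%:R n t @[n --> \oo] --> lim_rate t.
Proof.
rewrite /lim_rate; have [t0|t0] := ltP 0 t; last first.
  by apply: cvg_near_cst; apply: nearW => n; rewrite rateE// ltNge t0.
have [out|] := pselect (forall l, (tau l w < t%:E)%E).
  apply: cvg_near_cst; apply: nearW => n; rewrite rateE// t0/= (u_out t0 out).
  by case: ifP.
move=> /existsNP[l /negP]; rewrite -leNgt => tl.
apply: cvg_near_cst; near=> n; rewrite rateE// t0/= ifT//.
rewrite -lee_fin capE// le_min; apply/andP; split.
  rewrite (le_trans tl)// tau_mono//; near: n; exact: nbhs_infty_ge.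
by rewrite lee_fin; near: n; exact: nbhs_infty_ger.
Unshelve. all: end_near. Qed.

Let measurable_lim_rate : measurable_fun setT lim_rate.
Proof.
by apply: (measurable_fun_cvg (h := fun n => rate n%:R n)) => // t _; exact: rate_cvg.
Qed.

Let measurable_oo : measurable_fun (`]0%R, +oo[%classic : set R) (EFin \o u).
Proof.
apply: (eq_measurable_fun (EFin \o lim_rate)).
  by move=> t; rewrite inE/= in_itv/= andbT /lim_rate => ->.
by apply/measurable_EFinP; exact: measurable_funTS.
Qed.

Lemma measurable_path_rate : measurable_fun (`[0%R, +oo[%classic : set R) (EFin \o u).
Proof. by apply/(emeasurable_fun_itv_obnd_cbndP 0 (BInfty _ false)); exact: measurable_oo. Qed.

(** With horizon and number of phases both equal to [n], the rates increase to the flow: a positive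
    time is either beyond all switching times, where the flow is 0, or covered from some [n] on. *)
Lemma increment_sum_cvg :
  nondecreasing_seq (fun n => \sum_(l < n) increment n%:R phi l w) /\
  ((\sum_(l < n) increment n%:R phi l w)%:E @[n --> \oo] -->
     \int[leb]_(t in `[0%R, +oo[) (u t)%:E)%E.
Proof.
have limE : (\int[leb]_(t in `[0%R, +oo[) (u t)%:E = \int[leb]_t (lim_rate t)%:E)%E.
  rewrite -integral_itv_obnd_cbnd// [LHS]integral_mkcond; apply: eq_integral => t _.
  rewrite patchE /lim_rate mem_setE in_itv/= andbT; by case: ifP.
have rate0 n t : 0 <= rate n%:R n t by apply: sumr_ge0.
split.
  move=> n p np; rewrite -lee_fin !increment_sumE//.
  apply: ge0_le_integral => //.
  - by move=> t _; rewrite lee_fin.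
  - by apply/measurable_EFinP; exact: measurable_rate.
  - by apply/measurable_EFinP; exact: measurable_rate.
  - by move=> t _; rewrite lee_fin rate_mono.
rewrite limE; under eq_cvg do rewrite increment_sumE//.
apply: monotone_cvg.
- by move=> n; apply/measurable_EFinP; exact: measurable_rate.
- by move=> n t; rewrite lee_fin.
- by move=> t n p np; rewrite lee_fin rate_mono.
- by move=> t; apply: cvg_EFin; [exact: nearW|exact: rate_cvg].
Qed.

End income_along_a_path.

(** * Profit and losses over the infinite horizon *)

Let in_phaseE n t w : 0 < t -> in_phase s n t w <-> (tau n w < t%:E <= tau n.+1 w)%E.
Proof. by move=> t0; case: n => //=; rewrite tau0 lee_fin lte_fin t0 ltW. Qed.

Lemma mode_in n t w : 0 < t -> (tau n w < t%:E <= tau n.+1 w)%E ->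
  mode s t w = Some (xi n w).
Proof.
move=> t0 nt; apply: xget_subset1; first by exists n => //; exact/in_phaseE.
suff uniq p : in_phase s p t w -> p = n.
  by move=> _ _ [p /uniq -> ->] [q /uniq -> ->].
move=> /(in_phaseE _ _ t0)/andP[pt tp]; have /andP[nt1 tn] := nt.
apply/eqP; rewrite eqn_leq; apply/andP; split; rewrite leqNgt; apply/negP => lt.
  by have := lt_le_trans pt (le_trans tn (tau_mono w lt)); rewrite ltxx.
by have := lt_le_trans nt1 (le_trans tp (tau_mono w lt)); rewrite ltxx.
Qed.

Lemma mode_out t w : 0 < t -> (forall n, (tau n w < t%:E)%E) -> mode s t w = None.
Proof.
move=> t0 out; rewrite /mode; case: xgetP => // o _ [n /(in_phaseE _ _ t0)/andP[_ tn] _].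
by have := lt_le_trans (out n.+1) tn; rewrite ltxx.
Qed.

Definition profit_flow t w := expR (- (r * t)) * profit_rate psi (mode s t w) (X t w).
Definition total_income w := (\int[leb]_(t in `[0%R, +oo[) (fpos profit_flow t w)%:E)%E.
Definition total_outlay w := (\int[leb]_(t in `[0%R, +oo[) (fneg profit_flow t w)%:E)%E.
Definition total_fees w := (\sum_(0 <= l <oo) (switch_cost l w)%:E)%E.

Let flow_in l t w : 0 < t -> (tau l w < t%:E <= tau l.+1 w)%E ->
  profit_flow t w = profit (xi l w) t w.
Proof.
move=> t0 tl; rewrite /profit_flow (mode_in t0 tl)/=.
by rewrite /profit /frozen /discounted_profit max_l// ltW.
Qed.

Let flow_out t w : 0 < t -> (forall l, (tau l w < t%:E)%E) -> profit_flow t w = 0.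
Proof. by move=> t0 /(mode_out t0); rewrite /profit_flow => ->; rewrite mulr0. Qed.

Lemma income_cvg w : nondecreasing_seq (fun n => income n%:R n w) /\
  ((income n%:R n w)%:E @[n --> \oo] --> total_income w)%E.
Proof.
apply: (@increment_sum_cvg w
  (fun i t => fpos (profit i) t w) (fpos profit_flow ^~ w)).
- by move=> i; exact: (fpos_continuous (pb i)).
- by move=> i t; exact: fpos_ge0.
- by move=> l t t0 tl; rewrite /fpos (flow_in t0 tl).
- by move=> t t0 out; rewrite /fpos flow_out// maxxx.
Qed.

Lemma measurable_flow_income w :
  measurable_fun (`[0%R, +oo[%classic : set R) (fun t => (fpos profit_flow t w)%:E).
Proof.
apply: (@measurable_path_rate w
  (fun i t => fpos (profit i) t w) (fpos profit_flow ^~ w)).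
- by move=> i; exact: (fpos_continuous (pb i)).
- by move=> l t t0 tl; rewrite /fpos (flow_in t0 tl).
- by move=> t t0 out; rewrite /fpos flow_out// maxxx.
Qed.

Lemma outlay_cvg w : nondecreasing_seq (fun n => outlay n%:R n w) /\
  ((outlay n%:R n w)%:E @[n --> \oo] --> total_outlay w)%E.
Proof.
apply: (@increment_sum_cvg w
  (fun i t => fneg (profit i) t w) (fneg profit_flow ^~ w)).
- by move=> i; exact: (fneg_continuous (pb i)).
- by move=> i t; exact: fneg_ge0.
- by move=> l t t0 tl; rewrite /fneg (flow_in t0 tl).
- by move=> t t0 out; rewrite /fneg flow_out// oppr0 maxxx.
Qed.

Let cost_ge0 l w : 0 <= switch_cost l w.
Proof. exact: switch_cost_ge0. Qed.

Lemma fees_cvg w : nondecreasing_seq (fun n => fees n%:R n w) /\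
  ((fees n%:R n w)%:E @[n --> \oo] --> total_fees w)%E.
Proof.
apply: (sum_nondecreasing_cvg (a := fun n l => paid n%:R l w)).
- by move=> n l; rewrite /paid; case: ifP.
- move=> l n p np; rewrite /paid; case: ifP => [tn|_]; last by case: ifP.
  by rewrite (le_trans tn)// lee_fin ler_nat.
- move=> l; rewrite /paid; case tl : (tau l.+1 w) => [x| |].
  + near=> n; rewrite ifT// lee_fin; near: n; exact: nbhs_infty_ger.
  + by apply: nearW => n; rewrite /switch_cost tl ltxx.
  + by have := tau_ge0 l.+1 w; rewrite tl.
Unshelve. all: end_near. Qed.

(** Outlay and fees are grouped as losses: income has finite expectation, so only the losses can
    make the profit infinite. *)
Lemma total_profitE : total_profit P r X psi g s =
  (\int[P]_w (total_income w - (total_outlay w + total_fees w)))%E.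
Proof.
apply: eq_integral => w _; rewrite [in LHS]integralE.
have -> : (\int[leb]_(t in `[0%R, +oo[) (fun t => (expR (- (r * t)) *
    profit_rate psi (mode s t w) (X t w))%:E)^\+ t = total_income w)%E.
  by apply: eq_integral => t _; rewrite funeposE -EFin_max.
have -> : (\int[leb]_(t in `[0%R, +oo[) (fun t => (expR (- (r * t)) *
    profit_rate psi (mode s t w) (X t w))%:E)^\- t = total_outlay w)%E.
  by apply: eq_integral => t _; rewrite funenegE -EFinN -EFin_max.
(* Switches are numbered from 1 in the profit and from 0 in [total_fees]; the value at index 0 is a
   filler outside the sum. *)
pose cost n := (if n is n'.+1 then switch_cost n' w else 0)%:E.
have cost0 n : (0 <= cost n)%E by case: n => [|n]; rewrite lee_fin.
have -> : (\sum_(1 <= n <oo) discount r (tau n w) * (g (xi n.-1 w) (xi n w)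
    (X (fine (tau n w)) w))%:E = total_fees w)%E.
  transitivity (\sum_(1 <= n <oo) cost n)%E.
    apply/congr_lim/funext => p; apply: eq_big_nat => -[//|n] _; rewrite /cost /switch_cost /discount /=.
    case tn : (tau n.+1 w) => [x| |]; rewrite ?ltry ?ltxx//.
    + by rewrite gt0_muley ?lte_fin//= mul0e.
    + by have := tau_ge0 n.+1 w; rewrite tn.
  rewrite -nneseries_addn// /total_fees; apply: eq_eseriesr => n _.
  by rewrite addn1.
have o0 : (0 <= total_outlay w)%E.
  by apply: integral_ge0 => t _; rewrite lee_fin; exact: fneg_ge0.
have f0 : (0 <= total_fees w)%E by apply: nneseries_ge0 => n _ _; rewrite lee_fin.
rewrite -addeA; congr (_ + _)%E; rewrite oppeD//.
by apply: ge0_adde_def; rewrite inE.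
Qed.

Let iI n : itg (income n%:R n).
Proof.
exact: (itg_income (ler0n R n)).
Qed.

Let iO n : itg (outlay n%:R n).
Proof.
exact: (itg_outlay (ler0n R n)).
Qed.

Let iC n : itg (fees n%:R n).
Proof. exact: itg_fees. Qed.

Let income_ge0 n w : 0 <= income n%:R n w.
Proof. by have [/(_ 0%N n (leq0n n)) + _] := income_cvg w; rewrite /income /= big_ord0. Qed.

Let outlay_ge0 n w : 0 <= outlay n%:R n w.
Proof. by have [/(_ 0%N n (leq0n n)) + _] := outlay_cvg w; rewrite /outlay /= big_ord0. Qed.

Let fees_ge0 n w : 0 <= fees n%:R n w.
Proof. by have [/(_ 0%N n (leq0n n)) + _] := fees_cvg w; rewrite /fees /= big_ord0. Qed.

Let total_ge0 w : [/\ 0 <= total_income w, 0 <= total_outlay w & 0 <= total_fees w]%E.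
Proof.
split; try by apply: integral_ge0 => t _; rewrite lee_fin ?fpos_ge0 ?fneg_ge0.
apply: nneseries_ge0 => n _ _; rewrite lee_fin.
exact: switch_cost_ge0.
Qed.

Let losses n w := outlay n%:R n w + fees n%:R n w.

Let losses_cvg w :
  ((losses n w)%:E @[n --> \oo] --> total_outlay w + total_fees w)%E.
Proof.
under eq_cvg do rewrite EFinD.
have [_ o0 f0] := total_ge0 w.
apply: cvgeD; first by apply: ge0_adde_def; rewrite inE.
  by have [] := outlay_cvg w.
by have [] := fees_cvg w.
Qed.

Let measurable_total_income : measurable_fun setT total_income.
Proof.
apply: (emeasurable_fun_cvg (fun n => EFin \o income n%:R n)).
  by move=> n; have /integrableP[] := iI n.
by move=> w _; have [] := income_cvg w.
Qed.

Let measurable_total_fees : measurable_fun setT total_fees.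
Proof.
apply: (emeasurable_fun_cvg (fun n => EFin \o fees n%:R n)).
  by move=> n; have /integrableP[] := iC n.
by move=> w _; have [] := fees_cvg w.
Qed.

Let measurable_total_losses : measurable_fun setT (fun w => total_outlay w + total_fees w)%E.
Proof.
apply: (emeasurable_fun_cvg (fun n => EFin \o losses n)).
  by move=> n; have /integrableP[] := itg_D (iO n) (iC n).
by move=> w _; exact: losses_cvg.
Qed.

Let E_income_cvg :
  ((\int[P]_w income n%:R n w)%:E @[n --> \oo] --> \int[P]_w total_income w)%E.
Proof.
under eq_cvg do rewrite -(E_EFin (iI _)).
apply: monotone_cvg.
- by move=> n; have /integrableP[] := iI n.
- by move=> n w; rewrite lee_fin.
- by move=> w n p np; rewrite lee_fin; have [/(_ _ _ np)] := income_cvg w.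
- by move=> w; have [] := income_cvg w.
Qed.

Let E_losses_cvg : ((\int[P]_w losses n w)%:E @[n --> \oo] -->
  \int[P]_w (total_outlay w + total_fees w))%E.
Proof.
have iL n : itg (losses n) := itg_D (iO n) (iC n).
under eq_cvg do rewrite -(E_EFin (iL _)).
apply: monotone_cvg.
- by move=> n; have /integrableP[] := iL n.
- by move=> n w; rewrite lee_fin addr_ge0.
- move=> w n p np; rewrite lee_fin; apply: lerD.
    by have [/(_ _ _ np)] := outlay_cvg w.
  by have [/(_ _ _ np)] := fees_cvg w.
- by move=> w; exact: losses_cvg.
Qed.

(** At any time the flow is that of one mode or 0, so its positive part is at most the sum over all
    modes, each finite in expectation by [fpos_tot_lty]. *)
Let total_income_lty : (\int[P]_w total_income w < +oo)%E.
Proof.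
apply: (@le_lt_trans _ _ (\int[P]_w \sum_(i < m) fpos_tot (profit i) w)%E); last first.
  rewrite ge0_integral_sum//.
  - by apply: lte_sum_pinfty => i _; exact: (fpos_tot_lty (pb i)).
  - by move=> i; exact: (measurable_fpos_tot (pb i)).
  - by move=> i w _; exact: fpos_tot_ge0.
apply: ge0_le_integral => //.
- by move=> w _; have [] := total_ge0 w.
- by apply: emeasurable_sum => i; exact: (measurable_fpos_tot (pb i)).
move=> w _; rewrite /fpos_tot -ge0_integral_sum//; last 2 first.
  move=> i; apply: measurable_funTS; apply/measurable_EFinP.
  by apply: continuous_measurable_fun; exact: (fpos_continuous (pb i)).
  by move=> i t _; rewrite lee_fin fpos_ge0.
apply: ge0_le_integral => //.
- by move=> t _; rewrite lee_fin fpos_ge0.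
- exact: measurable_flow_income.
- apply: emeasurable_sum => i; apply: measurable_funTS; apply/measurable_EFinP.
  by apply: continuous_measurable_fun; exact: (fpos_continuous (pb i)).
move=> t; rewrite /= in_itv/= andbT => t0; rewrite sumEFin lee_fin.
have s0 (p : pred 'I_m) : 0 <= \sum_(i < m | p i) fpos (profit i) t w.
  by apply: sumr_ge0 => i _; exact: fpos_ge0.
rewrite {1}/fpos /profit_flow; case: (mode s t w) => [i|] /=; last by rewrite mulr0 maxxx.
rewrite (bigD1 i)//= -[leLHS]addr0; apply: lerD => //.
by rewrite /fpos /profit /frozen /discounted_profit (max_l t0).
Qed.

Lemma total_profit_split : total_profit P r X psi g s =
  (\int[P]_w total_income w - \int[P]_w (total_outlay w + total_fees w))%E.
Proof.
rewrite (total_profitE) ge0_integralB//.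
  by move=> w; have [] := total_ge0 w.
by move=> w; have [_ o0 f0] := total_ge0 w; exact: adde_ge0.
Qed.

Lemma wealth0 K w : 0 <= K -> wealth K 0 w = Y i1 0 w.
Proof.
move=> K0; rewrite /wealth (cap_id (tau_ge0 0) (tau0 w) K0) /= xi0.
by rewrite /dvalue /frozen maxxx mulr0 oppr0 expR0 mul1r.
Qed.

(** If all switching times were at most [A], infinitely many switches would each cost at least
    [c = exp(-rA)/alpha], and the first [N] of them would already exceed the finite total. *)
Lemma times_unbounded w (A : R) : (total_fees w < +oo)%E -> exists n, (A%:E < tau n w)%E.
Proof.
move=> fin; apply: contrapT => /forallNP bnd.
have {}bnd n : (tau n w <= A%:E)%E by rewrite leNgt; apply/negP.
have A0 : 0 <= A by have := bnd 0%N; rewrite tau0 lee_fin.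
pose c := expR (- (r * A)) * alpha^-1.
have c0 : 0 < c by rewrite mulr_gt0 ?expR_gt0// invr_gt0.
have cost n : c <= switch_cost n w.
  have ty : (tau n.+1 w < +oo)%E by rewrite (le_lt_trans (bnd _))// ltry.
  rewrite /switch_cost ty; have ne : xi n w != xi n.+1 w by rewrite eq_sym; exact: xi_neq.
  have /andP[gl _] := g_bounds (X (fine (tau n.+1 w)) w) ne.
  apply: ler_pM; rewrite ?expR_ge0 ?invr_ge0 ?(ltW alpha_gt0)//.
  rewrite ler_expR lerN2 ler_pM2l// -lee_fin fineK// ge0_fin_numE//.
have [_ _ f0] := total_ge0 w; pose f := fine (total_fees w).
have fE : total_fees w = f%:E by rewrite fineK// ge0_fin_numE.
pose N := (Num.truncn (f / c)).+1.
have : ((\sum_(0 <= n < N) c)%:E <= f%:E)%E.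
  rewrite -fE; apply: le_trans (_ : (\sum_(0 <= n < N) (switch_cost n w)%:E <= _)%E); last first.
    by apply: nneseries_lim_ge => n _ _; rewrite lee_fin (le_trans (ltW c0)).
  by rewrite -sumEFin; apply: lee_sum => n _; rewrite lee_fin.
rewrite lee_fin sumr_const_nat subn0 -mulr_natl -ler_pdivlMr// leNgt.
by rewrite truncnS_gt.
Qed.

(** The stages tend to infinity, and the sum over all modes absorbs the dependence of the held mode
    on [n]. *)
Lemma wealth_cvg w : (total_fees w < +oo)%E ->
  (forall i, dvalue i t w @[t --> +oo] --> 0) -> wealth n%:R n w @[n --> \oo] --> 0.
Proof.
move=> fin dv.
have stage_y : cap (tau n) n%:R w @[n --> \oo] --> +oo.
  apply/cvgryPge => A; have [N AN] := times_unbounded A fin.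
  near=> n; rewrite -lee_fin capE// le_min; apply/andP; split.
    rewrite (le_trans (ltW AN))// tau_mono//; near: n; exact: nbhs_infty_ge.
  by rewrite lee_fin; near: n; exact: nbhs_infty_ger.
apply/norm_cvg0P; apply: (@squeeze_cvgr _ _ _ _ (fun=> 0)
  (fun n => \sum_(i < m) `|dvalue i (cap (tau n) n%:R w) w|)).
- apply: nearW => n; rewrite normr_ge0/= /wealth.
  by rewrite (bigD1 (mode_before n%:R n w))//= lerDl sumr_ge0.
- exact: cvg_cst.
- have : \sum_(i < m) `|dvalue i (cap (tau n) n%:R w) w| @[n --> \oo] --> \sum_(j < m) (0 : R).
    apply: cvg_big => [|j _]; first exact: add_continuous.
    by apply/norm_cvg0P; apply: cvg_comp stage_y (dv j).
  by rewrite big1_eq.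
Unshelve. all: end_near. Qed.

Let E_wealth_cvg : (\int[P]_w (total_outlay w + total_fees w) < +oo)%E ->
  \int[P]_w wealth n%:R n w @[n --> \oo] --> 0.
Proof.
move=> fin.
have iL : P.-integrable setT (fun w => total_outlay w + total_fees w)%E.
  apply/integrableP; split => //; under eq_integral => w _.
    rewrite gee0_abs; last by have [_ o0 f0] := total_ge0 w; exact: adde_ge0.
    over.
  exact: fin.
have mW n : measurable_fun setT (wealth n%:R n).
  apply: itg_measurable.
  exact: (itg_wealth (ler0n R n)).
have ae0 : {ae P, forall w, wealth n%:R n w @[n --> \oo] --> 0}.
  apply: filterS2 (integrable_ae measurableT iL) dvalue_vanish => w /(_ I) fn.
  have [_ o0 f0] := total_ge0 w.
  have lt : (total_outlay w + total_fees w < +oo)%E by rewrite -ge0_fin_numE// adde_ge0.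
  by apply: wealth_cvg; apply: le_lt_trans lt; rewrite leeDr.
have [_] := @E_dominated _ _ _ P (fun n => wealth n%:R n) (fun=> 0) (majorant) mW
  (measurable_cst _) majorant_integrable
  (fun n w => dvalue_majorant _ _ w) ae0.
by rewrite E_cst.
Qed.

Let fine_E (Z : T -> \bar R) : (0 <= \int[P]_w Z w < +oo)%E ->
  (\int[P]_w Z w = (fine (\int[P]_w Z w))%:E)%E.
Proof. by move=> /andP[z0 zy]; rewrite fineK// ge0_fin_numE. Qed.

Let total_incomeE : (\int[P]_w total_income w = (fine (\int[P]_w total_income w))%:E)%E.
Proof.
apply: fine_E; rewrite total_income_lty andbT; apply: integral_ge0 => w _.
by have [] := total_ge0 w.
Qed.

Let total_losses_ge0 : (0 <= \int[P]_w (total_outlay w + total_fees w))%E.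
Proof. by apply: integral_ge0 => w _; have [_ o0 f0] := total_ge0 w; exact: adde_ge0. Qed.

Let E_lossesE n : \int[P]_w losses n w = \int[P]_w outlay n%:R n w + \int[P]_w fees n%:R n w.
Proof. by rewrite /losses E_D. Qed.

Let E_wealth0 n : \int[P]_w wealth n%:R 0 w = \int[P]_w Y i1 0 w.
Proof. by apply: eq_Rintegral => w _; rewrite wealth0. Qed.

Lemma total_profit_le : (total_profit P r X psi g s <= (\int[P]_w Y i1 0 w)%:E)%E.
Proof.
rewrite total_profit_split.
have [fin|] := ltP (\int[P]_w (total_outlay w + total_fees w))%E +oo%E; last first.
  by rewrite leye_eq => /eqP ->; rewrite addeNy leNye.
have lossE := fine_E (introT andP (conj total_losses_ge0 fin)).
have := E_income_cvg; rewrite total_incomeE => /fine_cvgP[_ cI].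
have := E_losses_cvg; rewrite lossE => /fine_cvgP[_ cL].
rewrite total_incomeE lossE -EFinB lee_fin lerBlDr.
have c1 : \int[P]_w income n%:R n w + \int[P]_w wealth n%:R n w @[n --> \oo] -->
    fine (\int[P]_w total_income w)%E + 0 by exact: cvgD cI (E_wealth_cvg fin).
have c2 : \int[P]_w Y i1 0 w + \int[P]_w losses n w @[n --> \oo] -->
    \int[P]_w Y i1 0 w + fine (\int[P]_w (total_outlay w + total_fees w))%E.
  by apply: cvgD cL; exact: cvg_cst.
rewrite -[leLHS]addr0; apply: (ler_cvg_to c1 c2).
suff step n : \int[P]_w income n%:R n w + \int[P]_w wealth n%:R n w <=
    \int[P]_w Y i1 0 w + \int[P]_w losses n w by apply: nearW => n; exact: step.
rewrite E_lossesE -(E_wealth0 n).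
exact: (horizon_le (ler0n R n)).
Qed.

(** The balance itself bounds the losses: they equal income plus a difference of values, whose means
    are controlled by [majorant] and the initial value. Hence they have finite expectation, the
    remaining value vanishes in the limit, and the equality persists. *)
Lemma total_profit_eq :
  (forall n, \int[P]_w income n%:R n w + \int[P]_w wealth n%:R n w = \int[P]_w wealth n%:R 0 w +
    (\int[P]_w outlay n%:R n w + \int[P]_w fees n%:R n w)) ->
  total_profit P r X psi g s = (\int[P]_w Y i1 0 w)%:E /\
  (\int[P]_w total_fees w < +oo)%E.
Proof.
move=> bal.
have iY n := itg_wealth (ler0n R n) n.
have iH := majorant_integrable.
have fin : (\int[P]_w (total_outlay w + total_fees w) < +oo)%E.
  apply: (@le_lt_trans _ _ (\int[P]_w total_income w + (\int[P]_w majorant w - (\int[P]_w Y i1 0 w)%:E))%E); last first.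
    rewrite total_incomeE; apply: lte_add_pinfty; first exact: ltry.
    rewrite -EFinN; apply: lte_add_pinfty; last exact: ltry.
    exact: integrable_lty.
  move: E_losses_cvg => /cvg_lim <- //; apply: lime_le.
    by apply/cvg_ex; eexists; exact: E_losses_cvg.
  apply: nearW => n; rewrite E_lossesE -(E_wealth0 n).
  have -> : \int[P]_w outlay n%:R n w + \int[P]_w fees n%:R n w =
    \int[P]_w income n%:R n w + (\int[P]_w wealth n%:R n w - \int[P]_w wealth n%:R 0 w).
    have solve (a b c e : R) : a + b = c + e -> e = a + (b - c).
      by move=> ab; rewrite addrA ab addrAC subrr add0r.
    exact: solve (bal n).
  rewrite EFinD EFinB; apply: leeD.
    rewrite -(E_EFin (iI n)); apply: ge0_le_integral => //.
    - by move=> w _; rewrite lee_fin.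
    - by have /integrableP[] := iI n.
    - move=> w _; have [nd cv] := income_cvg w.
      have ndE : nondecreasing_seq (fun n => (income n%:R n w)%:E).
        by move=> i j ij; rewrite lee_fin; exact: nd.
      rewrite -(cvg_lim _ cv)// (cvg_lim _ (ereal_nondecreasing_cvgn ndE))//.
      by apply: ereal_sup_ubound; exists n.
  apply: leeB => //; rewrite -(E_EFin (iY n)); apply: le_integral => //; first exact: iY.
  move=> w _; apply: (@le_trans _ _ `|wealth n%:R n w|%:E).
    by rewrite lee_fin; exact: ler_norm.
  exact: dvalue_majorant.
split; last first.
  apply: le_lt_trans fin; apply: ge0_le_integral => //.
  - by move=> w _; have [] := total_ge0 w.
  - by move=> w _; have [_ o0 f0] := total_ge0 w; rewrite leeDr.
rewrite total_profit_split.
have lossE := fine_E (introT andP (conj total_losses_ge0 fin)).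
have := E_income_cvg; rewrite total_incomeE => /fine_cvgP[_ cI].
have := E_losses_cvg; rewrite lossE => /fine_cvgP[_ cL].
rewrite total_incomeE lossE -EFinB; congr EFin; apply/eqP; rewrite subr_eq.
have c1 : \int[P]_w income n%:R n w + \int[P]_w wealth n%:R n w @[n --> \oo] -->
    fine (\int[P]_w total_income w)%E + 0 by exact: cvgD cI (E_wealth_cvg fin).
have c2 : \int[P]_w Y i1 0 w + \int[P]_w losses n w @[n --> \oo] -->
    \int[P]_w Y i1 0 w + fine (\int[P]_w (total_outlay w + total_fees w))%E.
  by apply: cvgD cL; exact: cvg_cst.
have c3 : \int[P]_w Y i1 0 w + \int[P]_w losses n w @[n --> \oo] -->
    fine (\int[P]_w total_income w)%E + 0.
  rewrite (_ : (fun n => _) = (fun n => \int[P]_w income n%:R n w +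
    \int[P]_w wealth n%:R n w)) //.
  by apply/funext => n; rewrite E_lossesE -(E_wealth0 n).
by apply/eqP; rewrite -[LHS]addr0 -(cvg_lim _ c3)// (cvg_lim _ c2).
Qed.

(** * Profit and summability for hitting strategies *)

Section hitting_optimal.
Hypothesis hit : hitting_strategy F X g i1 Y s.

Let hitting_profit : total_profit P r X psi g s = (\int[P]_w Y i1 0 w)%:E /\
  (\int[P]_w total_fees w < +oo)%E.
Proof.
apply: (total_profit_eq) => n.
exact: (horizon_hitting hit (ler0n R n)).
Qed.

Lemma hitting_total_profit : total_profit P r X psi g s = (\int[P]_w Y i1 0 w)%:E.
Proof. by case: hitting_profit. Qed.

Let discount_ge0 n w : (0 <= discount r (tau n w))%E.
Proof. exact: expeR_ge0. Qed.

Let discount_le n w : (discount r (tau n.+1 w) <= alpha%:E * (switch_cost n w)%:E)%E.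
Proof.
rewrite /switch_cost /discount; case tn : (tau n.+1 w) => [x| |]; last 2 first.
- by rewrite gt0_muley ?lte_fin//= mule0.
- by have := tau_ge0 n.+1 w; rewrite tn.
rewrite ltry /= -EFinM lee_fin mulrCA ler_peMr ?expR_ge0//.
have ne : xi n w != xi n.+1 w.
  by have [_ _ _ _ /(_ n w)] := adm; rewrite eq_sym tn ltry; apply.
have /andP[gl _] := g_bounds (X x w) ne.
by rewrite -(mulfV (lt0r_neq0 alpha_gt0)) ler_wpM2l// ltW.
Qed.

(** The start contributes 1; every later discount factor is at most [alpha] times the cost of its
    switch, because costs are at least [1/alpha], and total fees have finite expectation. *)
Lemma hitting_summable : (\int[P]_w (\sum_(0 <= l <oo) discount r (tau l w)) < +oo)%E.
Proof.
have [_ fin] := hitting_profit.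
have cost0 n w : (0 <= (switch_cost n w)%:E)%E.
  by rewrite lee_fin; exact: switch_cost_ge0.
have f0 w : (0 <= total_fees w)%E by apply: nneseries_ge0.
have mf := measurable_total_fees.
have md n : measurable_fun setT (fun w => discount r (tau n w)).
  have mtau : measurable_fun setT (tau n).
    by apply: (stopping_time_measurable sF Fm); have [_ /(_ n)] := adm.
  have -> : (fun w => discount r (tau n w)) = fun w => if (tau n w < +oo)%E
      then (expR (- (r * fine (tau n w))))%:E else 0%E.
    apply/funext => w; rewrite /discount; have := tau_ge0 n w.
    case: (tau n w) => [x| |]//; first by rewrite ltry.
    by rewrite gt0_muley ?lte_fin//= ltxx.
  apply: measurable_fun_ifT => //.
    by apply: (measurable_fun_bool true); exact: measurable_lte.
  apply/measurable_EFinP; apply: measurableT_comp => //; apply: measurableT_comp => //.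
  by apply: measurable_funM => //; apply: measurableT_comp => //; exact: fine_measurable.
apply: (@le_lt_trans _ _ (\int[P]_w (1 + alpha%:E * total_fees w))%E).
  apply: ge0_le_integral => //.
  - by move=> w _; apply: nneseries_ge0.
  - by apply: ge0_emeasurable_sum.
  - by apply: emeasurable_funD => //; exact: measurable_funeM.
  move=> w _; rewrite nneseries_recl//; apply: leeD.
    by have [[-> _] _ _ _ _] := adm; rewrite /discount mule0 oppe0 expeR0.
  rewrite -(@nneseries_addn _ (fun l => discount r (tau l w)))// -nneseriesZl//.
  by apply: lee_nneseries => n _ //; rewrite addn1; exact: discount_le.
have a0 : (0 <= alpha%:E)%E by rewrite lee_fin ltW.
rewrite ge0_integralD//; [|by move=> w _; rewrite mule_ge0|exact: measurable_funeM].
rewrite integral_cst//= mul1e probability_setT ge0_integralZl//.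
apply: lte_add_pinfty; first exact: ltry.
by apply: lte_mul_pinfty.
Qed.

End hitting_optimal.

End verification.

End switching_data.

Theorem theorem1 (d : measure_display) (T : measurableType d) (R : realType)
  (P : probability T R)
  (n : nat) (B : R -> T -> 'rV[R]_n) (hB : brownian_motion P B)
  (m : nat) (m_ge2 : (1 < m)%N) (i1 : 'I_m) (hi1 : nat_of_ord i1 = 0%N)
  (k : nat) (r : R) (r_gt0 : (0 < r)%R)
  (X : R -> T -> 'rV[R]_k)
  (X_prog : progressive (completed_filtration P B)
     (X : R -> T -> g_sigma_algebraType (@open 'rV[R]_k)))
  (X_cont : continuous_process X)
  (g : 'I_m -> 'I_m -> 'rV[R]_k -> R)
  (g_cont : forall i j, i != j -> continuous (g i j))
  (alpha : R) (alpha_gt0 : (0 < alpha)%R)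
  (g_bounds : forall i j x, i != j -> (alpha^-1 <= g i j x <= alpha)%R)
  (psi : 'I_m -> 'rV[R]_k -> R)
  (psi_cont : forall i, continuous (psi i))
  (C gamma : R)
  (psi_growth : forall i x, (`|psi i x| <= C * (1 + `|x| `^ gamma))%R)
  (psi_M2 : forall i,
     spaceM2 P (completed_filtration P B) (discounted_profit r X psi i))
  (psi_wd : forall i, well_defined_profit P r X psi i)
  (Y : 'I_m -> R -> T -> R)
  (hY : solves_switching_system P (completed_filtration P B) r X psi g Y) :
  let F := completed_filtration P B in
  let J := total_profit P r X psi g in
  {ae P, forall w,
     (Y i1 0%R w)%:E = ereal_sup [set J s | s in admissible F i1]} /\
  ((exists s, hitting_strategy F X g i1 Y s) /\
   forall s, hitting_strategy F X g i1 Y s ->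
   [/\ admissible F i1 s,
       \int[P]_w (\sum_(0 <= l <oo) discount r (stime s l w)) < +oo &
       forall s', admissible F i1 s' -> J s' <= J s]).
Proof.
move=> F J.
have sF := filtration_sigma P B; have Fm := filtration_measurable hB.
have Fmono := @filtration_mono _ _ _ P _ B.
have J_le s : admissible F i1 s -> J s <= (\int[P]_w Y i1 0%R w)%R%:E.
  exact: (total_profit_le sF Fm Fmono m_ge2 r_gt0 X_prog X_cont g_cont alpha_gt0 g_bounds
    psi_cont psi_M2 psi_wd hY).
have hit_adm s : hitting_strategy F X g i1 Y s -> admissible F i1 s.
  exact: (hitting_admissible sF Fm Fmono m_ge2 X_prog X_cont g_cont hY).
have J_eq s : hitting_strategy F X g i1 Y s -> J s = (\int[P]_w Y i1 0%R w)%R%:E.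
  move=> hs; exact: (hitting_total_profit sF Fm Fmono m_ge2 r_gt0 X_prog X_cont g_cont
    alpha_gt0 g_bounds psi_cont psi_M2 psi_wd hY (hit_adm s hs) hs).
(* Existence also serves the first claim: a hitting strategy attains the upper bound [J_le], which
   is thus the supremum. *)
have [s0 hs0] := hitting_strategy_ex sF Fm Fmono m_ge2 X_prog X_cont g_cont hY i1.
have supE : ereal_sup [set J s | s in admissible F i1] = (\int[P]_w Y i1 0%R w)%R%:E.
  apply/eqP; rewrite eq_le; apply/andP; split.
    by apply: ge_ereal_sup => _ [s As <-]; exact: J_le.
  by rewrite -(J_eq _ hs0); apply: ereal_sup_ubound; exists s0 => //; exact: hit_adm.
split; last first.
  split; first by exists s0.
  move=> s hs; split; first exact: hit_adm.
    exact: (hitting_summable sF Fm Fmono m_ge2 r_gt0 X_prog X_cont g_cont alpha_gt0 g_bounds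
      psi_cont psi_M2 psi_wd hY (hit_adm s hs) hs).
  by move=> s' As'; rewrite (J_eq _ hs); exact: J_le.
have iY : P.-integrable setT (EFin \o Y i1 0%R).
  have := itg_y (switching_osp sF Fm Fmono m_ge2 r_gt0 X_prog X_cont g_cont alpha_gt0 g_bounds
    psi_cont psi_M2 psi_wd hY i1) 0%R.
  by rewrite /dvalue /frozen maxxx mulr0 oppr0 expR0; under [X in EFin \o X]funext do rewrite mul1r.
have mY := Y_adapted sF Fmono hY (lexx 0%R) (lexx 0%R) i1.
have := trivial_constant (sF 0%R) (Fm 0%R) (filtration0_trivial hB) mY iY.
by apply: filterS => w ->; rewrite supE.
Qed.
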